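(* On the holomorphic anti-canonical line bundle $\omega^{-1}_{\mathbb{CP}^1}$ there exists an integrable meromorphic connection $\nabla$ with regular singular points $u_1^*,\dots,u_K^*,\infty$ such that the restriction of $\omega^{-1}_{\mathbb{CP}^1}$ (with $\nabla$) to $\overset{\circ}{\mathrm{UP}}$ is isomorphic to the flat determinant line bundle $(\mathrm{DET}\,\mathrm D)^*\to\overset{\circ}{\mathrm{UP}}$ of the signature operator along the fiber of $\mathrm Z\to\overset{\circ}{\mathrm{UP}}$. The curvature $\Omega$ of $\nabla$ (as a current on $\mathbb{CP}^1$) equals $$\frac{i\,\Omega}{2\pi}=\sum_{n=1}^{K}\frac{k_n}{6}\,\delta(u-u_n^* )\,du\wedge d\bar u+\frac{10-N_f}{6}\,\delta(v)\,dv\wedge d\bar v ,$$ whence $\int_{\mathbb{CP}^1}i\,\Omega/(2\pi)=2$.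
   Context: Setting. Fix $N_f\in\{0,1,2,3,4\}$. $\mathrm Z\to\mathbb{CP}^1$ is a Jacobian rational elliptic surface with singular fibers of Kodaira type $I_{k_n}$ over $[u_n^*:1]$, $1\le n\le K$, with $\sum_{n=1}^Kk_n=N_f+2$, and a singular fiber of Kodaira type $I^*_{4-N_f}$ over $u=\infty$. It has a Weierstrass presentation $E_u:\ y_u^2=4x_u^3-g_2(u)x_u-g_3(u)$, with $g_2,g_3\in\mathbb C[u]$ of degrees at most $2$ and $3$; the discriminant $\mathbf\Delta_u=g_2^3-27g_3^2$ has degree $N_f+2$ and a zero of order $k_n$ at $u_n^*$. Near infinity one uses $v$ with $u=-1/v$, in which the discriminant is $\mathbf\Delta_v=v^{12}\mathbf\Delta_u$ and $dz_u=dx_u/y_u=-v\,dz_v$. $\overset{\circ}{\mathrm{UP}}$ denotes $\mathbb{CP}^1$ with small open discs around $u_1^*,\dots,u_K^*,\infty$ removed. The signature operator along the fiber is $\mathrm D=\bar\partial+\bar\partial_1:\Omega^{0,0}(E_u)\oplus\Omega^{1,0}(E_u)\to\Omega^{0,1}(E_u)\oplus\Omega^{1,1}(E_u)$. Its determinant line bundle $\mathrm{DET}\,\mathrm D$ has fibers $[H^{0,0}(E_u)\otimes H^{1,0}(E_u)]^{-1}\otimes[H^{0,1}(E_u)\otimes H^{1,1}(E_u)]\cong[H^{1,0}(E_u)]^{-2}$, so that $(dz)^2$, $dz=dx/y$, is a holomorphic frame of the dual $(\mathrm{DET}\,\mathrm D)^*$. On $(\mathrm{DET}\,\mathrm D)^*$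 one uses the flat connection dual to the Bismut-Freed connection (the unitary connection of the Quillen metric compatible with the holomorphic structure, for which $\nabla^{\mathrm{BF}}(dz)^{-2}=\frac16\frac{d\mathbf\Delta}{\mathbf\Delta}\otimes(dz)^{-2}$); equivalently the connection for which the (multivalued) section $\mathbf\Delta^{1/6}(dz)^2$ is parallel. ''Isomorphic'' means isomorphic as flat holomorphic line bundles with connection. The curvature of a meromorphic connection is taken in the sense of currents: if $\nabla e=A\otimes e$ for a local holomorphic frame $e$ and meromorphic one-form $A$ with simple poles, then $\Omega=dA$ as a current. $\delta(u-u_n^* )\,du\wedge d\bar u$ (resp. $\delta(v)\,dv\wedge d\bar v$) denotes the Dirac current at $u_n^*$ (resp. at $v=0$), pairing with a function $f$ to its value at that point. *)

(* Defs.v *)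
From HB Require Import structures.
From mathcomp Require Import all_boot all_order all_algebra.
From mathcomp Require Import complex ring.
From mathcomp Require Import all_classical all_reals all_analysis.
Set Implicit Arguments.
Unset Strict Implicit.
Unset Printing Implicit Defensive.
Import Order.TTheory GRing.Theory Num.Theory.
Import numFieldNormedType.Exports.
Local Open Scope classical_set_scope.
Local Open Scope ring_scope.

(* R[i] itself carries no topology; as a numClosedFieldType it gets the one of
   its norm, together with complex derivatives (derivable, derive1). *)
Definition Cplx (R : realType) : numClosedFieldType := R[i].

Section dual_and_inverse_square.
Variables (K : fieldType) (V : lmodType K).

Definition is_dual : {pred V -> K^o} := fun l => `[< linear l >].

Record dual := Dual { dual_fun :> V -> K^o; _ : dual_fun \in is_dual }.

HB.instance Definition _ := [isSub for dual_fun].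
HB.instance Definition _ := [Choice of dual by <:].

Lemma is_dual_submod_closed : submod_closed is_dual.
Proof.
split=> [|c f g /asboolP lf /asboolP lg]; apply/asboolP => a x y.
  by rewrite /= scaler0 addr0.
rewrite !fctE /= [f _]lf [g _]lg !scalerDr !scalerA [c * a]mulrC !addrA.
by congr (_ + _); rewrite -!addrA; congr (_ + _); rewrite addrC.
Qed.

HB.instance Definition _ :=
  GRing.isSubmodClosed.Build _ _ is_dual is_dual_submod_closed.
HB.instance Definition _ := [SubChoice_isSubLmodule of dual by <:].

(* For a line V, the bilinear forms on V are the line V^{-2}. *)
Definition is_bilinear_form : {pred V * V -> K^o} := fun B =>
  `[< forall x, linear (fun y => B (x, y)) /\ linear (fun y => B (y, x)) >].

Record inverse_square := InverseSquare {
  bilinear_fun :> V * V -> K^o; _ : bilinear_fun \in is_bilinear_form }.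

HB.instance Definition _ := [isSub for bilinear_fun].
HB.instance Definition _ := [Choice of inverse_square by <:].

Lemma is_bilinear_form_submod_closed : submod_closed is_bilinear_form.
Proof.
split=> [|c f g /asboolP bf /asboolP bg]; apply/asboolP => x.
  by split=> a y z; rewrite /= scaler0 addr0.
have [lf rf] := bf x; have [lg rg] := bg x.
split=> a y z; rewrite !fctE /=.
  rewrite [f _]lf [g _]lg !scalerDr !scalerA [c * a]mulrC !addrA.
  by congr (_ + _); rewrite -!addrA; congr (_ + _); rewrite addrC.
rewrite [f _]rf [g _]rg !scalerDr !scalerA [c * a]mulrC !addrA.
by congr (_ + _); rewrite -!addrA; congr (_ + _); rewrite addrC.
Qed.

HB.instance Definition _ :=
  GRing.isSubmodClosed.Build _ _ is_bilinear_form is_bilinear_form_submod_closed.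
HB.instance Definition _ := [SubChoice_isSubLmodule of inverse_square by <:].

(* For v in a line V, the element v (x) v of V^{2} = (V^{-2})^*. *)
Lemma square_subproof (v : V) :
  (fun B : inverse_square => B (v, v) : K^o)
    \in (fun l : inverse_square -> K^o => `[< linear l >]).
Proof. by apply/asboolP. Qed.

End dual_and_inverse_square.

Definition square (K : fieldType) (V : lmodType K) (v : V) :
  dual (inverse_square V) := Dual (square_subproof v).

Section complex_plane.
Variable R : realType.
Local Notation C := (Cplx R).

(* All complex derivatives exist on V; by Goursat's theorem this is the same as
   asking for the first one when V is open. *)
Definition holomorphic (V : set C) (f : C -> C) : Prop :=
  forall n z, V z -> derivable (derive1n n f) z 1.

Lemma holomorphic_lin (V : set C) (c : C) (f g : C -> C) : open V ->
  holomorphic V f -> holomorphic V g ->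
  holomorphic V (fun z => c * f z + g z).
Proof.
move=> oV hf hg.
have E n z : V z -> derive1n n (fun z => c * f z + g z) z =
    c * derive1n n f z + derive1n n g z.
  elim: n z => [//|n IHn] z Vz.
  rewrite !derive1nS !derive1E.
  have eqn : \near z, derive1n n (fun z => c * f z + g z) z =
      ((c *: (derive1n n f : C -> C^o)) + (derive1n n g : C -> C^o)) z.
    by near=> w; apply: IHn; near: w; exact: open_nbhs_nbhs.
  rewrite (near_eq_derive _ eqn) deriveD; [|exact/derivableZ/hf|exact: hg].
  by rewrite deriveZ//; exact: hf.
move=> n z Vz.
have eqn : \near z, ((c *: (derive1n n f : C -> C^o)) +
    (derive1n n g : C -> C^o)) z = derive1n n (fun z => c * f z + g z) z.
  by near=> w; rewrite E//; near: w; exact: open_nbhs_nbhs.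
apply: (near_eq_derivable eqn).
by apply: derivableD; [exact/derivableZ/hf|exact: hg].
Unshelve. all: by end_near. Qed.

Lemma holomorphic_zero (V : set C) : holomorphic V (fun=> 0).
Proof.
have E n : derive1n n (fun=> 0 : C) = (fun=> 0 : C).
  elim: n => // n IHn; rewrite derive1nS IHn; apply/funext => t.
  exact: derive1_cst.
by move=> n z _; rewrite E; exact: derivable_cst.
Qed.

Definition meromorphic_at (f : C -> C) (p : C) : Prop :=
  exists (m : nat) (V : set C) (h : C -> C), [/\ open V, V p, holomorphic V h &
    forall z, V z -> z != p -> f z = h z / (z - p) ^+ m].

Definition simple_pole (f : C -> C) (p : C) : Prop :=
  exists (V : set C) (h : C -> C), [/\ open V, V p, holomorphic V h, h p != 0 &
    forall z, V z -> z != p -> f z = h z / (z - p)].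

Definition re (z : C) : R := complex.Re z.
Definition im (z : C) : R := complex.Im z.

(* Real partial derivatives in z = x + iy. *)
Definition dx (F : C -> C) (z : C) : C :=
  Complex (derive1 (fun t : R => re (F (z + Complex t 0))) 0)
          (derive1 (fun t : R => im (F (z + Complex t 0))) 0).
Definition dy (F : C -> C) (z : C) : C :=
  Complex (derive1 (fun t : R => re (F (z + Complex 0 t))) 0)
          (derive1 (fun t : R => im (F (z + Complex 0 t))) 0).
Definition dbar (F : C -> C) (z : C) : C := (dx F z + 'i * dy F z) / 2.

Fixpoint Cn (n : nat) (F : C -> C) : Prop :=
  continuous F /\
  if n is m.+1 then
    [/\ forall z, [/\ derivable (fun t : R => re (F (z + Complex t 0))) 0 1,
                      derivable (fun t : R => im (F (z + Complex t 0))) 0 1,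
                      derivable (fun t : R => re (F (z + Complex 0 t))) 0 1 &
                      derivable (fun t : R => im (F (z + Complex 0 t))) 0 1],
        Cn m (dx F) & Cn m (dy F)]
  else True.

Definition smooth (F : C -> C) : Prop := forall n, Cn n F.

(* Integral over the complex plane against Lebesgue measure dx dy. *)
Definition plane_integral (F : C -> C) : C :=
  let mu := (lebesgue_measure \x lebesgue_measure)%E in
  Complex (Rintegral mu setT (fun p : R * R => re (F (Complex p.1 p.2))))
          (Rintegral mu setT (fun p : R * R => im (F (Complex p.1 p.2)))).

(* The current d(a dz) on a compactly supported function F: the integral of
   (a dz) /\ dF = a (dx + i dy) /\ (F_x dx + F_y dy). *)
Definition exterior_derivative (a F : C -> C) : C :=
  plane_integral (fun z => a z * (dy F z - 'i * dx F z)).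

End complex_plane.

Section projective_line.
Variable R : realType.
Local Notation C := (Cplx R).

(* Some u is the point [u : 1] and None is the point at infinity; the second
   chart has coordinate v with u = - 1/v. *)
Definition CP1 : Type := option C.

Variant chart := chart_u | chart_v.

Definition pt (c : chart) (z : C) : CP1 :=
  match c with
  | chart_u => Some z
  | chart_v => if z == 0 then None else Some (- z^-1)
  end.

Definition smooth_CP1 (f : CP1 -> C) : Prop := forall c, smooth (f \o pt c).

Definition chart_disc (c : chart) (z : C) (r : R) : set CP1 :=
  [set p | exists2 w : C, `|w - z| < r%:C%C & p = pt c w].

(* A cotangent vector at p is given by its components in du and in dv (0 if p
   is not in that chart), related by alpha_u du = alpha_v dv. *)
Definition is_cotangent (p : CP1) : {pred chart -> C^o} := fun alpha =>
  `[< match p with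
      | None => alpha chart_u = 0
      | Some u => if u == 0 then alpha chart_v = 0
                  else alpha chart_u = alpha chart_v * derive1 (fun t : C => - t^-1) u
      end >].

Record cotangent (p : CP1) := Cotangent {
  components :> chart -> C^o; _ : components \in is_cotangent p }.

HB.instance Definition _ p := [isSub for @components p].
HB.instance Definition _ p := [Choice of cotangent p by <:].

Lemma is_cotangent_submod_closed p : submod_closed (is_cotangent p).
Proof.
split=> [|c f g /asboolP hf /asboolP hg]; apply/asboolP.
  by case: p => [u|//]; case: ifP => _ //=; rewrite mul0r.
rewrite !fctE /=.
case: p hf hg => [u|]; last by move=> -> ->; rewrite scaler0 addr0.
case: ifP => _ -> ->; first by rewrite scaler0 addr0.
by rewrite mulrDl scalerAl.
Qed.

HB.instance Definition _ p :=
  GRing.isSubmodClosed.Build _ _ (is_cotangent p) (is_cotangent_submod_closed p).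
HB.instance Definition _ p := [SubChoice_isSubLmodule of cotangent p by <:].

Definition anticanonical (p : CP1) : lmodType C := dual (cotangent p).

Lemma coordinate_vector_subproof (c : chart) (p : CP1) :
  (fun alpha : cotangent p => alpha c : C^o) \in @is_dual C (cotangent p).
Proof. by apply/asboolP. Qed.

(* The coordinate vector field of the chart c: a frame of the anti-canonical
   bundle over that chart (its value is 0 outside). *)
Definition coordinate_vector (c : chart) (p : CP1) : anticanonical p :=
  Dual (coordinate_vector_subproof c p).

End projective_line.

Section connections.
Variable R : realType.
Local Notation C := (Cplx R).

(* A connection on a bundle framed over an open subset of a chart is given by
   its connection form a dz, i.e. nabla e = a dz (x) e for the frame e. In that
   frame, nabla (f e) = (covariant_derivative a f) dz (x) e. *)
Definition covariant_derivative (a f : C -> C) (z : C) : C :=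
  derive1 f z + a z * f z.

(* A meromorphic connection on the anti-canonical bundle, in terms of its forms
   in the frames d/du and d/dv. The last clause says that both forms define the
   same nabla s (d/dv) on the sections s over open sets of the overlap which do
   not contain points of S; here d/dv = (du/dv) d/du on the overlap. *)
Definition meromorphic_connection (S : set (CP1 R)) (a : chart -> C -> C) : Prop :=
  (forall c z, meromorphic_at (a c) z) /\
  forall (W : set C) (f g : C -> C),
    open W -> (forall v, W v -> v != 0 /\ ~ S (pt chart_v v)) ->
    holomorphic W g -> holomorphic [set - v^-1 | v in W] f ->
    (forall v, W v ->
      f (- v^-1) *: coordinate_vector chart_u (pt chart_v v) =
      g v *: coordinate_vector chart_v (pt chart_v v)) ->
    forall v, W v ->
      covariant_derivative (a chart_v) g v *: coordinate_vector chart_v (pt chart_v v) =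
      derive1 (fun t : C => - t^-1) v *:
        (covariant_derivative (a chart_u) f (- v^-1) *:
           coordinate_vector chart_u (pt chart_v v)).

(* The curvature d(a dz) vanishes off the singular points. *)
Definition integrable_connection (S : set (CP1 R)) (a : chart -> C -> C) : Prop :=
  forall c z, ~ S (pt c z) -> dbar (a c) z = 0.

Definition regular_singular_points (S : set (CP1 R)) (a : chart -> C -> C) : Prop :=
  (forall c, holomorphic [set z | ~ S (pt c z)] (a c)) /\
  (forall c z, S (pt c z) -> simple_pole (a c) z).

Definition supported_in (c : chart) (f : CP1 R -> C) : Prop :=
  exists r : R, forall p, (forall z : C, `|z| <= r%:C%C -> p <> pt c z) -> f p = 0.

Definition current (Om : (CP1 R -> C) -> C) : Prop :=
  (forall (k : C) f g, smooth_CP1 f -> smooth_CP1 g ->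
     Om (fun p => k * f p + g p) = k * Om f + Om g) /\
  (exists (M : R) (N : nat), forall f (B : R), smooth_CP1 f ->
     (forall c (z : C) i j, `|z| <= 1 -> (i + j <= N)%N ->
        `|iter i (@dx R) (iter j (@dy R) (f \o pt c)) z| <= B%:C%C) ->
     `|Om f| <= (M * B)%:C%C).

(* The curvature of a connection as a current: d(a dz) in each chart. By
   partitions of unity there is only one such current. *)
Definition curvature_current (a : chart -> C -> C) (Om : (CP1 R -> C) -> C) : Prop :=
  current Om /\
  forall c f, smooth_CP1 f -> supported_in c f ->
    Om f = exterior_derivative (a c) (f \o pt c).

(* A holomorphic line bundle with connection over an open set of the u-plane:
   fibers, holomorphic frame, connection form in that frame. *)
Record framed_bundle := FramedBundle {
  fiber : C -> lmodType C;
  frame : forall u, fiber u;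
  connection_form : C -> C }.

Definition flat_line_bundle (U : set C) (E : framed_bundle) : Prop :=
  (forall u, U u -> forall s : fiber E u, exists! k : C, s = k *: frame E u) /\
  holomorphic U (connection_form E).

(* Isomorphism over a subset X of CP1 not containing infinity, on which the
   bundles are understood to be given in a neighborhood. *)
Definition flat_isomorphic (X : set (CP1 R)) (E F : framed_bundle) : Prop :=
  exists U : set C, [/\ open U, X `<=` Some @` U,
    flat_line_bundle U E, flat_line_bundle U F &
    exists Phi : forall u, fiber E u -> fiber F u,
      (forall u, U u -> linear (Phi u) /\ bijective (Phi u)) /\
      forall (W : set C) (f : C -> C), open W -> W `<=` U -> holomorphic W f ->
        exists g : C -> C, [/\ holomorphic W g,
          forall u, W u -> Phi u (f u *: frame E u) = g u *: frame F u &
          forall u, W u ->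
            Phi u (covariant_derivative (connection_form E) f u *: frame E u) =
            covariant_derivative (connection_form F) g u *: frame F u]].

Definition restricted_anticanonical (a : chart -> C -> C) : framed_bundle :=
  {| fiber := fun u => anticanonical (Some u);
     frame := fun u => coordinate_vector chart_u (Some u);
     connection_form := a chart_u |}.

End connections.

Section elliptic_curve.
Variable R : realType.
Local Notation C := (Cplx R).
Variables a b : C.

Local Notation C3 := (C^o * C^o * C^o)%type.

(* Homogeneous coordinates (X, Y, Z) for the curve y^2 = 4 x^3 - a x - b:
   the affine cone over it, and the tangent vectors w to the cone at P. *)
Definition on_cone (P : C3) : Prop :=
  let: (X, Y, Z) := P in
  P != 0 /\ Y ^+ 2 * Z = 4 * X ^+ 3 - a * X * Z ^+ 2 - b * Z ^+ 3.

Definition tangent (P w : C3) : Prop :=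
  let: (X, Y, Z) := P in let: (X', Y', Z') := w in
  2 * Y * Y' * Z + Y ^+ 2 * Z' =
  12 * X ^+ 2 * X' - a * (X' * Z ^+ 2 + 2 * X * Z * Z') - 3 * b * Z ^+ 2 * Z'.

(* H^{1,0}: holomorphic one-forms om on the projective curve, written as
   one-forms (P, w) |-> om (P, w) on the punctured cone which are pulled back
   from the curve (they vanish on the radial direction and are invariant under
   scaling) and whose pullbacks by holomorphic arcs are holomorphic. Their
   value is set to 0 at pairs (P, w) which are not tangent to the cone. *)
Definition is_H10 : {pred C3 * C3 -> C^o} := fun om => `[<
  [/\ forall P w, ~ (on_cone P /\ tangent P w) -> om (P, w) = 0,
      forall P w w' (k : C), on_cone P -> tangent P w -> tangent P w' ->
        om (P, k *: w + w') = k * om (P, w) + om (P, w'),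
      forall P, on_cone P -> om (P, P) = 0,
      forall P w (k : C), on_cone P -> tangent P w -> k != 0 ->
        om (k *: P, k *: w) = om (P, w) &
      forall (V : set C) (X Y Z : C -> C), open V ->
        holomorphic V X -> holomorphic V Y -> holomorphic V Z ->
        (forall t, V t -> on_cone (X t, Y t, Z t)) ->
        holomorphic V (fun t =>
          om ((X t, Y t, Z t), (derive1 X t, derive1 Y t, derive1 Z t)))] >].

Record H10 := HolomorphicForm { form_fun :> C3 * C3 -> C^o; _ : form_fun \in is_H10 }.

HB.instance Definition _ := [isSub for form_fun].
HB.instance Definition _ := [Choice of H10 by <:].

Lemma is_H10_submod_closed : submod_closed is_H10.
Proof.
split=> [|c f g /asboolP[f1 f2 f3 f4 f5] /asboolP[g1 g2 g3 g4 g5]]; apply/asboolP.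
  split=> [P w _|P w w' k _ _ _|P _|P w k _ _ _|V X Y Z _ _ _ _ _].
  - reflexivity.
  - by rewrite -[RHS]/(k * 0 + 0 : C) mulr0 addr0.
  - reflexivity.
  - reflexivity.
  - exact: holomorphic_zero.
have fgE x : (c *: f + g) x = c * f x + g x by [].
split=> [P w Pw|P w w' k Pc Pw Pw'|P Pc|P w k Pc Pw k0|V X Y Z oV hX hY hZ XYZ].
- by rewrite fgE (f1 _ _ Pw) (g1 _ _ Pw) mulr0 addr0.
- rewrite !fgE (f2 _ _ _ _ Pc Pw Pw') (g2 _ _ _ _ Pc Pw Pw').
  by rewrite !mulrDr addrACA mulrCA.
- by rewrite fgE (f3 _ Pc) (g3 _ Pc) mulr0 addr0.
- by rewrite !fgE (f4 _ _ _ Pc Pw k0) (g4 _ _ _ Pc Pw k0).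
- have := holomorphic_lin (c := c) oV (f5 V X Y Z oV hX hY hZ XYZ)
                               (g5 V X Y Z oV hX hY hZ XYZ).
  by congr holomorphic; apply/funext => t; rewrite fgE.
Qed.

HB.instance Definition _ :=
  GRing.isSubmodClosed.Build _ _ is_H10 is_H10_submod_closed.
HB.instance Definition _ := [SubChoice_isSubLmodule of H10 by <:].

(* The holomorphic form which is dx / y = (Z dX - X dZ) / (Y Z) where Y Z != 0;
   it exists and is unique when the curve is smooth. *)
Definition dz : H10 := xget 0 [set om : H10 | forall X Y Z X' Y' Z' : C,
  on_cone (X, Y, Z) -> tangent (X, Y, Z) (X', Y', Z') -> Y * Z != 0 ->
  om ((X, Y, Z), (X', Y', Z')) = (Z * X' - X * Z') / (Y * Z)].

End elliptic_curve.

Section elliptic_surface.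
Variable R : realType.
Local Notation C := (Cplx R).

Definition discriminant (g2 g3 : {poly C}) : {poly C} := g2 ^+ 3 - 27 *: g3 ^+ 2.

(* Kodaira types of the fiber over t of y^2 = 4 x^3 - a x - b, read off the
   vanishing orders of (a, b, discriminant) in Kodaira's table. *)
Definition kodaira_I (k : nat) (a b : {poly C}) (t : C) : Prop :=
  [/\ (0 < k)%N, ~~ root a t, ~~ root b t, discriminant a b != 0 &
      mup t (discriminant a b) = k].

Definition kodaira_I_star (k : nat) (a b : {poly C}) (t : C) : Prop :=
  [/\ ('X - t%:P) ^+ 2 %| a, ('X - t%:P) ^+ 3 %| b, discriminant a b != 0,
      mup t (discriminant a b) = (6 + k)%N &
      (0 < k)%N -> ~~ (('X - t%:P) ^+ 3 %| a) /\ ~~ (('X - t%:P) ^+ 4 %| b)].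

(* v^d g(- 1/v) as a polynomial in v, for g of degree at most d. *)
Definition at_infinity (d : nat) (g : {poly C}) : {poly C} :=
  \poly_(i < d.+1) ((-1) ^+ (d - i) * g`_(d - i)).

(* The Weierstrass presentation of a Jacobian rational elliptic surface: in the
   coordinate v the coefficients are v^4 g2 and v^6 g3, so that the
   discriminant is multiplied by v^12. *)
Record rational_elliptic_surface (Nf K : nat) (us : 'I_K -> C) (k : 'I_K -> nat)
    (g2 g3 : {poly C}) : Prop := RationalEllipticSurface {
  Nf_le4 : (Nf <= 4)%N;
  size_g2 : (size g2 <= 3)%N;
  size_g3 : (size g3 <= 4)%N;
  size_discriminant : size (discriminant g2 g3) = Nf.+3;
  us_inj : injective us;
  sum_k : (\sum_n k n = Nf + 2)%N;
  fiber_us : forall n, kodaira_I (k n) g2 g3 (us n);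
  fiber_infinity : kodaira_I_star (4 - Nf) (at_infinity 4 g2) (at_infinity 6 g3) 0 }.

(* CP1 without the open discs of radii r n around us n and r' around v = 0. *)
Definition UP (K : nat) (us : 'I_K -> C) (r : 'I_K -> R) (r' : R) : set (CP1 R) :=
  ~` ((\bigcup_n chart_disc chart_u (us n) (r n)) `|` chart_disc chart_v 0 r').

(* DET D has the fibers [H^{0,0} (x) H^{1,0}]^{-1} (x) [H^{0,1} (x) H^{1,1}] for
   the signature operator D along E_u. By Serre duality and since H^{0,0} is the
   constants, this is [H^{1,0}(E_u)]^{-2}. In the frame (dz)^{-2} the connection
   form of the Bismut-Freed connection is (1/6) d Delta / Delta; the dual
   connection has the opposite form in the dual frame (dz)^2. *)
Definition DET (g2 g3 : {poly C}) (u : C) : lmodType C :=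
  inverse_square (H10 g2.[u] g3.[u]).

Definition bismut_freed (g2 g3 : {poly C}) (u : C) : C :=
  (discriminant g2 g3)^`().[u] / (6 * (discriminant g2 g3).[u]).

Definition dual_DET (g2 g3 : {poly C}) : framed_bundle R :=
  {| fiber := fun u => dual (DET g2 g3 u);
     frame := fun u => square (dz g2.[u] g3.[u]);
     connection_form := fun u => - bismut_freed g2 g3 u |}.

End elliptic_surface.

Section parallel.
Variable R : realType.
Local Notation C := (Cplx R).

Lemma is_derive_horner (p : {poly C}) (u : C) :
  is_derive u 1 (horner p : C -> C) p^`().[u].
Proof.
elim/poly_ind: p => [|p c IHp].
  rewrite deriv0 horner0 (_ : horner 0 = cst 0); first exact: is_derive_cst.
  by apply/funext => t; rewrite horner0.
have -> : horner (p * 'X + c%:P) = (fun t => p.[t] * t) + cst c.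
  by apply/funext => t; rewrite !hornerE.
apply: is_derive_eq.
rewrite derivD derivC addr0 derivM derivX mulr1 !hornerE.
by rewrite /GRing.scale/= mulr1 addrC [u * _]mulrC.
Qed.

(* The connection on the dual of DET D is the one for which the multivalued
   section Delta^{1/6} (dz)^2 is parallel. *)
Lemma dual_DET_parallel (g2 g3 : {poly C}) (W : set C) (h : C -> C) :
  open W -> (forall u, W u -> (discriminant g2 g3).[u] != 0) ->
  holomorphic W h -> (forall u, W u -> h u ^+ 6 = (discriminant g2 g3).[u]) ->
  forall u, W u ->
    covariant_derivative (connection_form (dual_DET g2 g3)) h u = 0.
Proof.
move=> oW D0 hh h6 u Wu; set D := discriminant g2 g3 in D0 h6 *.
have dh : is_derive u 1 h ('D_1 h u) by apply/derivableP/(hh 0%N).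
have eqn : \near u, (h ^+ 6) u = D.[u].
  by near=> w; rewrite fctE h6//; near: w; exact: open_nbhs_nbhs.
have eqD : 'D_1 (h ^+ 6) u = 'D_1 (horner D : C -> C) u by exact: near_eq_derive.
move: eqD; rewrite [RHS](@derive_val _ _ _ _ _ _ _ (is_derive_horner D u)).
rewrite [LHS](@derive_val _ _ _ _ _ _ _ (is_deriveX 6 dh)).
rewrite /covariant_derivative /= /bismut_freed -/D derive1E -h6// => <-.
have hu0 : h u != 0 by apply: contraNneq (D0 u Wu) => h0; rewrite -h6// h0 expr0n.
rewrite /GRing.scale/=; have -> : h u ^+ 6 = h u ^+ 5 * h u by rewrite exprSr.
have n6 : (6%:R : C) != 0 by rewrite pnatr_eq0.
field.
Unshelve. all: by end_near. Qed.

End parallel.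

(* Main.v *)
(* Let w be k_n/6 at u_n and (10 - N_f)/6 at infinity. In each of the two charts the
   connection form is the sum of the -w_p/(z - p) dz over the singular points p of the
   chart. The two forms define one connection on the anti-canonical bundle because the
   weights add up to 2: for u = -1/v the forms differ by the logarithmic derivative of
   dv/du. On the u-chart the form is -d Delta/(6 Delta), which is the dual
   Bismut-Freed form. So the isomorphism maps d/du to (dz)^2, once H^{1,0}(E_u) is
   known to be spanned by dz = dx/y. For that, write a holomorphic form as r dx/y.
   The function r is bounded near the branch points and tends to a constant c at
   infinity, so the sum and the product of r - c at (x, y) and (x, -y) are functions
   of x which vanish by the maximum principle; hence r = c.
   The curvature current is computed by the Cauchy-Pompeiu formula: d of dz/(z - p) as
   a current is 2 pi i times the Dirac current at p. Its real and imaginary parts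
   come from integrating by parts against log |z - p| and against the angle of z - p,
   where the angle jumps along a line and these jumps produce the value at p. *)
Require Import Defs.
From mathcomp Require Import all_boot all_order all_algebra.
From mathcomp Require Import complex ring lra.
From mathcomp Require Import all_classical all_reals all_analysis measurable_realfun.
Import Order.TTheory GRing.Theory Num.Theory.
Import numFieldNormedType.Exports.
Local Open Scope classical_set_scope.
Local Open Scope ring_scope.
Set Implicit Arguments.
Unset Strict Implicit.
Unset Printing Implicit Defensive.

(** A form in [H10] is controlled only through its pullbacks to holomorphic arcs, so its behaviour
    at the branch points and at infinity is read off explicit arcs, x = e + s^2 and X = s, Z = s^3;
    these need local holomorphic square roots. No contour integrals are used: the maximum principle
    comes from the second-derivative test along real lines, and it is applied to a function that is
    visibly continuous at the branch points. Since [dz] is chosen with default 0, a form dx/y also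
    has to be constructed; otherwise (dz)^2 might vanish and be no frame. For the curvature,
    Fubini's theorem and integration by parts along horizontal and vertical lines replace Stokes'
    theorem; the line through the pole is negligible. This needs absolute integrability of the
    kernel, which holds because its slices have primitive atan. The angle enters through the
    branches atan ((y - y0) / (x - x0)) and atan ((x - x0) / (y - y0)), whose sum is pi/2 times a
    product of two signs; each sign yields a factor 2 at its jump, whence 2 pi. *)

Lemma is_derive_mul (K : numFieldType) (f g : K -> K) (z a b : K) :
  is_derive z 1 f a -> is_derive z 1 g b ->
  is_derive z 1 (fun w => f w * g w) (a * g z + f z * b).
Proof.
move=> ha hb; have h := is_deriveM ha hb; apply: is_derive_eq.
by rewrite /GRing.scale /= addrC [g z * a]mulrC.
Qed.

Lemma is_derive_inv (K : numFieldType) (f : K -> K) (z a : K) :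
  f z != 0 -> is_derive z 1 f a ->
  is_derive z 1 (fun w => (f w)^-1) (- a * (f z)^-1 * (f z)^-1).
Proof.
move=> f0 ha; apply: DeriveDef; first exact: (derivableV f0 _).
rewrite (deriveV f0) // derive_val /GRing.scale /=.
by rewrite -exprVn expr2 mulNr !mulNr mulrC mulrA.
Qed.

(** * Algebra of holomorphic functions *)

Section holomorphic_algebra.
Variable R : realType.
Local Notation C := (Cplx R).
Implicit Types (V : set C) (f g : C -> C) (z c : C).

Lemma is_derive1E f z c : is_derive z 1 f c -> derive1 f z = c.
Proof. by rewrite derive1E => h; rewrite derive_val. Qed.

Lemma derivable_is_derive1 f z : derivable f z 1 -> is_derive z 1 f (derive1 f z).
Proof. by rewrite derive1E => /derivableP. Qed.

Lemma is_derive_on V f g z c : open V -> V z -> (forall w, V w -> f w = g w) ->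
  is_derive z 1 f c -> is_derive z 1 g c.
Proof.
move=> oV Vz fg; apply: near_eq_is_derive.
by near=> w; apply: fg; near: w; exact: open_nbhs_nbhs.
Unshelve. all: by end_near. Qed.

Lemma derive1_on V f g z : open V -> (forall w, V w -> f w = g w) -> V z ->
  derive1 f z = derive1 g z.
Proof.
move=> oV fg Vz; rewrite !derive1E; apply: near_eq_derive.
by near=> w; apply/fg; near: w; exact: open_nbhs_nbhs.
Unshelve. all: by end_near. Qed.

(** Truncation of [holomorphic] to n derivatives. The closure lemmas go by induction on n: the
    derivative of a product, inverse or composite is built from the same functions and their
    derivatives, and one derivative fewer is then required of them. *)
Definition holn n V f := forall m z, (m < n)%N -> V z -> derivable (derive1n m f) z 1.

Lemma holnS n V f : holn n.+1 V f <->
  (forall z, V z -> derivable f z 1) /\ holn n V (derive1 f).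
Proof.
split=> [h|[h0 h]].
  split=> [z Vz|m z mn Vz]; first exact: (h 0%N).
  by rewrite -derive1Sn; exact: h.
by move=> [|m] z mn Vz; [exact: h0|rewrite derive1Sn; exact: h].
Qed.

Lemma holomorphicP V f : holomorphic V f <-> forall n, holn n V f.
Proof. by split=> h n => [m|] z; [move=> _; exact: h|move=> Vz; exact: (h n.+1)]. Qed.

Lemma holn_on n V f g : open V -> (forall w, V w -> f w = g w) ->
  holn n V f -> holn n V g.
Proof.
move=> oV; elim: n f g => [|n IHn] f g fg; first by move=> _ m z.
move=> /holnS[d h]; apply/holnS; split.
  move=> z Vz; have := derivable_is_derive1 (d _ Vz).
  by move/(is_derive_on oV Vz fg) => [].
by apply: IHn h => w Vw; exact: (derive1_on oV fg).
Qed.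

Lemma holnW n V f : holn n.+1 V f -> holn n V f.
Proof. by move=> h m z mn; apply: h; exact: ltnW. Qed.

Lemma holnD n V f g : open V -> holn n V f -> holn n V g ->
  holn n V (fun z => f z + g z).
Proof.
move=> oV; elim: n f g => [|n IHn] f g; first by move=> _ _ m z.
move=> /holnS[df hf] /holnS[dg hg].
apply/holnS; split=> [z Vz|]; first exact: (derivableD (df _ Vz) (dg _ Vz)).
apply: (holn_on oV _ (IHn _ _ hf hg)) => w Vw; apply/esym/is_derive1E.
exact: (is_deriveD (derivable_is_derive1 (df _ Vw)) (derivable_is_derive1 (dg _ Vw))).
Qed.

Lemma holnM n V f g : open V -> holn n V f -> holn n V g ->
  holn n V (fun z => f z * g z).
Proof.
move=> oV; elim: n f g => [|n IHn] f g hf' hg'; first by move=> m z.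
have /holnS[df hf] := hf'; have /holnS[dg hg] := hg'.
have H z : V z -> is_derive z 1 (fun w => f w * g w) (derive1 f z * g z + f z * derive1 g z).
  by move=> Vz; apply: is_derive_mul; [exact: derivable_is_derive1 (df _ Vz)|exact: derivable_is_derive1 (dg _ Vz)].
apply/holnS; split=> [z Vz|]; first by have [] := H _ Vz.
apply: (holn_on oV _ (holnD oV (IHn _ _ hf (holnW hg')) (IHn _ _ (holnW hf') hg))).
by move=> w Vw; apply/esym/is_derive1E/H.
Qed.

Lemma holn_cst n V c : holn n V (fun=> c).
Proof.
elim: n c => [|n IHn] c; first by move=> m z.
apply/holnS; split=> [z _|]; first exact: derivable_cst.
rewrite (_ : derive1 _ = fun=> 0) //; apply/funext => z; exact: derive1_cst.
Qed.

Lemma holn_id n V : holn n V id.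
Proof.
case: n => [|n]; first by move=> m z.
apply/holnS; split=> [z _|]; first exact: derivable_id.
rewrite (_ : derive1 _ = (fun=> 1 : C)); first exact: holn_cst.
by apply/funext => z; rewrite derive1E derive_id.
Qed.

Lemma holn_inv n V f : open V -> (forall z, V z -> f z != 0) -> holn n V f ->
  holn n V (fun z => (f z)^-1).
Proof.
move=> oV f0; elim: n => [|n IHn] hf'; first by move=> m z.
have /holnS[df hf] := hf'.
have H z : V z -> is_derive z 1 (fun w => (f w)^-1) (- derive1 f z * (f z)^-1 * (f z)^-1).
  by move=> Vz; apply: is_derive_inv; [exact: f0|exact: derivable_is_derive1 (df _ Vz)].
apply/holnS; split=> [z Vz|]; first by have [] := H _ Vz.
have hv := IHn (holnW hf').
have := holnM oV (holnM oV (holnM oV (@holn_cst n V (-1)) hf) hv) hv.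
by apply: holn_on => // w Vw; rewrite (is_derive1E (H _ Vw)) mulN1r.
Qed.

Lemma holomorphic_on V f g : open V -> (forall w, V w -> f w = g w) ->
  holomorphic V f -> holomorphic V g.
Proof. by move=> oV fg /holomorphicP h; apply/holomorphicP => n; exact: (holn_on oV fg). Qed.

Lemma holomorphicD V f g : open V -> holomorphic V f -> holomorphic V g ->
  holomorphic V (fun z => f z + g z).
Proof. by move=> oV /holomorphicP hf /holomorphicP hg; apply/holomorphicP => n; exact: holnD. Qed.

Lemma holomorphicM V f g : open V -> holomorphic V f -> holomorphic V g ->
  holomorphic V (fun z => f z * g z).
Proof. by move=> oV /holomorphicP hf /holomorphicP hg; apply/holomorphicP => n; exact: holnM. Qed.

Lemma holomorphic_cst V c : holomorphic V (fun=> c).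
Proof. by apply/holomorphicP => n; exact: holn_cst. Qed.

Lemma holomorphic_id V : holomorphic V id.
Proof. by apply/holomorphicP => n; exact: holn_id. Qed.

Lemma holomorphicN V f : open V -> holomorphic V f -> holomorphic V (fun z => - f z).
Proof.
move=> oV hf; have := holomorphicM oV (@holomorphic_cst V (-1)) hf.
by apply: holomorphic_on => // w _; rewrite mulN1r.
Qed.

Lemma holomorphicB V f g : open V -> holomorphic V f -> holomorphic V g ->
  holomorphic V (fun z => f z - g z).
Proof. by move=> oV hf hg; exact: holomorphicD oV hf (holomorphicN oV hg). Qed.

Lemma holomorphicV V f : open V -> (forall z, V z -> f z != 0) -> holomorphic V f ->
  holomorphic V (fun z => (f z)^-1).
Proof. by move=> oV f0 /holomorphicP hf; apply/holomorphicP => n; exact: holn_inv. Qed.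

Lemma holomorphic_div V f g : open V -> (forall z, V z -> g z != 0) -> holomorphic V f ->
  holomorphic V g -> holomorphic V (fun z => f z / g z).
Proof. by move=> oV g0 hf hg; exact: holomorphicM oV hf (holomorphicV oV g0 hg). Qed.

Lemma holomorphicX V f n : open V -> holomorphic V f -> holomorphic V (fun z => f z ^+ n).
Proof.
move=> oV hf; elim: n => [|n IHn].
  by apply: holomorphic_on (@holomorphic_cst V 1) => // w _; rewrite expr0.
by apply: holomorphic_on (holomorphicM oV hf IHn) => // w _; rewrite exprS.
Qed.

Lemma holomorphic_sum V (I : Type) (s : seq I) (P : pred I) (F : I -> C -> C) : open V ->
  (forall i, P i -> holomorphic V (F i)) ->
  holomorphic V (fun z => \sum_(i <- s | P i) F i z).
Proof.
move=> oV hF; elim: s => [|i s IHs].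
  by apply: holomorphic_on (@holomorphic_cst V 0) => // w _; rewrite big_nil.
have [Pi|Pi] := boolP (P i).
  by apply: holomorphic_on (holomorphicD oV (hF _ Pi) IHs) => // w _; rewrite big_cons Pi.
by apply: holomorphic_on IHs => // w _; rewrite big_cons (negbTE Pi).
Qed.

Lemma holomorphic_horner V (p : {poly C}) : open V -> holomorphic V (horner p).
Proof.
move=> oV; elim/poly_ind: p => [|p c IHp].
  by apply: holomorphic_on (@holomorphic_cst V 0) => // w _; rewrite horner0.
have := holomorphicD oV (holomorphicM oV IHp (@holomorphic_id V)) (@holomorphic_cst V c).
by apply: holomorphic_on => // w _; rewrite !hornerE.
Qed.

Lemma holomorphic_sub V V' f : V' `<=` V -> holomorphic V f -> holomorphic V' f.
Proof. by move=> s h n z /s; exact: h. Qed.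

Lemma holomorphic_local V f :
  (forall z, V z -> exists2 W : set C, open W /\ W z & holomorphic W f) -> holomorphic V f.
Proof. by move=> h n z /h[W [_ Wz]]; apply. Qed.

Lemma holomorphic_derive1 V f : holomorphic V f -> holomorphic V (derive1 f).
Proof. by move=> h n z Vz; rewrite -derive1Sn; exact: h. Qed.

Lemma holomorphic_is_derive V f z : holomorphic V f -> V z -> is_derive z 1 f (derive1 f z).
Proof. by move=> h Vz; apply: derivable_is_derive1; exact: (h 0%N). Qed.

Lemma holomorphic_cvg V f z : holomorphic V f -> V z -> {for z, continuous f}.
Proof.
by move=> h Vz; apply/differentiable_continuous/derivable1_diffP; exact: (h 0%N).
Qed.

End holomorphic_algebra.

(** * Derivatives and continuity by epsilon and delta *)

Section epsilon.

Lemma is_deriveP_eps (K : numFieldType) (f : K -> K) (x D : K) :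
  is_derive x 1 f D <-> forall e : K, 0 < e -> exists2 d : K, 0 < d &
    forall h, `|h| < d -> `|f (x + h) - f x - D * h| <= e * `|h|.
Proof.
have E h : h != 0 -> D - h^-1 *: ((f \o shift x) (h *: 1) - f x) =
    - (h^-1 * (f (x + h) - f x - D * h)).
  by move=> h0; rewrite /= /GRing.scale /= mulr1 [h + x]addrC; field.
split=> [[df <-] e e0|H].
  have /cvgrPdist_le /(_ e e0) : h^-1 *: ((f \o shift x) (h *: 1) - f x) @[h --> 0^'] --> 'D_1 f x.
    exact: df.
  rewrite near_withinE => /nbhs_ballP[d /= d0 H]; exists d => // h hd.
  have [->|h0] := eqVneq h 0; first by rewrite addr0 mulr0 !subrr !normr0 mulr0.
  have := H h; rewrite /ball /= sub0r normrN => /(_ hd h0).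
  rewrite /= /GRing.scale /= mulr1 [h + x]addrC => Hh.
  have : `|h| * `|'D_1 f x - h^-1 * (f (x + h) - f x)| <= `|h| * e by rewrite ler_pM2l ?normr_gt0.
  rewrite -normrM mulrBr mulrA mulfV // mul1r distrC [h * _]mulrC [`|h| * e]mulrC.
  by [].
have L : h^-1 *: ((f \o shift x) (h *: 1) - f x) @[h --> 0^'] --> D.
  apply/cvgrPdist_le => e e0; rewrite near_withinE; have [d d0 Hd] := H e e0.
  apply/nbhs_ballP; exists d => //= h; rewrite /ball /= sub0r normrN => hd h0.
  rewrite E // normrN normrM normfV ler_pdivrMl ?normr_gt0 // [leRHS]mulrC.
  exact: Hd.
split; first by apply/cvg_ex; exists D.
exact: (cvg_lim _ L).
Qed.

Lemma continuousP_eps (K : numFieldType) (f : K -> K) (x : K) :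
  {for x, continuous f} <-> forall e : K, 0 < e -> exists2 d : K, 0 < d &
    forall w, `|w - x| < d -> `|f w - f x| < e.
Proof.
split=> [/cvgrPdist_lt H e e0|H].
  have /nbhs_ballP[d /= d0 Hd] := H e e0; exists d => // w wd.
  by rewrite distrC; apply: Hd; rewrite /ball /= distrC.
apply/cvgrPdist_lt; first exact: nbhs_filter.
move=> e e0; have [d d0 Hd] := H e e0.
apply/nbhs_ballP; exists d => //= w; rewrite /ball /= distrC => wd.
by rewrite distrC; exact: Hd.
Qed.

End epsilon.

(** * The real-valued modulus, and derivatives along real lines *)

Section complex_plane.
Variable R : realType.
Local Notation C := (Cplx R).
Implicit Types (z w c : C).

(** The norm of [Cplx R] takes values in the complex numbers with their partial order. This is the
    same modulus as a real number, for which the total order is available. *)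
Definition nm z : R := Num.sqrt (re z ^+ 2 + im z ^+ 2).

Lemma normE z : `|z| = (nm z)%:C%C :> C.
Proof. exact: normc_def. Qed.

Lemma nm_ge0 z : 0 <= nm z. Proof. exact: sqrtr_ge0. Qed.

Lemma nm_sq z : nm z ^+ 2 = re z ^+ 2 + im z ^+ 2.
Proof. by rewrite sqr_sqrtr // addr_ge0 // sqr_ge0. Qed.

Lemma lecR' (a b : R) : (a%:C%C <= b%:C%C :> C) = (a <= b).
Proof. exact: lecR. Qed.

Lemma ltcR' (a b : R) : (a%:C%C < b%:C%C :> C) = (a < b).
Proof. exact: ltcR. Qed.

Lemma nmM z w : nm (z * w) = nm z * nm w.
Proof. by apply: complexI; rewrite rmorphM /= -!(normE _) normrM. Qed.

Lemma nmD z w : nm (z + w) <= nm z + nm w.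
Proof. by rewrite -lecR' rmorphD /= -!normE ler_normD. Qed.

Lemma nmN z : nm (- z) = nm z.
Proof. by apply: complexI; rewrite -!(normE _) normrN. Qed.

Lemma nmX z n : nm (z ^+ n) = nm z ^+ n.
Proof. by apply: complexI; rewrite rmorphXn /= -!(normE _) normrX. Qed.

Lemma nmV z : nm z^-1 = (nm z)^-1.
Proof. by apply: complexI; rewrite fmorphV /= -!(normE _) normfV. Qed.

Lemma nm0 : nm 0 = 0. Proof. by rewrite /nm /= expr0n /= addr0 sqrtr0. Qed.

Lemma nm1 : nm 1 = 1. Proof. by rewrite /nm /= expr0n /= addr0 expr1n sqrtr1. Qed.

Lemma nm_eq0 z : (nm z == 0) = (z == 0).
Proof. by rewrite -[RHS]normr_eq0 [X in _ = (X == _)]normE -(inj_eq (@complexI R)). Qed.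

Lemma nm_gt0 z : (0 < nm z) = (z != 0).
Proof. by rewrite lt_def nm_eq0 nm_ge0 andbT. Qed.

Lemma nmR (t : R) : nm t%:C%C = `|t|.
Proof. by rewrite /nm /= expr0n /= addr0 sqrtr_sqr. Qed.

Lemma nm_nat n : nm n%:R = n%:R.
Proof. by rewrite -(rmorph_nat (real_complex R)) nmR ger0_norm. Qed.

Lemma re_le_nm z : `|re z| <= nm z.
Proof. by rewrite -sqrtr_sqr ler_sqrt ?addr_ge0 ?sqr_ge0 // lerDl sqr_ge0. Qed.

Lemma im_le_nm z : `|im z| <= nm z.
Proof. by rewrite -sqrtr_sqr ler_sqrt ?addr_ge0 ?sqr_ge0 // lerDr sqr_ge0. Qed.

Lemma nm_le_reim z : nm z <= `|re z| + `|im z|.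
Proof.
rewrite -ler_sqr ?nnegrE ?nm_ge0 ?addr_ge0 // nm_sq sqrrD !real_normK ?num_real //.
by rewrite lerD2r lerDl mulrn_wge0 // mulr_ge0.
Qed.

Lemma reD z w : re (z + w) = re z + re w. Proof. by case: z w => ? ? []. Qed.
Lemma imD z w : im (z + w) = im z + im w. Proof. by case: z w => ? ? []. Qed.
Lemma reN z : re (- z) = - re z. Proof. by case: z. Qed.
Lemma imN z : im (- z) = - im z. Proof. by case: z. Qed.
Lemma reM z w : re (z * w) = re z * re w - im z * im w. Proof. by case: z w => ? ? []. Qed.
Lemma imM z w : im (z * w) = re z * im w + im z * re w.
Proof. by case: z w => a b [c d]; rewrite /= addrC [b * c]mulrC addrC. Qed.
Lemma reim z : z = Complex (re z) (im z). Proof. by case: z. Qed.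
Lemma eq_reim z w : re z = re w -> im z = im w -> z = w.
Proof. by case: z w => ? ? [? ?] /= -> ->. Qed.

Lemma pos_realC (e : C) : 0 < e -> exists2 d : R, 0 < d & e = d%:C%C.
Proof.
case: e => a b; rewrite ltcE /= => /andP[/eqP -> a0]; exists a => //.
Qed.

Lemma is_deriveC_eps (f : C -> C) z D :
  is_derive z 1 f D <-> forall e : R, 0 < e -> exists2 d : R, 0 < d &
    forall h, nm h < d -> nm (f (z + h) - f z - D * h) <= e * nm h.
Proof.
rewrite is_deriveP_eps; split=> [H e e0|H e /pos_realC[{}e e0 ->]].
  have [|d /pos_realC[{}d d0 ->] Hd] := H e%:C%C; first by rewrite ltcR'.
  exists d => // h hd; have := Hd h; rewrite !normE ltcR' -rmorphM lecR'; exact.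
have [d d0 Hd] := H e e0; exists d%:C%C; first by rewrite ltcR'.
by move=> h; rewrite !normE ltcR' -rmorphM lecR'; exact: Hd.
Qed.

Lemma continuousC_eps (f : C -> C) z :
  {for z, continuous f} <-> forall e : R, 0 < e -> exists2 d : R, 0 < d &
    forall w, nm (w - z) < d -> nm (f w - f z) < e.
Proof.
rewrite continuousP_eps; split=> [H e e0|H e /pos_realC[{}e e0 ->]].
  have [|d /pos_realC[{}d d0 ->] Hd] := H e%:C%C; first by rewrite ltcR'.
  exists d => // h hd; have := Hd h; rewrite !normE !ltcR'; exact.
have [d d0 Hd] := H e e0; exists d%:C%C; first by rewrite ltcR'.
by move=> h; rewrite !normE !ltcR'; exact: Hd.
Qed.

Lemma openC_eps (V : set C) : open V <->
  forall z, V z -> exists2 d : R, 0 < d & forall w, nm (w - z) < d -> V w.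
Proof.
split=> [oV z Vz|H].
  have /nbhs_ballP[d /= /pos_realC[{}d d0 ->] Hd] : nbhs z V by exact: open_nbhs_nbhs.
  by exists d => // w wd; apply: Hd; rewrite /ball /= distrC normE ltcR'.
rewrite openE => z /H[d d0 Hd]; apply/nbhs_ballP; exists d%:C%C; first by rewrite /= ltcR'.
by move=> w; rewrite /ball /= distrC normE ltcR'; exact: Hd.
Qed.

Lemma is_derive_re_line (f : C -> C) z c D (t : R) :
  is_derive (z + c * t%:C%C) 1 f D ->
  is_derive t 1 (fun t : R => re (f (z + c * t%:C%C))) (re (D * c)).
Proof.
move=> /is_deriveC_eps H; apply/is_deriveP_eps => e e0.
(* The extra 1 keeps the divisor positive when c = 0. *)
have c0 : 0 < nm c + 1 by rewrite ltr_wpDl ?nm_ge0.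
have [d d0 Hd] := H (e / (nm c + 1)) (divr_gt0 e0 c0).
exists (d / (nm c + 1)); first exact: divr_gt0.
move=> h hd; have := Hd (c * h%:C%C); rewrite nmM nmR.
rewrite {1}[nm c * _]mulrC => /(_ _)/wrap[].
  rewrite (le_lt_trans _ (_ : `|h| * (nm c + 1) < d)) ?ler_wpM2l ?lerDl //.
  by rewrite -ltr_pdivlMr.
move=> K.
have -> : re (f (z + c * (t + h)%:C%C)) - re (f (z + c * t%:C%C)) - re (D * c) * h =
   re (f (z + c * t%:C%C + c * h%:C%C) - f (z + c * t%:C%C) - D * (c * h%:C%C)).
  rewrite [in RHS]reD reN [in RHS]reD reN mulrA [re (D * c * _)]reM /= mulr0 subr0.
  by rewrite rmorphD /= mulrDr addrA.
apply: le_trans (re_le_nm _) _; apply: le_trans K _.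
rewrite mulrA ler_wpM2r // mulrAC ler_pdivrMr // ler_wpM2l ?(ltW e0) //.
by rewrite lerDl.
Qed.

Lemma is_derive_im_line (f : C -> C) z c D (t : R) :
  is_derive (z + c * t%:C%C) 1 f D ->
  is_derive t 1 (fun t : R => im (f (z + c * t%:C%C))) (im (D * c)).
Proof.
move=> h.
(* The imaginary part of f is the real part of - i f. *)
have h' : is_derive (z + c * t%:C%C) 1 (fun w => - 'i%C * f w : C) (- 'i%C * D).
  have K := is_deriveM (@is_derive_cst _ _ _ (- 'i%C : C) (z + c * t%:C%C) 1) h.
  by apply: is_derive_eq; rewrite /GRing.scale /= mulr0 addr0.
have := is_derive_re_line h'.
have -> : (fun t : R => re (- 'i%C * f (z + c * t%:C%C))) = (fun t : R => im (f (z + c * t%:C%C))).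
  by apply/funext => s; case: (f _) => x y; rewrite reM /=; ring.
suff -> : re (- 'i%C * D * c) = im (D * c) by [].
by case: D c {h h'} => x y [u v]; rewrite !(reM, imM) /=; ring.
Qed.

End complex_plane.

(** * The maximum principle *)

Section max_principle.
Variable R : realType.
Local Notation C := (Cplx R).
Implicit Types (z w c : C).

(** If s > 0, then U' t >= (s/2) t for small t > 0 because U' 0 = 0, and the mean value theorem
    gives U h > U 0. *)
Lemma second_derivative_max (U U' : R -> R) (s d : R) : 0 < d ->
  (forall t : R, `|t| < d -> is_derive t 1 U (U' t)) -> is_derive (0 : R) 1 U' s ->
  (forall t : R, `|t| < d -> U t <= U 0) -> s <= 0.
Proof.
move=> d0 dU dU' Umax.
have itvd t : t \in `]- d, d[%R -> `|t| < d by rewrite in_itv /= -ltr_norml.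
have U'0 : U' 0 = 0.
  have h : is_derive (0 : R) 1 U 0.
    apply: (@derive1_at_max _ U (- d) d).
    - by rewrite ge0_cp // ltW.
    - by move=> t /itvd /dU[].
    - by rewrite in_itv /= oppr_lt0 d0.
    - by move=> t /itvd; exact: Umax.
  have h' := dU 0; rewrite normr0 in h'; have {}h' := h' d0.
  by have := @derive_val _ _ _ _ _ _ _ h; rewrite (@derive_val _ _ _ _ _ _ _ h').
rewrite leNgt; apply/negP => s0.
have /is_deriveP_eps /(_ (s / 2)) [|e e0 He] := dU'; first by rewrite divr_gt0.
pose h := Num.min e d / 2.
have m0 : 0 < Num.min e d by rewrite lt_min e0 d0.
have h0 : 0 < h by rewrite divr_gt0.
have hm : h < Num.min e d by rewrite ltr_pdivrMr // ltr_pMr // ltr1n.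
have /andP[he hd] : (h < e) && (h < d) by rewrite -lt_min.
have ltd t : 0 <= t -> t <= h -> `|t| < d.
  by move=> t0 th; rewrite ger0_norm // (le_lt_trans th).
have [x||c] := @MVT R U U' 0 h h0.
- by rewrite in_itv /= => /andP[x0 xh]; apply: dU; rewrite ltd // ltW.
- apply: derivable_within_continuous => x; rewrite in_itv /= => /andP[x0 xh].
  by have [] := dU x (ltd x x0 xh).
rewrite in_itv /= => /andP[c0 ch] E.
have := He c; rewrite gtr0_norm // => /(_ (lt_trans ch he)).
rewrite add0r U'0 subr0 ler_norml => /andP[+ _].
have := Umax h (ltd h (ltW h0) (lexx _)); rewrite -subr_le0 E subr0 pmulr_lle0 //.
move: (U' c) => v; nra.
Qed.

Lemma lipschitz_continuous (F : C -> R) :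
  (forall z w, `|F w - F z| <= nm (w - z)) -> continuous F.
Proof.
move=> H z; apply/cvgrPdist_lt; first exact: nbhs_filter.
move=> e e0; apply/nbhs_ballP; exists e%:C%C; first by rewrite /= ltcR'.
move=> w; rewrite /ball /= normE ltcR' => h; apply: le_lt_trans h.
exact: H.
Qed.

Lemma nm_triangle z w : `|nm w - nm z| <= nm (w - z).
Proof.
rewrite ler_norml; apply/andP; split; last first.
  by rewrite lerBlDr (le_trans _ (nmD _ _)) // subrK.
rewrite lerBrDr addrC lerBlDr -[w - z]opprB nmN (le_trans _ (nmD _ _)) //.
by rewrite addrC subrK.
Qed.

Lemma continuous_nm : continuous (@nm R).
Proof. by apply: lipschitz_continuous => z w; exact: nm_triangle. Qed.

Lemma continuous_re : continuous (@re R).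
Proof. by apply: lipschitz_continuous => z w; rewrite -reN -reD re_le_nm. Qed.

Lemma continuous_im : continuous (@im R).
Proof. by apply: lipschitz_continuous => z w; rewrite -imN -imD im_le_nm. Qed.

Lemma continuous_Complex : continuous (fun p : R * R => Complex p.1 p.2 : C).
Proof.
move=> p; apply/cvgrPdist_lt => e /pos_realC[{}e e0 ->].
exists (ball p.1 (e / 2), ball p.2 (e / 2)).
  by split; apply: nbhsx_ballx; rewrite divr_gt0.
move=> q [/= h1 h2]; rewrite normE ltcR' (le_lt_trans (nm_le_reim _)) // /=.
by rewrite [ltRHS](splitr e) ltrD.
Qed.

Lemma is_derive_mulr (f : C -> C) z D c :
  is_derive z 1 f D -> is_derive z 1 (fun w => f w * c) (D * c).
Proof.
move=> /is_deriveC_eps H; apply/is_deriveC_eps => e e0.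
have c0 : 0 < nm c + 1 by rewrite ltr_wpDl ?nm_ge0.
have [d d0 Hd] := H _ (divr_gt0 e0 c0); exists d => // h /Hd K.
have -> : f (z + h) * c - f z * c - D * c * h = (f (z + h) - f z - D * h) * c by ring.
rewrite nmM (le_trans (ler_wpM2r (nm_ge0 c) K)) // mulrAC ler_wpM2r ?nm_ge0 //.
by rewrite mulrAC ler_pdivrMr // ler_wpM2l ?(ltW e0) // lerDl.
Qed.

Lemma nm_sq_line (g : C -> C) c om D (t : R) :
  is_derive (c + om * t%:C%C) 1 g D ->
  is_derive t 1 (fun t : R => nm (g (c + om * t%:C%C)) ^+ 2)
    (2 * (re (g (c + om * t%:C%C)) * re (D * om) + im (g (c + om * t%:C%C)) * im (D * om))).
Proof.
move=> dg; have dr := is_derive_re_line dg; have di := is_derive_im_line dg.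
have -> : (fun t : R => nm (g (c + om * t%:C%C)) ^+ 2) =
  (fun t : R => re (g (c + om * t%:C%C)) * re (g (c + om * t%:C%C))) +
  (fun t : R => im (g (c + om * t%:C%C)) * im (g (c + om * t%:C%C))).
  by apply/funext => s; rewrite nm_sq !expr2.
have h := is_deriveD (is_derive_mul dr dr) (is_derive_mul di di).
apply: is_derive_eq; ring.
Qed.

(* The second derivative of |g|^2 + e |z|^2 at c in the direction om is
   2 |g' om|^2 + 2 re (conj g * g'' om^2) + 2 e, which is positive for om = 1 or 'i. *)
Lemma no_interior_max (g : C -> C) (V : set C) c (e d : R) : open V -> V c ->
  holomorphic V g -> 0 < e -> 0 < d ->
  (forall w, nm (w - c) < d -> nm (g w) ^+ 2 + e * nm w ^+ 2 <= nm (g c) ^+ 2 + e * nm c ^+ 2) ->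
  False.
Proof.
move=> oV Vc hg e0 d0 cmax.
have [d1 d10 Vd] := (openC_eps V).1 oV c Vc.
pose g1 : C -> C := derive1 g; pose g2 : C -> C := derive1 g1.
have hg1 : holomorphic V g1 by exact: holomorphic_derive1.
pose s := re (g c) * re (g2 c) + im (g c) * im (g2 c).
have [om [om1 sq]] : exists om : C, nm om = 1 /\
    0 <= re (g c) * re (g2 c * om * om) + im (g c) * im (g2 c * om * om).
  have [s0|s0] := leP 0 s; first by exists 1; rewrite nm1 !mulr1.
  exists 'i%C; split; first by rewrite /nm /= expr0n /= add0r expr1n sqrtr1.
  have -> : g2 c * 'i%C * 'i%C = - g2 c.
    by rewrite -mulrA -expr2 sqr_i mulrN1.
  by rewrite reN imN !mulrN -opprD oppr_ge0 ltW.
pose m := Num.min d d1.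
have m0 : 0 < m by rewrite lt_min d0.
have lm (t : R) : nm (c + om * t%:C%C - c) = `|t|.
  by rewrite addrAC subrr add0r nmM om1 mul1r nmR.
have Vt t : `|t| < m -> V (c + om * t%:C%C).
  by rewrite lt_min => /andP[_ td]; apply: Vd; rewrite lm.
pose U t := nm (g (c + om * t%:C%C)) ^+ 2 + e * nm (c + om * t%:C%C) ^+ 2.
pose L t := c + om * t%:C%C.
pose U1 t := 2 * (re (g (L t)) * re (g1 (L t) * om) + im (g (L t)) * im (g1 (L t) * om)) +
  e * (2 * (re (L t) * re (1 * om) + im (L t) * im (1 * om))).
have did z : is_derive z 1 (id : C -> C) 1 by exact: is_derive_id.
have dU (t : R) : `|t| < m -> is_derive t 1 U (U1 t).
  move=> tm; have h1 := nm_sq_line (holomorphic_is_derive hg (Vt _ tm)).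
  have h2 := is_deriveZ e (nm_sq_line (did (c + om * t%:C%C))).
  exact: (is_deriveD h1 h2).
have V0 : V (c + om * (0 : R)%:C%C) by apply: Vt; rewrite normr0.
have L0 : L 0 = c by rewrite /L /= mulr0 addr0.
have dU1 : is_derive (0 : R) 1 U1
    (2 * (re (g1 c * om) ^+ 2 + im (g1 c * om) ^+ 2 +
      (re (g c) * re (g2 c * om * om) + im (g c) * im (g2 c * om * om))) + 2 * e).
  have hg0 := holomorphic_is_derive hg V0.
  have hg10 : is_derive (c + om * (0 : R)%:C%C) 1 (fun z => g1 z * om)
      (g2 (c + om * (0 : R)%:C%C) * om).
    exact: is_derive_mulr (holomorphic_is_derive hg1 V0).
  have h1 := is_derive_mul (is_derive_re_line hg0) (is_derive_re_line hg10).
  have h2 := is_derive_mul (is_derive_im_line hg0) (is_derive_im_line hg10).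
  have d0' := did (c + om * (0 : R)%:C%C).
  have h3 := is_derive_mul (is_derive_re_line d0') (@is_derive_cst _ _ _ (re (1 * om)) (0 : R) 1).
  have h4 := is_derive_mul (is_derive_im_line d0') (@is_derive_cst _ _ _ (im (1 * om)) (0 : R) 1).
  have h := is_deriveD (is_deriveZ 2 (is_deriveD h1 h2)) (is_deriveZ e (is_deriveZ 2 (is_deriveD h3 h4))).
  apply: is_derive_eq; rewrite /GRing.scale /= -/(L 0) L0 -/g1 -/g2 !mulr0 !addr0 !mul1r.
  have := nm_sq om; rewrite om1 expr1n => om2.
  have -> : 2 * e = e * (2 * (re om ^+ 2 + im om ^+ 2)) by rewrite -om2; ring.
  ring.
have := second_derivative_max m0 dU dU1.
have U0 t : `|t| < m -> U t <= U 0.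
  rewrite lt_min => /andP[td _]; rewrite /U -/(L 0) L0; apply: cmax.
  by rewrite lm.
move=> /(_ U0); apply/negP; rewrite -ltNge.
by rewrite ltr_wpDl ?mulr_gt0 // mulr_ge0 // addr_ge0 // addr_ge0 // sqr_ge0.
Qed.

(* No differentiability is needed at the zeros of g, where |g| <= A is trivial. *)
Lemma max_principle (g : C -> C) (rho A : R) : 0 < rho -> continuous g ->
  (forall z, g z != 0 -> exists2 V : set C, open V /\ V z & holomorphic V g) ->
  (forall z, rho <= nm z -> nm (g z) <= A) -> forall z, nm (g z) <= A.
Proof.
move=> r0 cg hg gA z; have [/gA//|zr] := leP rho (nm z).
have A0 : 0 <= A by apply: le_trans (nm_ge0 _) (gA rho%:C%C _); rewrite nmR ler_norm.
rewrite -ler_sqr ?nnegrE ?nm_ge0 //; apply/ler_addgt0Pl => e1 e10.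
(* On the square of half side rho one has |z|^2 <= 2 rho^2, so the perturbation e |z|^2 costs at
   most e1. It makes the second derivative at an interior maximum strictly positive in some
   direction. *)
pose e := e1 / (2 * rho ^+ 2).
have r20 : 0 < 2 * rho ^+ 2 by rewrite mulr_gt0 // exprn_gt0.
have e0 : 0 < e by rewrite divr_gt0.
pose u w := nm (g w) ^+ 2 + e * nm w ^+ 2.
pose B : set (R * R) := `[- rho, rho]%classic `*` `[- rho, rho]%classic.
have cB : compact B by apply: compact_setX; exact: segment_compact.
have cnm2 (f : C -> C) : continuous f -> continuous (fun p : R * R => nm (f (Complex p.1 p.2)) ^+ 2).
  move=> cf p; apply: (@continuous_comp _ _ _ (fun p : R * R => nm (f (Complex p.1 p.2))) (fun x => x ^+ 2)).
    apply: (@continuous_comp _ _ _ (fun p : R * R => f (Complex p.1 p.2)) (@nm R)).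
      apply: (@continuous_comp _ _ _ (fun p : R * R => Complex p.1 p.2 : C) f).
        exact: continuous_Complex.
      exact: cf.
    exact: continuous_nm.
  exact: exprn_continuous.
have cu : continuous (fun p : R * R => u (Complex p.1 p.2)).
  move=> p; apply: cvgD; first exact: cnm2.
  apply: (@continuous_comp _ _ _ (fun p : R * R => nm (Complex p.1 p.2) ^+ 2) ( *%R e)).
    by apply: (cnm2 id) => z'; exact: cvg_id.
  exact: mulrl_continuous.
have inB w : B (re w, im w) <-> `|re w| <= rho /\ `|im w| <= rho.
  by rewrite /B /= !in_itv /= !ler_norml; split=> -[].
have B0 : B !=set0 by exists (re 0, im 0); apply/inB; rewrite !normr0 ltW.
have [[c1 c2] Bc cmax] := compact_EVT_max B0 cB (continuous_subspaceT cu).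
pose c : C := Complex c1 c2.
rewrite inE in Bc; have [/= c1r c2r] := (inB c).1 Bc.
have uz : u z <= u c.
  have := cmax (re z, im z); rewrite -reim; apply; rewrite inE; apply/inB.
  by rewrite (le_trans (re_le_nm _)) ?(le_trans (im_le_nm _)) // ltW.
have ce : e * nm c ^+ 2 <= e1.
  have -> : e1 = e * (2 * rho ^+ 2) by rewrite /e divfK // gt_eqF.
  rewrite ler_pM2l // nm_sq /= -[c1 ^+ 2]real_normK ?num_real // -[c2 ^+ 2]real_normK ?num_real //.
  by rewrite mulrDl !mul1r lerD // ler_sqr ?nnegrE // ltW.
have gu : nm (g z) ^+ 2 <= u z by rewrite /u lerDl mulr_ge0 ?sqr_ge0 // ltW.
suff : nm (g c) ^+ 2 <= A ^+ 2.
  move=> gc; apply: le_trans gu _; apply: le_trans uz _; rewrite [e1 + _]addrC /u.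
  exact: lerD.
(* The square sticks out of the disc of radius rho; a maximum at such a point is covered by the
   bound outside the disc. *)
have [crho|crho] := leP rho (nm c); first by rewrite ler_sqr ?nnegrE ?nm_ge0 // gA.
have [->|gc0] := eqVneq (g c) 0; first by rewrite nm0 expr0n /= sqr_ge0.
have [V [oV Vc] hV] := hg c gc0.
exfalso; apply: (@no_interior_max g V c e (rho - nm c) oV Vc hV e0).
  by rewrite subr_gt0.
move=> w wc; have wr : nm w < rho.
  have := nmD (w - c) c; rewrite subrK => /le_lt_trans; apply.
  by rewrite -ltrBrDr.
have := cmax (re w, im w); rewrite -reim; apply; rewrite inE; apply/inB.
by rewrite (le_trans (re_le_nm _)) ?(le_trans (im_le_nm _)) // ltW.
Qed.

End max_principle.

(** * Composition and local square roots *)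

Section composition.
Variable R : realType.
Local Notation C := (Cplx R).
Implicit Types (V W : set C) (f g : C -> C) (z w c : C).

Lemma is_derive_compC f g z a b : is_derive z 1 g b -> is_derive (g z) 1 f a ->
  is_derive z 1 (fun w => f (g w)) (a * b).
Proof.
move=> dg df.
move: dg df => /is_deriveC_eps dg /is_deriveC_eps df; apply/is_deriveC_eps => e e0.
have a0 : 0 < 2 * (nm a + 1) by rewrite mulr_gt0 // ltr_wpDl ?nm_ge0.
have b0 : 0 < 2 * (nm b + 1) by rewrite mulr_gt0 // ltr_wpDl ?nm_ge0.
(* The error is the remainder of f at k plus a (k - b h); [e2] and [e1] keep each of the two below
   (e / 2) |h|. The bound e1 <= 1 gives |k| <= (|b| + 1) |h|. *)
pose e1 := Num.min 1 (e / (2 * (nm a + 1))); pose e2 := e / (2 * (nm b + 1)).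
have e10 : 0 < e1 by rewrite lt_min ltr01 divr_gt0.
have e20 : 0 < e2 by rewrite divr_gt0.
have [d1 d10 H1] := dg e1 e10; have [d2 d20 H2] := df e2 e20.
have B0 : 0 < nm b + 1 by rewrite ltr_wpDl ?nm_ge0.
exists (Num.min d1 (d2 / (nm b + 1))); first by rewrite lt_min d10 divr_gt0.
move=> h; rewrite lt_min => /andP[h1 h2].
pose k := g (z + h) - g z.
have kb : nm (k - b * h) <= e1 * nm h by exact: H1.
have kh : nm k <= (nm b + 1) * nm h.
  rewrite -(subrK (b * h) k) (le_trans (nmD _ _)) // nmM addrC mulrDl lerD2l.
  by rewrite (le_trans kb) // ler_wpM2r ?nm_ge0 // /e1 ge_min lexx.
have := H2 k; rewrite [g z + k]addrC subrK => /(_ _)/wrap[|K].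
  by rewrite (le_lt_trans kh) // mulrC -ltr_pdivlMr.
have -> : f (g (z + h)) - f (g z) - a * b * h =
  (f (g (z + h)) - f (g z) - a * k) + a * (k - b * h) by ring.
rewrite (le_trans (nmD _ _)) // nmM.
have L1 : e2 * nm k <= e / 2 * nm h.
  apply: le_trans (ler_wpM2l (ltW e20) kh) _.
  rewrite mulrA ler_wpM2r ?nm_ge0 // /e2 invfM mulrA mulfVK ?gt_eqF //.
have L2 : nm a * nm (k - b * h) <= e / 2 * nm h.
  apply: le_trans (ler_wpM2l (nm_ge0 a) kb) _.
  rewrite mulrA ler_wpM2r ?nm_ge0 //.
  have : e1 <= e / (2 * (nm a + 1)) by rewrite /e1 ge_min lexx orbT.
  move=> /(ler_wpM2l (nm_ge0 a)) /le_trans; apply.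
  have A0 : 0 < nm a + 1 by rewrite ltr_wpDl ?nm_ge0.
  rewrite (_ : nm a * _ = e / 2 * (nm a / (nm a + 1))); last by field; rewrite gt_eqF.
  by rewrite ler_piMr ?divr_ge0 ?(ltW e0) // ler_pdivrMr // mul1r lerDl.
rewrite (splitr e) mulrDl lerD // (le_trans K L1) //.
Qed.

Lemma holn_comp n V W f g : open V -> (forall z, V z -> W (g z)) ->
  holn n W f -> holn n V g -> holn n V (fun z => f (g z)).
Proof.
move=> oV VW; elim: n f => [|n IHn] f hf' hg'; first by move=> m z.
have /holnS[df hf] := hf'; have /holnS[dg hg] := hg'.
have H z : V z -> is_derive z 1 (fun w => f (g w)) (derive1 f (g z) * derive1 g z).
  move=> Vz; apply: is_derive_compC; first exact: derivable_is_derive1 (dg _ Vz).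
  exact: derivable_is_derive1 (df _ (VW _ Vz)).
apply/holnS; split=> [z Vz|]; first by have [] := H _ Vz.
apply: (holn_on oV _ (holnM oV (IHn _ hf (holnW hg')) hg)).
by move=> w Vw; apply/esym/is_derive1E/H.
Qed.

Lemma holomorphic_comp V W f g : open V -> (forall z, V z -> W (g z)) ->
  holomorphic W f -> holomorphic V g -> holomorphic V (fun z => f (g z)).
Proof.
move=> oV VW /holomorphicP hf /holomorphicP hg; apply/holomorphicP => n.
exact: (holn_comp oV VW (hf n) (hg n)).
Qed.

Definition csqrt (w : C) : C := sqrtc w.

Lemma sqr_csqrt w : csqrt w ^+ 2 = w. Proof. exact: sqr_sqrtc. Qed.

Lemma csqrt1 : csqrt 1 = 1. Proof. exact: sqrtc1. Qed.

Lemma re_csqrt_ge0 w : 0 <= re (csqrt w).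
Proof. by case: w => x y /=; exact: sqrtr_ge0. Qed.

Lemma re_csqrt_gt0 w : 0 < re w -> 0 < re (csqrt w).
Proof.
case: w => x y /= x0; rewrite sqrtr_gt0 divr_gt0 // ltr_wpDl //.
Qed.

(** With s' = csqrt (w + h), the error s' - s - h / (2 s) equals - h^2 / (2 s (s' + s)^2). The
    denominator stays away from 0 for every h, because re s' >= 0 and so |s' + s| >= re s > 0. *)
Lemma is_derive_csqrt w : 0 < re w -> is_derive w 1 csqrt (2 * csqrt w)^-1.
Proof.
move=> w0; set s := csqrt w; have s0 : 0 < re s by exact: re_csqrt_gt0.
apply/is_deriveC_eps => e e0; exists (e * re s ^+ 3); first by rewrite mulr_gt0 // exprn_gt0.
move=> h hd; set s' := csqrt (w + h).
have ss : re s <= nm (s' + s).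
  by apply: le_trans (re_le_nm _); rewrite ger0_norm reD ?addr_ge0 ?re_csqrt_ge0 // lerDr re_csqrt_ge0.
have sn : re s <= nm s by apply: le_trans (ler_norm _) (re_le_nm _).
have ss0 : s' + s != 0 by rewrite -nm_gt0 (lt_le_trans s0).
have s_0 : s != 0 by rewrite -nm_gt0 (lt_le_trans s0).
have hE : h = (s' - s) * (s' + s).
  by rewrite -subr_sqr /s' /s !sqr_csqrt addrAC subrr add0r.
have two0 : (2 : C) != 0 by rewrite pnatr_eq0.
have -> : s' - s - (2 * s)^-1 * h = - (h ^+ 2 / (2 * s * (s' + s) ^+ 2)).
  by rewrite hE; field; rewrite s_0 ss0.
rewrite nmN nmM nmV (nmX h) [nm (2 * s * _)]nmM [nm (2 * s)]nmM (nmX (s' + s)).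
rewrite nm_nat ler_pdivrMr; last first.
  by rewrite mulr_gt0 ?mulr_gt0 ?exprn_gt0 // (lt_le_trans s0).
rewrite expr2 mulrAC ler_wpM2r ?nm_ge0 //.
have : re s ^+ 3 <= 2 * nm s * nm (s' + s) ^+ 2.
  have -> : re s ^+ 3 = re s * re s ^+ 2 by rewrite exprS.
  rewrite ler_pM ?sqr_ge0 // ?(ltW s0) //; first by rewrite (le_trans sn) // ler_peMl ?nm_ge0 // ler1n.
  by rewrite ler_sqr ?nnegrE ?nm_ge0 // ltW.
by move=> K; rewrite (le_trans (ltW hd)) // ler_wpM2l // ltW.
Qed.

Lemma open_re_gt0 : open [set w : C | 0 < re w].
Proof.
apply/openC_eps => w /= w0; exists (re w) => // v /(le_lt_trans (re_le_nm _)).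
by rewrite reD reN ltr_norml ltrBrDr addNr => /andP[].
Qed.

Lemma holomorphic_csqrt : holomorphic [set w : C | 0 < re w] csqrt.
Proof.
apply/holomorphicP; elim=> [|n IHn]; first by move=> m z.
apply/holnS; split=> [z /is_derive_csqrt[]//|].
have oV := open_re_gt0.
have h2 : holn n [set w : C | 0 < re w] (fun w => 2 * csqrt w).
  by apply: (holnM oV _ IHn); exact: holn_cst.
have := holn_inv oV _ h2; move=> /(_ _)/wrap[].
  move=> z z0; rewrite mulf_neq0 ?pnatr_eq0 //; apply/eqP => E.
  by have := re_csqrt_gt0 z0; rewrite E ltxx.
by apply: holn_on => // z z0; apply/esym/is_derive1E; exact: is_derive_csqrt.
Qed.

Lemma continuous_hornerC (p : {poly C}) : continuous (horner p : C -> C).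
Proof.
move=> z; apply: (@holomorphic_cvg _ setT); last by [].
by apply: holomorphic_horner; exact: openT.
Qed.

(** The root is r0 times the principal root of p(s) / p(s0), on the set where this quotient has
    positive real part. It depends on s only through p(s), whence the last clause: for an even
    polynomial the root is even. *)
Lemma local_sqrt (p : {poly C}) (s0 r0 : C) : r0 != 0 -> r0 ^+ 2 = p.[s0] ->
  exists (V : set C) (q : C -> C), [/\ open V /\ V s0, holomorphic V q, q s0 = r0,
    forall s, V s -> q s ^+ 2 = p.[s] /\ q s != 0 &
    forall s s', V s -> p.[s] = p.[s'] -> V s' /\ q s = q s'].
Proof.
move=> r00 r2; have p0 : p.[s0] != 0 by rewrite -r2 expf_neq0.
pose W := [set w : C | 0 < re w].
pose V := [set s : C | W (p.[s] / p.[s0])].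
have oV : open V.
  have -> : V = (fun s => (p.[s0]^-1 *: p).[s]) @^-1` W.
    by apply/funext => s; rewrite /V /= hornerZ mulrC.
  by apply: open_comp open_re_gt0 => z _; exact: continuous_hornerC.
pose q s := r0 * csqrt (p.[s] / p.[s0]).
have q2 s : q s ^+ 2 = p.[s] by rewrite exprMn sqr_csqrt r2 mulrC divfK.
exists V, q; split.
- by split=> //; rewrite /V /W /= divff //= ltr01.
- apply: (holomorphicM oV); first exact: holomorphic_cst.
  apply: (holomorphic_comp oV _ holomorphic_csqrt); first by [].
  by apply: (holomorphicM oV); [exact: holomorphic_horner|exact: holomorphic_cst].
- by rewrite /q divff // csqrt1 mulr1.
- move=> s Vs; split=> //; rewrite mulf_neq0 //; apply/eqP => E.
  by have := re_csqrt_gt0 Vs; rewrite E ltxx.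
- by move=> s s'; rewrite /V /= /q => + <-.
Qed.

End composition.

Local Opaque holomorphic.

(** * Functions of x holomorphic off the roots of the cubic *)

Section elliptic_functions.
Variable R : realType.
Local Notation C := (Cplx R).
Variables a b : C.
Implicit Types (x y z s t : C).

Definition cub x : C := 4 * x ^+ 3 - a * x - b.
Definition dcub x : C := 12 * x ^+ 2 - a.

Lemma holomorphic_cub V : open V -> holomorphic V cub.
Proof.
move=> oV; apply: (holomorphicB oV); last exact: holomorphic_cst.
apply: (holomorphicB oV).
  apply: (holomorphicM oV); first exact: holomorphic_cst.
  by apply: (holomorphicX (n := 3) oV); exact: holomorphic_id.
by apply: (holomorphicM oV); [exact: holomorphic_cst|exact: holomorphic_id].
Qed.

Lemma continuous_cub : continuous cub.
Proof.
move=> z; apply: (@holomorphic_cvg _ setT); last by [].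
by apply: holomorphic_cub; exact: openT.
Qed.

Lemma nm_cub x : 1 <= nm x -> nm (cub x) <= (4 + nm a + nm b) * nm x ^+ 3.
Proof.
move=> x1; rewrite /cub (le_trans (nmD _ _)) // nmN [leRHS]mulrDl lerD //; last first.
  by rewrite ler_peMr ?nm_ge0 // exprn_ege1.
rewrite (le_trans (nmD _ _)) // nmN nmM nmX nm_nat nmM [leRHS]mulrDl lerD2l ler_wpM2l ?nm_ge0 //.
by rewrite exprS ler_peMr ?nm_ge0 // exprn_ege1.
Qed.

(* S^7 cub extends by 0 to the roots of cub, is holomorphic off them, and tends to 0
   at infinity (like |x|^(3 - 7/2)), so it vanishes by the maximum principle. *)
Lemma vanish_off_roots (S : C -> C) (B rho : R) :
  (forall x, cub x != 0 -> exists2 V : set C, open V /\ V x & holomorphic V S) ->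
  (forall e, cub e = 0 -> exists2 d : R, 0 < d & exists M : R,
     forall x, cub x != 0 -> nm (x - e) < d -> nm (S x) <= M) ->
  (forall x, cub x != 0 -> rho < nm x -> nm (S x) ^+ 2 * nm x <= B) ->
  forall x, cub x != 0 -> S x = 0.
Proof.
move=> hS bS dS x0 fx0; pose g x := S x ^+ 7 * cub x.
have g0 x : cub x = 0 -> g x = 0 by rewrite /g => ->; rewrite mulr0.
have hg x : cub x != 0 -> exists2 V : set C, open V /\ V x & holomorphic V g.
  move=> /hS[V [oV Vx] hV]; exists V; first by split.
  apply: (holomorphicM oV).
    exact: (holomorphicX (n := 7) oV).
  exact: holomorphic_cub.
have cg : continuous g.
  move=> z; have [fz|/hg[V [oV Vz] hV]] := eqVneq (cub z) 0; last exact: (holomorphic_cvg hV Vz).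
  apply/continuousC_eps => e e0; have [d d0 [M HM]] := bS z fz.
  have M7 : 0 < `|M| ^+ 7 + 1 by rewrite ltr_wpDl // exprn_ge0.
  have [d' d'0 Hd'] := (continuousC_eps cub z).1 (@continuous_cub z) _ (divr_gt0 e0 M7).
  exists (Num.min d d') => [|w]; first by rewrite lt_min d0.
  rewrite lt_min => /andP[wd /Hd']; rewrite fz (g0 _ fz) !subr0.
  have [fw _|fw] := eqVneq (cub w) 0; first by rewrite (g0 _ fw) nm0.
  rewrite ltr_pdivlMr // => K; rewrite /g nmM nmX mulrC; apply: le_lt_trans K.
  rewrite ler_wpM2l ?nm_ge0 // (le_trans (_ : _ <= `|M| ^+ 7)) ?lerDl //.
  by rewrite lerXn2r ?nnegrE ?nm_ge0 // (le_trans (HM w fw wd)) // ler_norm.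
have gz z : nm (g z) <= 0.
  apply/ler_addgt0Pl => e e0; rewrite addr0.
  pose c := 4 + nm a + nm b; have c0 : 0 <= c by rewrite !addr_ge0 ?nm_ge0.
  pose B' := `|B| ^+ 7 * c ^+ 2; have B'0 : 0 <= B' by rewrite mulr_ge0 ?exprn_ge0.
  (* Beyond this radius |g|^2 <= B' / |w| <= e^2. The other terms ensure |w| >= 1 and |w| > rho, as
     the bounds on [cub] and S require. *)
  pose rho' := Num.max 1 (`|rho| + 1 + B' / e ^+ 2).
  have r'0 : 0 < rho' by rewrite lt_max ltr01.
  apply: (@max_principle _ g rho') => //.
    by move=> w gw; apply: hg; apply: contraNneq gw => /g0 ->.
  move=> w rw; have [fw|fw] := eqVneq (cub w) 0; first by rewrite (g0 _ fw) nm0 ltW.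
  move: rw; rewrite ge_max => /andP[w1 w2].
  have e20 : 0 < e ^+ 2 by rewrite exprn_gt0.
  have wr : rho < nm w.
    apply: lt_le_trans w2; apply: le_lt_trans (ler_norm _) _.
    by rewrite -addrA ltrDl ltr_pwDl // divr_ge0 // ltW.
  have w0 : 0 < nm w by apply: lt_le_trans w1.
  have Bw : B' / nm w <= e ^+ 2.
    rewrite ler_pdivrMr // mulrC -ler_pdivrMr // (le_trans _ w2) //.
    by rewrite lerDr addr_ge0.
  rewrite -ler_sqr ?nnegrE ?nm_ge0 ?(ltW e0) // (le_trans _ Bw) //.
  rewrite /g nmM nmX exprMn exprAC.
  have s2 : nm (S w) ^+ 2 <= `|B| / nm w.
    by rewrite ler_pdivlMr // (le_trans (dS w fw wr)) // ler_norm.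
  have h1 : (nm (S w) ^+ 2) ^+ 7 <= (`|B| / nm w) ^+ 7.
    by rewrite lerXn2r ?nnegrE ?sqr_ge0 // divr_ge0 // ltW.
  have h2 : nm (cub w) ^+ 2 <= (c * nm w ^+ 3) ^+ 2.
    by rewrite ler_sqr ?nnegrE ?nm_ge0 ?mulr_ge0 ?exprn_ge0 ?nm_ge0 // nm_cub.
  apply: le_trans (ler_pM _ _ h1 h2) _; rewrite ?exprn_ge0 ?nm_ge0 //.
  have -> : (`|B| / nm w) ^+ 7 * (c * nm w ^+ 3) ^+ 2 = B' / nm w.
    by rewrite /B'; field; rewrite gt_eqF.
  exact: lexx.
have /eqP : nm (g x0) = 0 by apply/eqP; rewrite eq_le gz nm_ge0.
by rewrite nm_eq0 mulf_eq0 (negbTE fx0) orbF expf_eq0 /= => /eqP.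
Qed.

End elliptic_functions.

(** Ideal membership with an explicit cofactor c: an equation is reduced to a known one and an
    identity left to [ring]. *)
Lemma eq_lincomb (K : comPzRingType) (l r c u v : K) :
  u = v -> l - r = c * (u - v) -> l = r.
Proof. by move=> -> /eqP; rewrite subrr mulr0 subr_eq0 => /eqP. Qed.

(** * Holomorphic forms on the cone and local arcs of the curve *)

Section forms.
Variable R : realType.
Local Notation C := (Cplx R).
Variables a b : C.
Implicit Types (x y z s t k : C) (om : H10 a b).
Local Notation cub := (cub a b).
Local Notation dcub := (dcub a).
Local Notation on_cone := (on_cone a b).
Local Notation tangent := (tangent a b).
Local Notation C3 := (C^o * C^o * C^o)%type.
Implicit Types (P w : C3).

Lemma H10_spec om :
  [/\ forall P w, ~ (on_cone P /\ tangent P w) -> om (P, w) = 0,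
      forall P w w' k, on_cone P -> tangent P w -> tangent P w' ->
        om (P, k *: w + w') = k * om (P, w) + om (P, w'),
      forall P, on_cone P -> om (P, P) = 0,
      forall P w k, on_cone P -> tangent P w -> k != 0 ->
        om (k *: P, k *: w) = om (P, w) &
      forall (V : set C) (X Y Z : C -> C), open V ->
        holomorphic V X -> holomorphic V Y -> holomorphic V Z ->
        (forall t, V t -> on_cone (X t, Y t, Z t)) ->
        holomorphic V (fun t =>
          om ((X t, Y t, Z t), (derive1 X t, derive1 Y t, derive1 Z t)))].
Proof. by case: om => om /= /asboolP. Qed.

Lemma tangent0 P : tangent P 0.
Proof. by case: P => [[X Y] Z] /=; ring. Qed.

Lemma tangent_radial P : on_cone P -> tangent P P.
Proof.
(* The factor 3 is that of Euler's relation for a cubic form. *)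
case: P => [[X Y] Z] /= [_ E]; apply: (eq_lincomb (c := 3) E); ring.
Qed.

Lemma tangent_lin P w w' k : tangent P w -> tangent P w' -> tangent P (k *: w + w').
Proof.
case: P w w' => [[X Y] Z] [[X1 Y1] Z1] [[X2 Y2] Z2] /= E1 E2.
rewrite /GRing.scale /= /GRing.scale /=; apply: (eq_lincomb (c := 1) E2).
rewrite mul1r; set l := _ - _.
have -> : l = k * (2 * Y * Y1 * Z + Y ^+ 2 * Z1 - (12 * X ^+ 2 * X1 - a * (X1 * Z ^+ 2 + 2 * X * Z * Z1) -
   3 * b * Z ^+ 2 * Z1)) + (2 * Y * Y2 * Z + Y ^+ 2 * Z2 -
  (12 * X ^+ 2 * X2 - a * (X2 * Z ^+ 2 + 2 * X * Z * Z2) - 3 * b * Z ^+ 2 * Z2)).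
  rewrite /l; ring.
by rewrite E1 subrr mulr0 add0r.
Qed.

Lemma form0 om P : on_cone P -> om (P, 0) = 0.
Proof.
move=> cP; have [_ lin _ _ _] := H10_spec om.
have := lin P 0 0 1 cP (tangent0 P) (tangent0 P); rewrite scaler0 addr0 mul1r => /eqP.
by rewrite -subr_eq0 opprD addrA subrr sub0r oppr_eq0 => /eqP.
Qed.

(** Forms do not see the radial direction. At a smooth point the tangent plane of the cone is
    spanned by this direction and one more vector, so that one value determines the form at P. *)
Lemma form_radial om P w k l : on_cone P -> tangent P w ->
  om (P, k *: w + l *: P) = k * om (P, w).
Proof.
move=> cP tw; have [_ lin rad _ _] := H10_spec om.
have tP := tangent_radial cP.
have tl : tangent P (l *: P) by rewrite -[l *: P]addr0; apply: tangent_lin => //; exact: tangent0.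
rewrite lin // -[l *: P]addr0 lin //; last exact: tangent0.
by rewrite rad // form0 // mulr0 !addr0.
Qed.

Lemma on_cone_affine x y : y ^+ 2 = cub x -> on_cone (x, y, 1).
Proof.
move=> E; split; last by rewrite E /cub; ring.
by apply/eqP => -[_ _ /eqP]; rewrite oner_eq0.
Qed.

Lemma tangent_affine x y : y != 0 -> tangent (x, y, 1) (1, dcub x / (2 * y), 0).
Proof.
by move=> y0 /=; rewrite /dcub; field.
Qed.

Lemma on_coneZ P k : k != 0 -> on_cone P -> on_cone (k *: P).
Proof.
case: P => [[X Y] Z] k0 [P0 E]; split; first by rewrite scaler_eq0 negb_or k0.
rewrite /GRing.scale /= /GRing.scale /=; apply: (eq_lincomb (c := k ^+ 3) E); ring.
Qed.

Lemma tangentZ P w k : tangent P w -> tangent (k *: P) (k *: w).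
Proof.
case: P w => [[X Y] Z] [[X1 Y1] Z1] /= E; rewrite /GRing.scale /=.
by apply: (eq_lincomb (c := k ^+ 3) E); ring.
Qed.

(* om / (dx/y) at the affine point (x, y). *)
Definition dz_ratio om x y : C := y * om ((x, y, 1), (1, dcub x / (2 * y), 0)).

(** Scaling by [Z^-1] moves P into the affine chart, where the scaled vector is d(X/Z) times the
    affine tangent vector plus a radial part. *)
Lemma form_regular om X Y Z X' Y' Z' : on_cone (X, Y, Z) ->
  tangent (X, Y, Z) (X', Y', Z') -> Y * Z != 0 ->
  om ((X, Y, Z), (X', Y', Z')) = (Z * X' - X * Z') / (Y * Z) * dz_ratio om (X / Z) (Y / Z).
Proof.
move=> cP tw YZ; move: (YZ); rewrite mulf_eq0 negb_or => /andP[Y0 Z0].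
have [_ _ _ scal _] := H10_spec om.
have V0 : Z^-1 != 0 by rewrite invr_eq0.
have E0 : (Z^-1 *: ((X, Y, Z) : C3)) = (X / Z, Y / Z, 1).
  by rewrite -[LHS]/(Z^-1 * X, Z^-1 * Y, Z^-1 * Z) mulVf // ![Z^-1 * _]mulrC.
rewrite -(scal _ _ Z^-1 cP tw V0) E0.
have cP0 : on_cone (X / Z, Y / Z, 1) by rewrite -E0; exact: on_coneZ.
have E : (Y / Z) ^+ 2 = cub (X / Z).
  have [_] := cP0; rewrite !expr1n !mulr1 => ->; by rewrite /cub.
have y0 : Y / Z != 0 by rewrite mulf_neq0.
have tT := @tangent_affine (X / Z) (Y / Z) y0.
have -> : Z^-1 *: ((X', Y', Z') : C3) =
   ((Z * X' - X * Z') / Z ^+ 2) *: ((1, dcub (X / Z) / (2 * (Y / Z)), 0) : C3)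
   + (Z' / Z) *: ((X / Z, Y / Z, 1) : C3).
  rewrite -[LHS]/(Z^-1 * X', Z^-1 * Y', Z^-1 * Z').
  rewrite -[RHS]/((Z * X' - X * Z') / Z ^+ 2 * 1 + Z' / Z * (X / Z),
    (Z * X' - X * Z') / Z ^+ 2 * (dcub (X / Z) / (2 * (Y / Z))) + Z' / Z * (Y / Z),
    (Z * X' - X * Z') / Z ^+ 2 * 0 + Z' / Z * 1).
  congr (_, _, _); [by field| |by field].
  have [_ E1] := cP; have E2 : 2 * Y * Y' * Z + Y ^+ 2 * Z' =
     12 * X ^+ 2 * X' - a * (X' * Z ^+ 2 + 2 * X * Z * Z') - 3 * b * Z ^+ 2 * Z' := tw.
  (* Z times the tangency equation minus 3 Z' times the equation of the curve; this eliminates b. *)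
  have key : 2 * Y * Y' * Z ^+ 2 =
      (Z * X' - X * Z') * (12 * X ^+ 2 - a * Z ^+ 2) + 2 * Y ^+ 2 * Z * Z'.
    apply/eqP; rewrite -subr_eq0; apply/eqP.
    transitivity (Z * (2 * Y * Y' * Z + Y ^+ 2 * Z' - (12 * X ^+ 2 * X' -
        a * (X' * Z ^+ 2 + 2 * X * Z * Z') - 3 * b * Z ^+ 2 * Z')) -
      3 * Z' * (Y ^+ 2 * Z - (4 * X ^+ 3 - a * X * Z ^+ 2 - b * Z ^+ 3))); first by ring.
    by rewrite E1 E2 !subrr !mulr0 subr0.
  have -> : Y' = (2 * Y * Y' * Z ^+ 2) / (2 * Y * Z ^+ 2) by field; rewrite Y0 Z0.
  by rewrite key /dcub; field; rewrite Y0 Z0.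
rewrite form_radial // /dz_ratio; field; rewrite Y0 Z0 //.
Qed.

Lemma tangent_expanded (X Y Z X' Y' Z' : C) :
  (Y' * Y + Y * Y') * Z + Y * Y * Z' = ((X' * X + X * X') * X + X * X * X') * 4 -
    (X' * (Z * Z) + X * (Z' * Z + Z * Z')) * a - ((Z' * Z + Z * Z') * Z + Z * Z * Z') * b ->
  tangent (X, Y, Z) (X', Y', Z').
Proof. by move=> E /=; apply: (eq_lincomb (c := 1) E); ring. Qed.

Lemma arc_tangent (V : set C) (X Y Z : C -> C) : open V ->
  holomorphic V X -> holomorphic V Y -> holomorphic V Z ->
  (forall t, V t -> on_cone (X t, Y t, Z t)) ->
  forall t, V t -> tangent (X t, Y t, Z t) (derive1 X t, derive1 Y t, derive1 Z t).
Proof.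
move=> oV hX hY hZ cone t Vt.
have dX := holomorphic_is_derive hX Vt; have dY := holomorphic_is_derive hY Vt.
have dZ := holomorphic_is_derive hZ Vt.
have d1 := is_derive_mul (is_derive_mul dY dY) dZ.
have d2 := is_derive_mulr 4 (is_derive_mul (is_derive_mul dX dX) dX).
have d3 := is_derive_mulr a (is_derive_mul dX (is_derive_mul dZ dZ)).
have d4 := is_derive_mulr b (is_derive_mul (is_derive_mul dZ dZ) dZ).
have eqV (w : C) : V w -> Y w * Y w * Z w = X w * X w * X w * 4 - X w * (Z w * Z w) * a - Z w * Z w * Z w * b.
  by move=> /cone[_ E]; apply: (eq_lincomb (c := 1) E); ring.
have d5 := is_deriveB (is_deriveB d2 d3) d4.
have d6 := is_derive_on oV Vt eqV d1.
have E := etrans (esym (is_derive1E d6)) (is_derive1E d5).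
exact: tangent_expanded E.
Qed.

(** The first equation holds on all of V, the second only where Y Z is nonzero. As f is holomorphic,
    they link the values of [om] at points with Y Z = 0 to [dz_ratio] nearby. *)
Lemma arc_form om (V : set C) (X Y Z : C -> C) : open V ->
  holomorphic V X -> holomorphic V Y -> holomorphic V Z ->
  (forall t, V t -> on_cone (X t, Y t, Z t)) ->
  exists2 f : C -> C, holomorphic V f & forall t, V t ->
    f t = om ((X t, Y t, Z t), (derive1 X t, derive1 Y t, derive1 Z t)) /\
    (Y t * Z t != 0 -> f t = (Z t * derive1 X t - X t * derive1 Z t) / (Y t * Z t) *
      dz_ratio om (X t / Z t) (Y t / Z t)).
Proof.
move=> oV hX hY hZ cone; have [_ _ _ _ hol] := H10_spec om.
exists (fun t => om ((X t, Y t, Z t), (derive1 X t, derive1 Y t, derive1 Z t))).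
  exact: hol.
move=> t Vt; split=> // YZ; apply: form_regular => //; first exact: cone.
exact: (arc_tangent oV hX hY hZ cone).
Qed.

Definition cub_poly : {poly C} := 4%:P * 'X^3 - a%:P * 'X - b%:P.

Lemma horner_cub x : cub_poly.[x] = cub x.
Proof. by rewrite /cub /cub_poly !(hornerE, hornerXn, hornerCM). Qed.

Lemma ratio_holomorphic om (V : set C) (Y : C -> C) : open V -> holomorphic V Y ->
  (forall t, V t -> Y t ^+ 2 = cub t /\ Y t != 0) ->
  exists2 r, holomorphic V r & forall t, V t -> dz_ratio om t (Y t) = r t.
Proof.
move=> oV hY HY; have h1 := @holomorphic_cst R V 1; have hid := @holomorphic_id R V.
have [|f hf Hf] := arc_form om oV hid hY h1.
  by move=> t /HY[E _]; exact: on_cone_affine.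
exists (fun t => Y t * f t); first exact: holomorphicM.
move=> t Vt; have [_ Yt0] := HY t Vt; have [_] := Hf t Vt.
rewrite mulr1 => /(_ Yt0) ->; rewrite !divr1 (is_derive1E (is_derive_id _ _)).
by rewrite derive1_cst; field.
Qed.

(** Both sheets q and - q are treated over the same V, because a function of x will be formed from
    the two values of the ratio. *)
Lemma ratio_regular om x0 y0 : y0 != 0 -> y0 ^+ 2 = cub x0 ->
  exists (V : set C) (q r r' : C -> C), [/\ open V /\ V x0, holomorphic V r, holomorphic V r',
    forall t, V t -> q t ^+ 2 = cub t /\ q t != 0 &
    forall t, V t -> dz_ratio om t (q t) = r t /\ dz_ratio om t (- q t) = r' t].
Proof.
move=> y00; rewrite -horner_cub => E0.
have [V [q [[oV Vx] hq q0 q2 _]]] := local_sqrt y00 E0.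
have {}q2 t : V t -> q t ^+ 2 = cub t /\ q t != 0 by move=> /q2; rewrite horner_cub.
have [r hr Hr] := ratio_holomorphic om oV hq q2.
have [|r' hr' Hr'] := ratio_holomorphic om oV (holomorphicN oV hq).
  by move=> t /q2; rewrite sqrrN oppr_eq0.
exists V, q, r, r'; split; [by split|exact: hr|exact: hr'|exact: q2|].
by move=> t Vt; split; [exact: Hr|exact: Hr'].
Qed.

(** For a root e of [cub] this is cub (e + s^2) / s^2. *)
Definition branch_poly (e : C) : {poly C} := 4%:P * 'X^4 + (12 * e)%:P * 'X^2 + (dcub e)%:P.

Lemma horner_branch e s : (branch_poly e).[s] = 4 * s ^+ 4 + 12 * e * s ^+ 2 + dcub e.
Proof. by rewrite /branch_poly !(hornerE, hornerXn, hornerCM). Qed.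

Lemma branch_cub e s : cub e = 0 -> s ^+ 2 * (branch_poly e).[s] = cub (e + s * s).
Proof.
move=> E; rewrite horner_branch; apply: (eq_lincomb (c := -1) E).
by rewrite /cub /dcub; ring.
Qed.

(* Near a branch point the curve is parametrized by x = e + s^2, y = s q(s). *)
Lemma branch_arc om e : cub e = 0 -> dcub e != 0 ->
  exists (V : set C) (q f : C -> C), [/\ open V /\ V 0, holomorphic V q /\ q 0 != 0,
    holomorphic V f, f 0 = om ((e, 0, 1), (0, q 0, 0)) &
    forall s, V s -> [/\ q s ^+ 2 = (branch_poly e).[s], V (- s) /\ q (- s) = q s, q s != 0 &
      s != 0 -> dz_ratio om (e + s * s) (s * q s) = q s / 2 * f s]].
Proof.
move=> ce de; have r0 : csqrt (dcub e) ^+ 2 = (branch_poly e).[0].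
  by rewrite sqr_csqrt horner_branch !expr0n /= !mulr0 !add0r.
have r00 : csqrt (dcub e) != 0 by rewrite -sqrf_eq0 sqr_csqrt.
have [V [q [[oV V0] hq q0 q2 qs]]] := local_sqrt r00 r0.
have hid := @holomorphic_id R V.
have hX : holomorphic V (fun s => e + s * s).
  apply: (holomorphicD oV); first exact: holomorphic_cst.
  exact: (holomorphicM oV).
have hY := holomorphicM oV hid hq.
have h1 := @holomorphic_cst R V 1.
have [|f hf Hf] := arc_form om oV hX hY h1.
  move=> s /q2[E _]; apply: on_cone_affine; rewrite exprMn E; exact: branch_cub.
have dX s : derive1 (fun s => e + s * s : C) s = 2 * s.
  have := is_deriveD (@is_derive_cst _ _ _ (e : C) s 1) (is_derive_mul (is_derive_id s 1) (is_derive_id s 1)).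
  by move/is_derive1E => ->; rewrite add0r mul1r mulr1 mulr2n mulrDl mul1r.
exists V, q, f; split; [by split|by rewrite q0; split|exact: hf| |].
  (* The derivative of e + s^2 is 0 at s = 0, so the velocity there is vertical. *)
  have [-> _] := Hf 0 V0; rewrite derive1_cst dX !mulr0 addr0 mul0r.
  congr (om (_, (_, _, _))).
  have := is_derive_mul (is_derive_id (0 : C) 1) (holomorphic_is_derive hq V0).
  by move/is_derive1E => ->; rewrite mul0r addr0 mul1r.
move=> s Vs; have [E qs0] := q2 s Vs.
(* [branch_poly] is even, so s and - s give the points (x, y) and (x, - y). *)
have [|VN qN] := qs s (- s) Vs.
  by rewrite !horner_branch; ring.
split=> // s0; have [_] := Hf s Vs; rewrite mulr1 mulf_neq0 // => /(_ isT) ->.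
(* On the arc dx/y = 2 s ds / (s q) = 2 ds / q, whence the factor q / 2. *)
by rewrite !divr1 dX derive1_cst; field; rewrite s0 qs0.
Qed.

(** The value of Y^2 after X = s, Z = s^3 is put into the equation and s^3 is divided out. *)
Definition infinity_poly : {poly C} := 4%:P - a%:P * 'X^4 - b%:P * 'X^6.

Lemma horner_infinity s : infinity_poly.[s] = 4 - a * s ^+ 4 - b * s ^+ 6.
Proof. by rewrite /infinity_poly !(hornerE, hornerXn, hornerCM). Qed.

(* Near the point at infinity: X = s, Y = q(s), Z = s^3, i.e. x = s^-2, y = q(s) s^-3. *)
Lemma infinity_arc om :
  exists (V : set C) (q f : C -> C), [/\ open V /\ V 0, holomorphic V q /\ q 0 = 2,
    holomorphic V f, f 0 = om ((0, 2, 0), (1, derive1 q 0, 0)) &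
    forall s, V s -> [/\ q s ^+ 2 = infinity_poly.[s], V (- s) /\ q (- s) = q s, q s != 0 &
      s != 0 -> dz_ratio om (s / (s * s * s)) (q s / (s * s * s)) = - (q s / 2 * f s)]].
Proof.
have r0 : 2 ^+ 2 = infinity_poly.[0].
  by rewrite horner_infinity !expr0n /= !mulr0 !subr0; ring.
have r00 : (2 : C) != 0 by rewrite pnatr_eq0.
have [V [q [[oV V0] hq q0 q2 qs]]] := local_sqrt r00 r0.
have hid := @holomorphic_id R V.
have hZ : holomorphic V (fun s => s * s * s).
  by apply: (holomorphicM oV); [exact: (holomorphicM oV)|].
have [|f hf Hf] := arc_form om oV hid hq hZ.
  move=> s /q2[E qs0]; split; last by rewrite E horner_infinity; ring.
  by apply/eqP => -[_ /eqP]; rewrite (negbTE qs0).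
have dZ s : derive1 (fun s => s * s * s : C) s = 3 * (s * s).
  have := is_derive_mul (is_derive_mul (is_derive_id s 1) (is_derive_id s 1)) (is_derive_id s 1).
  by move/is_derive1E => ->; rewrite !mul1r !mulr1; ring.
have d1 s : derive1 (id : C -> C) s = 1 by exact: (is_derive1E (is_derive_id s 1)).
exists V, q, f; split; [by split|by split|exact: hf| |].
  by have [-> _] := Hf 0 V0; rewrite d1 dZ !mulr0 q0.
move=> s Vs; have [E qs0] := q2 s Vs.
have [|VN qN] := qs s (- s) Vs.
  by rewrite !horner_infinity; congr (_ - _ * _ - _ * _); ring.
split=> // s0; have [_] := Hf s Vs; rewrite !mulf_neq0 // => /(_ isT) ->.
(* Here dx/y = (- 2 s^-3 ds) / (q s^-3) = - 2 ds / q. *)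
by rewrite d1 dZ; field; rewrite s0 qs0.
Qed.

End forms.

(** * The line H^{1,0} of a smooth curve *)

Section holomorphic_forms.
Variable R : realType.
Local Notation C := (Cplx R).
Variables a b : C.
Implicit Types (x y z s t k : C) (om : H10 a b).
Local Notation cub := (cub a b).
Local Notation dcub := (dcub a).
Hypothesis smooth_curve : a ^+ 3 - 27 * b ^+ 2 != 0.

(** A double root e forces a = 12 e^2 and b = - 8 e^3, for which the discriminant vanishes. *)
Lemma simple_root e : cub e = 0 -> dcub e != 0.
Proof.
move=> ce; apply: contraNneq smooth_curve => de.
have aE : a = 12 * e ^+ 2 by apply: (eq_lincomb (c := -1) de); rewrite /dcub; ring.
have bE : b = - 8 * e ^+ 3.
  by apply: (eq_lincomb (c := -1) ce); rewrite /cub aE; ring.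
by rewrite aE bE; apply/eqP; ring.
Qed.

Lemma nm_lt_sqr s (d : R) : 0 < d -> nm (s * s) < d ^+ 2 -> nm s < d.
Proof. by move=> d0; rewrite nmM -expr2 ltr_sqr ?nnegrE ?nm_ge0 // ltW. Qed.

(** A point near the root is the arc point of parameter s or - s, where s^2 = x - e. There the ratio
    is a function holomorphic at s = 0, hence bounded. *)
Lemma ratio_bounded_near_root om e : cub e = 0 ->
  exists2 d : R, 0 < d & exists M : R, forall x y, y != 0 -> y ^+ 2 = cub x ->
    nm (x - e) < d -> nm (dz_ratio om x y) <= M.
Proof.
move=> ce; have [V [q [f [[oV V0] [hq _] hf _ H]]]] := branch_arc om ce (simple_root ce).
pose G s := q s / 2 * f s.
have hG : holomorphic V G.
  by apply: (holomorphicM oV _ hf); apply: (holomorphicM oV hq); exact: holomorphic_cst.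
have [d1 d10 H1] := (continuousC_eps G 0).1 (holomorphic_cvg hG V0) 1 ltr01.
have [d2 d20 H2] := (openC_eps V).1 oV 0 V0.
pose d := Num.min d1 d2; have d0 : 0 < d by rewrite lt_min d10.
exists (d ^+ 2); first exact: exprn_gt0.
exists (nm (G 0) + 1) => x y y0 yx xe.
pose s := csqrt (x - e); have ss : s * s = x - e by rewrite -expr2 sqr_csqrt.
have xE : x = e + s * s by rewrite ss addrC subrK.
have s0 : s != 0.
  apply: contraNneq y0 => s0; rewrite -sqrf_eq0 yx xE s0 mulr0 addr0 ce //.
have sd : nm s < d by apply: nm_lt_sqr => //; rewrite ss.
have bound t : nm t < d -> t != 0 -> t * t = s * s -> y = t * q t -> nm (dz_ratio om x y) <= nm (G 0) + 1.
  rewrite lt_min => /andP[t1 t2] t0 tt ->; rewrite xE -tt.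
  have Vt : V t by apply: H2; rewrite subr0.
  have [_ _ _ ->//] := H t Vt; rewrite -/(G t) -(subrK (G 0) (G t)) addrC.
  by rewrite (le_trans (nmD _ _)) // lerD2l ltW // H1 // subr0.
have Vs : V s by apply: H2; rewrite subr0; move: sd; rewrite lt_min => /andP[].
have [q2 [VN qN] _ _] := H s Vs.
have : y ^+ 2 == (s * q s) ^+ 2.
  by rewrite yx exprMn q2 (branch_cub s ce) -xE.
rewrite eqf_sqr => /orP[/eqP E|/eqP E]; first exact: (bound s).
apply: (bound (- s)); rewrite ?nmN ?oppr_eq0 ?mulrNN //.
by rewrite qN mulNr.
Qed.

(** On the arc at infinity the ratio is G s with x = s^-2, so it differs from G 0 by O(s). Squaring
    and multiplying by |x| states this decay without a square root. *)
Lemma ratio_infinity om : exists (c0 : C) (rho B : R), forall x y, y != 0 -> y ^+ 2 = cub x ->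
  rho < nm x -> nm (dz_ratio om x y - c0) ^+ 2 * nm x <= B.
Proof.
have [V [q [f [[oV V0] [hq _] hf _ H]]]] := infinity_arc om.
pose G s := - (q s / 2 * f s).
have hG : holomorphic V G.
  apply: (holomorphicN oV).
  by apply: (holomorphicM oV _ hf); apply: (holomorphicM oV hq); exact: holomorphic_cst.
have [d1 d10 H1] := (is_deriveC_eps _ _ _).1 (holomorphic_is_derive hG V0) 1 ltr01.
have [d2 d20 H2] := (openC_eps V).1 oV 0 V0.
set D := derive1 G 0 in H1.
pose d := Num.min d1 d2; have d0 : 0 < d by rewrite lt_min d10.
exists (G 0), (d ^- 2), ((1 + nm D) ^+ 2) => x y y0 yx xd.
have x0 : 0 < nm x by apply: le_lt_trans xd; rewrite invr_ge0 sqr_ge0.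
have x_0 : x != 0 by rewrite -nm_gt0.
pose s := csqrt x^-1; have ss : s * s = x^-1 by rewrite -expr2 sqr_csqrt.
have s0 : s != 0.
  by rewrite -sqrf_eq0 expr2 ss invr_eq0.
have sd : nm s < d.
  apply: nm_lt_sqr => //; rewrite ss nmV -[ltRHS]invrK ltf_pV2 // posrE //.
  by rewrite invr_gt0 exprn_gt0.
have xE t : t != 0 -> t * t = s * s -> x = t / (t * t * t).
  move=> t0 tt; have -> : t / (t * t * t) = (t * t)^-1 by field.
  by rewrite tt ss invrK.
have bound t : nm t < d -> t != 0 -> t * t = s * s -> y = q t / (t * t * t) ->
    nm (dz_ratio om x y - G 0) <= (1 + nm D) * nm t.
  rewrite lt_min => /andP[t1 t2] t0 tt ->; rewrite (xE t) //.
  have Vt : V t by apply: H2; rewrite subr0.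
  have [_ _ _ ->//] := H t Vt; rewrite -/(G t).
  have := H1 t t1; rewrite add0r mul1r => K.
  rewrite -(subrK (D * t) (G t - G 0)) (le_trans (nmD _ _)) //.
  by rewrite mulrDl mul1r nmM lerD2r.
have Vs : V s by apply: H2; rewrite subr0; move: sd; rewrite lt_min => /andP[].
have [q2 [VN qN] _ _] := H s Vs.
suff K : nm (dz_ratio om x y - G 0) <= (1 + nm D) * nm s.
  have ns : nm s ^+ 2 * nm x = 1.
    by rewrite -nmX -nmM expr2 ss mulVf // nm1.
  have := lerXn2r 2 (nm_ge0 _) _ K; rewrite nnegrE mulr_ge0 ?addr_ge0 ?nm_ge0 // => /(_ isT).
  move/(ler_wpM2r (ltW x0)); rewrite [X in _ <= X * _]exprMn -[X in _ <= X]mulrA.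
  by rewrite ns mulr1.
have : y ^+ 2 == (q s / (s * s * s)) ^+ 2.
  rewrite yx exprMn q2 horner_infinity {1}(xE s) //; apply/eqP; rewrite /cub.
  have -> : s / (s * s * s) = (s ^+ 2)^-1 by field.
  by field.
rewrite eqf_sqr => /orP[/eqP E|/eqP E]; first exact: (bound s).
rewrite -(nmN s); apply: (bound (- s)); rewrite ?nmN ?oppr_eq0 ?mulrNN //.
by rewrite qN E mulrN invrN mulrN.
Qed.

(* A symmetric function T of the values of om / (dx/y) at (x, y) and (x, -y) is a
   function of x alone, although the square root y is not. *)
Lemma symmetric_vanish om (c0 : C) (rho B : R) (T : C -> C -> C) :
  (forall x y, y != 0 -> y ^+ 2 = cub x ->
    rho < nm x -> nm (dz_ratio om x y - c0) ^+ 2 * nm x <= B) ->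
  (forall u v, T u v = T v u) ->
  (forall V f g, open V -> holomorphic V f -> holomorphic V g ->
     holomorphic V (fun z => T (f z) (g z))) ->
  (forall u v (M : R), nm u <= M -> nm v <= M -> nm (T u v) <= 2 * M + M ^+ 2) ->
  (forall u v (N n : R), 1 <= n -> nm u ^+ 2 * n <= N -> nm v ^+ 2 * n <= N ->
     nm (T u v) ^+ 2 * n <= 4 * N + N ^+ 2) ->
  forall x y, y != 0 -> y ^+ 2 = cub x -> T (dz_ratio om x y - c0) (dz_ratio om x (- y) - c0) = 0.
Proof.
move=> decay symT holT bT dT.
pose Y x := csqrt (cub x); have Y2 x : Y x ^+ 2 = cub x by exact: sqr_csqrt.
have Y0 x : cub x != 0 -> Y x != 0 by move=> h; rewrite -sqrf_eq0 Y2.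
pose S x := T (dz_ratio om x (Y x) - c0) (dz_ratio om x (- Y x) - c0).
have SE x y : y ^+ 2 = cub x -> T (dz_ratio om x y - c0) (dz_ratio om x (- y) - c0) = S x.
  move=> yx; have : y ^+ 2 == Y x ^+ 2 by rewrite yx Y2.
  rewrite eqf_sqr => /orP[/eqP ->|/eqP ->] //.
  by rewrite opprK symT.
move=> x y y0 yx; rewrite SE //.
have fx0 : cub x != 0 by rewrite -yx sqrf_eq0.
move: x fx0 {y y0 yx}.
apply: (@vanish_off_roots _ a b S (4 * B + B ^+ 2) (Num.max 1 rho)).
- move=> x /Y0 h; have [V [q [r [r' [[oV Vx] hr hr' q2 qr]]]]] := ratio_regular om h (Y2 x).
  exists V; first by split.
  have hc := @holomorphic_cst R V c0.
  apply: (holomorphic_on oV _ (holT V _ _ oV (holomorphicB oV hr hc) (holomorphicB oV hr' hc))).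
  by move=> w Vw; have [<- <-] := qr w Vw; rewrite SE //; case: (q2 w Vw).
- move=> e /(ratio_bounded_near_root om)[d d0 [M HM]]; exists d => //.
  exists (2 * (M + nm c0) + (M + nm c0) ^+ 2) => x fx xe.
  have hb y' : y' != 0 -> y' ^+ 2 = cub x -> nm (dz_ratio om x y' - c0) <= M + nm c0.
    by move=> y'0 y'x; rewrite (le_trans (nmD _ _)) // nmN lerD2r; exact: HM.
  by apply: bT; apply: hb; rewrite ?sqrrN ?Y2 ?oppr_eq0 ?Y0.
- move=> x fx; rewrite gt_max => /andP[x1 xr].
  by apply: dT; [exact: ltW|apply: decay|apply: decay]; rewrite ?sqrrN ?Y2 ?oppr_eq0 ?Y0.
Qed.

Lemma ratio_const om : exists c0, forall x y, y != 0 -> y ^+ 2 = cub x -> dz_ratio om x y = c0.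
Proof.
have [c0 [rho [B decay]]] := ratio_infinity om; exists c0 => x y y0 yx.
have sq2 (u v : R) : (u + v) ^+ 2 <= 2 * (u ^+ 2 + v ^+ 2).
  by rewrite -subr_ge0 (_ : _ - _ = (u - v) ^+ 2) ?sqr_ge0 //; ring.
(* The bounds 2 M + M^2 and 4 N + N^2 in [symmetric_vanish] are chosen to cover the sum and the
   product at once. *)
have h1 := @symmetric_vanish om c0 rho B (fun u v => u + v) decay _ _ _ _ x y y0 yx.
have h2 := @symmetric_vanish om c0 rho B (fun u v => u * v) decay _ _ _ _ x y y0 yx.
have {}h1 : (dz_ratio om x y - c0) + (dz_ratio om x (- y) - c0) = 0.
  apply: h1 => [u v|V f g|u v M uM vM|u v N n n1 uN vN].
  - exact: addrC.
  - exact: holomorphicD.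
  - rewrite (le_trans (nmD _ _)) // (le_trans (lerD uM vM)) //.
    by rewrite [2 * M]mulr_natl mulr2n lerDl sqr_ge0.
  - have N0 : 0 <= N by apply: le_trans uN; rewrite mulr_ge0 ?sqr_ge0 // (le_trans ler01).
    have n0 : 0 <= n by apply: le_trans n1.
    have K : nm (u + v) ^+ 2 <= 2 * (nm u ^+ 2 + nm v ^+ 2).
      by apply: le_trans (sq2 _ _); rewrite ler_sqr ?nnegrE ?addr_ge0 ?nm_ge0 // nmD.
    apply: le_trans (ler_wpM2r n0 K) _; rewrite -mulrA mulrDl.
    have := sqr_ge0 N; lra.
have {}h2 : (dz_ratio om x y - c0) * (dz_ratio om x (- y) - c0) = 0.
  apply: h2 => [u v|V f g|u v M uM vM|u v N n n1 uN vN].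
  - exact: mulrC.
  - exact: holomorphicM.
  - have M0 : 0 <= M by apply: le_trans uM; exact: nm_ge0.
    by rewrite nmM (le_trans (ler_pM (nm_ge0 _) (nm_ge0 _) uM vM)) // -expr2 lerDr mulr_ge0.
  - have N0 : 0 <= N by apply: le_trans uN; rewrite mulr_ge0 ?sqr_ge0 // (le_trans ler01).
    have vN' : nm v ^+ 2 <= N by apply: le_trans vN; rewrite ler_peMr ?sqr_ge0.
    have n0 : 0 <= n by apply: le_trans n1.
    rewrite nmM exprMn mulrAC (le_trans (ler_pM _ _ uN vN')) ?sqr_ge0 ?mulr_ge0 ?nm_ge0 //.
    by rewrite -expr2 lerDr mulr_ge0.
apply/eqP; rewrite -subr_eq0 -sqrf_eq0; apply/eqP.
move: h1 h2; set u := _ - c0; set v := _ - c0 => h1 h2.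
(* u is a root of T^2 - (u + v) T + u v, which is T^2 here. *)
have -> : u ^+ 2 = u * (u + v) - u * v by ring.
by rewrite h1 h2 mulr0 subrr.
Qed.

Local Notation on_cone := (on_cone a b).
Local Notation tangent := (tangent a b).
Local Notation C3 := (C^o * C^o * C^o)%type.
Implicit Types (P w : C3).

Lemma triple_eq (x y z x' y' z' : C) : x = x' -> y = y' -> z = z' ->
  ((x, y, z) : C3) = (x', y', z').
Proof. by move=> -> -> ->. Qed.

(** The gradient of Y^2 Z - 4 X^3 + a X Z^2 + b Z^3. [tangent P w] says that it is orthogonal to w,
    and by Euler's relation it is orthogonal to P on the cone. *)
Definition grad P : C3 :=
  let: (X, Y, Z) := P in
  (a * Z ^+ 2 - 12 * X ^+ 2, 2 * Y * Z, Y ^+ 2 + 2 * a * X * Z + 3 * b * Z ^+ 2).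

Definition cross P w : C3 :=
  let: (X, Y, Z) := P in let: (X', Y', Z') := w in
  (Y * Z' - Z * Y', Z * X' - X * Z', X * Y' - Y * X').

(** A zero of the gradient with Z = 0 would be the origin; one with Z nonzero would have Y = 0 and X
    / Z a double root of the cubic. *)
Lemma grad_neq0 P : on_cone P -> grad P != 0.
Proof.
case: P => [[X Y] Z] [P0 E]; apply: contraNneq P0 => -[gX gY gZ].
have [Z0|Z0] := eqVneq Z 0.
  have /eqP X3 : 4 * X ^+ 3 = 0 by move: E; rewrite Z0 => E; apply: (eq_lincomb (c := -1) E); ring.
  have X0 : X = 0 by apply/eqP; move: X3; rewrite mulf_eq0 pnatr_eq0 expf_eq0.
  have /eqP Y0 : Y ^+ 2 = 0 by apply: (eq_lincomb (c := 1) gZ); rewrite Z0; ring.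
  have {}Y0 : Y = 0 by apply/eqP; move: Y0; rewrite expf_eq0.
  by rewrite X0 Y0 Z0.
have Y0 : Y = 0.
  by apply/eqP; move/eqP: gY; rewrite !mulf_eq0 (negbTE Z0) pnatr_eq0 orbF.
have cx : cub (X / Z) = 0.
  have -> : cub (X / Z) = (4 * X ^+ 3 - a * X * Z ^+ 2 - b * Z ^+ 3) / Z ^+ 3 by rewrite /cub; field.
  by rewrite -E Y0 expr0n /= !mul0r.
have := simple_root cx; rewrite (_ : dcub _ = - (a * Z ^+ 2 - 12 * X ^+ 2) / Z ^+ 2).
  by rewrite gX oppr0 mul0r eqxx.
by rewrite /dcub; field.
Qed.

(** Up to sign, the 2 x 2 minors are the components of grad x (P x w) = P (grad . w) - w (grad . P),
    and both scalar products vanish. The [transitivity] terms spell this out, with grad . P equal to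
    3 times the cubic form. *)
Lemma cross_grad P w : on_cone P -> tangent P w ->
  [/\ (cross P w).1.1 * (grad P).1.2 = (cross P w).1.2 * (grad P).1.1,
      (cross P w).1.1 * (grad P).2 = (cross P w).2 * (grad P).1.1 &
      (cross P w).1.2 * (grad P).2 = (cross P w).2 * (grad P).1.2].
Proof.
case: P w => [[X Y] Z] [[X' Y'] Z'] [_ E] /= T; split; apply/eqP; rewrite -subr_eq0; apply/eqP.
- transitivity (3 * Z' * (Y ^+ 2 * Z - (4 * X ^+ 3 - a * X * Z ^+ 2 - b * Z ^+ 3)) - Z *
    (2 * Y * Y' * Z + Y ^+ 2 * Z' - (12 * X ^+ 2 * X' - a * (X' * Z ^+ 2 + 2 * X * Z * Z') - 3 * b * Z ^+ 2 * Z')));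
    first ring.
  by rewrite E T !subrr !mulr0 subr0.
- transitivity (-3 * Y' * (Y ^+ 2 * Z - (4 * X ^+ 3 - a * X * Z ^+ 2 - b * Z ^+ 3)) + Y *
    (2 * Y * Y' * Z + Y ^+ 2 * Z' - (12 * X ^+ 2 * X' - a * (X' * Z ^+ 2 + 2 * X * Z * Z') - 3 * b * Z ^+ 2 * Z')));
    first ring.
  by rewrite E T !subrr !mulr0 addr0.
- transitivity (3 * X' * (Y ^+ 2 * Z - (4 * X ^+ 3 - a * X * Z ^+ 2 - b * Z ^+ 3)) - X *
    (2 * Y * Y' * Z + Y ^+ 2 * Z' - (12 * X ^+ 2 * X' - a * (X' * Z ^+ 2 + 2 * X * Z * Z') - 3 * b * Z ^+ 2 * Z')));
    first ring.
  by rewrite E T !subrr !mulr0 subr0.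
Qed.

(* The cross product P x w is a multiple of the gradient; dx/y is twice the ratio. *)
Definition dz_fun (Pw : C3 * C3) : C^o :=
  if `[< on_cone Pw.1 /\ tangent Pw.1 Pw.2 >] then
    let g := grad Pw.1 in let c := cross Pw.1 Pw.2 in
    if g.1.2 != 0 then 2 * c.1.2 / g.1.2 else
    if g.1.1 != 0 then 2 * c.1.1 / g.1.1 else 2 * c.2 / g.2
  else 0.

(** Replaces the case distinction of [dz_fun] by three equations with a unique solution, on which
    linearity, scaling and holomorphy can be checked. *)
Lemma dz_funP P w : on_cone P -> tangent P w -> forall t : C, dz_fun (P, w) = t <->
  [/\ t * (grad P).1.1 = 2 * (cross P w).1.1, t * (grad P).1.2 = 2 * (cross P w).1.2 &
      t * (grad P).2 = 2 * (cross P w).2].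
Proof.
move=> cP tw t; rewrite /dz_fun asboolT //=; have [h1 h2 h3] := cross_grad cP tw.
have := grad_neq0 cP; move: (grad P) (cross P w) h1 h2 h3 => [[g1 g2] g3] [[c1 c2] c3] /= h1 h2 h3 g0.
case: ifPn => [g20|/negPn/eqP g20].
  split=> [<-|[_ <- _]]; last by field.
  split; [|by field|].
    by rewrite mulrAC -(mulrA 2) -h1; field.
  by rewrite mulrAC -(mulrA 2) h3; field.
case: ifPn => [g10|/negPn/eqP g10].
  split=> [<-|[<- _ _]]; last by field.
  split; [by field| |].
    by rewrite mulrAC -(mulrA 2) h1; field.
  by rewrite mulrAC -(mulrA 2) h2; field.
have g30 : g3 != 0 by apply: contraNneq g0 => ->; rewrite g10 g20.
split=> [<-|[_ _ <-]]; last by field.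
split; [| |by field].
  by rewrite mulrAC -(mulrA 2) -h2; field.
by rewrite mulrAC -(mulrA 2) -h3; field.
Qed.

Lemma open_neq0 (V : set C) (G : C -> C) : open V -> holomorphic V G ->
  open [set t | V t /\ G t != 0].
Proof.
move=> oV hG; apply/openC_eps => z [Vz Gz]; rewrite -nm_gt0 in Gz.
have [d1 d10 H1] := (openC_eps V).1 oV z Vz.
have [d2 d20 H2] := (continuousC_eps G z).1 (holomorphic_cvg hG Vz) _ Gz.
exists (Num.min d1 d2) => [|w]; first by rewrite lt_min d10.
rewrite lt_min => /andP[w1 w2]; split; first exact: H1.
by apply/eqP => Gw; have := H2 w w2; rewrite Gw sub0r nmN ltxx.
Qed.

Lemma holomorphic_quotient (V : set C) (f c g : C -> C) : open V ->
  holomorphic V c -> holomorphic V g -> (forall t, V t -> f t * g t = c t) ->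
  forall t, V t -> g t != 0 -> exists2 W : set C, open W /\ W t & holomorphic W f.
Proof.
move=> oV hc hg fgc t Vt gt0; pose W := [set t | V t /\ g t != 0].
have oW : open W := open_neq0 oV hg.
have WV : W `<=` V by move=> w [].
exists W; first by split.
have gW (w : C) : W w -> g w != 0 by case.
apply: (holomorphic_on oW _ (holomorphic_div oW gW (holomorphic_sub WV hc) (holomorphic_sub WV hg))).
by move=> w [Vw gw]; rewrite -fgc // mulfK.
Qed.

(** Near each t one component of the gradient is nonzero, and there the form is a quotient of
    holomorphic functions. *)
Lemma dz_fun_arc (V : set C) (X Y Z : C -> C) : open V ->
  holomorphic V X -> holomorphic V Y -> holomorphic V Z ->
  (forall t, V t -> on_cone (X t, Y t, Z t)) ->
  holomorphic V (fun t => dz_fun ((X t, Y t, Z t), (derive1 X t, derive1 Y t, derive1 Z t))).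
Proof.
move=> oV hX hY hZ cone.
have tg := arc_tangent oV hX hY hZ cone.
have hX' := holomorphic_derive1 hX; have hY' := holomorphic_derive1 hY.
have hZ' := holomorphic_derive1 hZ; have hk c := @holomorphic_cst R V c.
have spec t : V t -> _ := fun Vt => (dz_funP (cone t Vt) (tg t Vt) _).1 erefl.
apply: holomorphic_local => t Vt.
have := grad_neq0 (cone t Vt); rewrite -!pair_eqE /= !negb_and -orbA => /or3P[] g0.
- apply: (@holomorphic_quotient V _ (fun t => 2 * (Y t * derive1 Z t - Z t * derive1 Y t))
    (fun t => a * Z t ^+ 2 - 12 * X t ^+ 2) oV _ _ _ t Vt g0).
  + apply: (holomorphicM oV (hk 2)).
    exact: (holomorphicB oV (holomorphicM oV hY hZ') (holomorphicM oV hZ hY')).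
  + apply: (holomorphicB oV); apply: (holomorphicM oV (hk _)).
      exact: (holomorphicX oV hZ).
    exact: (holomorphicX oV hX).
  + by move=> w Vw; have [h _ _] := spec w Vw; exact: h.
- apply: (@holomorphic_quotient V _ (fun t => 2 * (Z t * derive1 X t - X t * derive1 Z t))
    (fun t => 2 * Y t * Z t) oV _ _ _ t Vt g0).
  + apply: (holomorphicM oV (hk 2)).
    exact: (holomorphicB oV (holomorphicM oV hZ hX') (holomorphicM oV hX hZ')).
  + by apply: (holomorphicM oV _ hZ); exact: (holomorphicM oV (hk _) hY).
  + by move=> w Vw; have [_ h _] := spec w Vw; exact: h.
- apply: (@holomorphic_quotient V _ (fun t => 2 * (X t * derive1 Y t - Y t * derive1 X t))
    (fun t => Y t ^+ 2 + 2 * a * X t * Z t + 3 * b * Z t ^+ 2) oV _ _ _ t Vt g0).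
  + apply: (holomorphicM oV (hk 2)).
    exact: (holomorphicB oV (holomorphicM oV hX hY') (holomorphicM oV hY hX')).
  + apply: (holomorphicD oV).
      apply: (holomorphicD oV); first exact: (holomorphicX oV hY).
      by apply: (holomorphicM oV _ hZ); exact: (holomorphicM oV (hk _) hX).
    by apply: (holomorphicM oV (hk _)); exact: (holomorphicX oV hZ).
  + by move=> w Vw; have [_ _ h] := spec w Vw; exact: h.
Qed.

Lemma dz_fun_H10 : dz_fun \in is_H10 a b.
Proof.
apply/asboolP; split.
- by move=> P w nPw; rewrite /dz_fun asboolF.
- move=> P w w' k cP tw tw'.
  have [h1 h2 h3] := (dz_funP cP tw _).1 erefl; have [h1' h2' h3'] := (dz_funP cP tw' _).1 erefl.
  apply/(dz_funP cP (tangent_lin k tw tw')).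
  rewrite !mulrDl -!mulrA h1 h2 h3 h1' h2' h3'.
  case: P w w' {cP tw tw' h1 h2 h3 h1' h2' h3'} => [[X Y] Z] [[X1 Y1] Z1] [[X2 Y2] Z2].
  by rewrite /GRing.scale /= /GRing.scale /=; split; ring.
- move=> P cP; apply/(dz_funP cP (tangent_radial cP)).
  by case: P {cP} => [[X Y] Z] /=; split; ring.
- move=> P w k cP tw k0; have [h1 h2 h3] := (dz_funP cP tw _).1 erefl.
  apply/(dz_funP (on_coneZ k0 cP) (tangentZ k tw)).
  (* Scaling P and w by k multiplies both the cross product and the gradient by k^2, so the quotient
     is invariant. *)
  have E1 : cross (k *: P) (k *: w) = k ^+ 2 *: cross P w.
    case: P w {cP tw h1 h2 h3} => [[X Y] Z] [[X1 Y1] Z1].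
    rewrite /GRing.scale /= /GRing.scale /=; by apply: triple_eq; rewrite /GRing.scale /=; ring.
  have E2 : grad (k *: P) = k ^+ 2 *: grad P.
    case: P {cP tw h1 h2 h3 E1} => [[X Y] Z].
    by rewrite /GRing.scale /= /GRing.scale /=; apply: triple_eq; rewrite /GRing.scale /=; ring.
  rewrite E1 E2 /GRing.scale /= /GRing.scale /= ![_ * (k ^+ 2 * _)]mulrCA.
  by rewrite h1 h2 h3.
- exact: dz_fun_arc.
Qed.

(** [dz] is picked by [xget] with default 0; the witness [dz_fun] shows that there is something to
    pick. *)
Lemma dz_spec X Y Z X' Y' Z' : on_cone (X, Y, Z) -> tangent (X, Y, Z) (X', Y', Z') ->
  Y * Z != 0 -> dz a b ((X, Y, Z), (X', Y', Z')) = (Z * X' - X * Z') / (Y * Z).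
Proof.
move=> cP tw YZ; apply: (@xgetPex _ 0 [set om : H10 a b | forall X Y Z X' Y' Z' : C,
  on_cone (X, Y, Z) -> tangent (X, Y, Z) (X', Y', Z') -> Y * Z != 0 ->
  om ((X, Y, Z), (X', Y', Z')) = (Z * X' - X * Z') / (Y * Z)]) => //.
exists (HolomorphicForm dz_fun_H10) => {cP tw YZ} {}X {}Y {}Z {}X' {}Y' {}Z' cP tw YZ /=.
apply/(dz_funP cP tw) => /=; have [h1 _ h3] := cross_grad cP tw.
move: YZ; rewrite mulf_eq0 negb_or => /andP[Y0 Z0].
split; last 1 first.
- have -> : (Z * X' - X * Z') / (Y * Z) * (Y ^+ 2 + 2 * a * X * Z + 3 * b * Z ^+ 2) =
    ((Z * X' - X * Z') * (Y ^+ 2 + 2 * a * X * Z + 3 * b * Z ^+ 2)) / (Y * Z) by rewrite mulrAC.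
  by rewrite [X in X / _]h3 /=; field; rewrite Y0 Z0.
- have -> : (Z * X' - X * Z') / (Y * Z) * (a * Z ^+ 2 - 12 * X ^+ 2) =
    ((Z * X' - X * Z') * (a * Z ^+ 2 - 12 * X ^+ 2)) / (Y * Z) by rewrite mulrAC.
  by rewrite -[X in X / _]h1 /=; field; rewrite Y0 Z0.
- by field; rewrite Y0 Z0.
Qed.

Lemma holomorphic_eq0 (V : set C) (f : C -> C) : open V -> V 0 -> holomorphic V f ->
  (forall s, V s -> s != 0 -> f s = 0) -> f 0 = 0.
Proof.
move=> oV V0 hf f0; apply/eqP; apply: contraT; rewrite -nm_gt0 => fp.
have [d1 d10 H1] := (openC_eps V).1 oV 0 V0.
have [d2 d20 H2] := (continuousC_eps f 0).1 (holomorphic_cvg hf V0) _ fp.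
pose d := Num.min d1 d2; have d0 : 0 < d by rewrite lt_min d10.
pose s : C := (d / 2)%:C%C; have ns : nm s = d / 2 by rewrite nmR gtr0_norm // divr_gt0.
have : nm s < d by rewrite ns ltr_pdivrMr // ltr_pMr // ltr1n.
rewrite lt_min => /andP[s1 s2].
have s0 : s != 0 by rewrite -nm_gt0 ns divr_gt0.
have Vs : V s by apply: H1; rewrite subr0.
by have := H2 s; rewrite subr0 (f0 s Vs s0) sub0r nmN ltxx => /(_ s2).
Qed.

(** The points with Y Z = 0 need an argument: infinity and the branch points. There a tangent vector
    is, up to a radial part, a multiple of the velocity of the local arc. The pullback to the arc
    vanishes for s <> 0, hence at s = 0 by continuity. *)
Lemma form_eq0 om : (forall x y, y != 0 -> y ^+ 2 = cub x -> dz_ratio om x y = 0) -> om = 0.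
Proof.
move=> r0; apply/val_inj/funext => -[P w]; rewrite -[LHS]/(om (P, w)) -[RHS]/(0 : C).
have [zero _ _ scal _] := H10_spec om.
have [[cP tw]|] := pselect (on_cone P /\ tangent P w); last exact: zero.
case: P w cP tw => [[X Y] Z] [[X' Y'] Z'] cP tw; have [P0 E] := cP.
have [Z0|Z0] := eqVneq Z 0.
  have /eqP X3 : 4 * X ^+ 3 = 0 by move: E; rewrite Z0 => E; apply: (eq_lincomb (c := -1) E); ring.
  have X0 : X = 0 by apply/eqP; move: X3; rewrite mulf_eq0 pnatr_eq0 expf_eq0.
  have Y0 : Y != 0 by apply: contraNneq P0 => ->; rewrite X0 Z0.
  have Z'0 : Z' = 0.
    have /eqP : Y ^+ 2 * Z' = 0.
      by apply: (eq_lincomb (c := 1) (tw : _ = _ :> C)); rewrite X0 Z0; ring.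
    by rewrite mulf_eq0 expf_eq0 (negbTE Y0) => /eqP.
  have [V [q [f [[oV V0] [hq q0] hf f0 H]]]] := infinity_arc om.
  have f00 : f 0 = 0.
    apply: (holomorphic_eq0 oV V0 hf) => s Vs s0; have [q2 _ qs0 /(_ s0)] := H s Vs.
    rewrite r0 ?mulf_neq0 ?invr_eq0 ?mulf_neq0 //.
      move/eqP; rewrite eq_sym oppr_eq0 !mulf_eq0 (negbTE qs0) invr_eq0 pnatr_eq0.
      by move/eqP.
    rewrite exprMn q2 horner_infinity /cub.
    have -> : s / (s * s * s) = (s ^+ 2)^-1 by field.
    by field.
  move: cP tw; rewrite {P0} X0 Z0 Z'0 => cP tw.
  have k0 : 2 / Y != 0 by rewrite mulf_neq0 ?invr_eq0 ?pnatr_eq0.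
  rewrite -(scal _ _ (2 / Y) cP tw k0).
  have E1 : (2 / Y) *: ((0, Y, 0) : C3) = (0, 2, 0).
    by rewrite -[LHS]/(2 / Y * 0, 2 / Y * Y, 2 / Y * 0); apply: triple_eq; field.
  have E2 : (2 / Y) *: ((X', Y', 0) : C3) = (2 / Y * X') *: ((1, derive1 q 0, 0) : C3) +
      ((2 / Y * Y' - 2 / Y * X' * derive1 q 0) / 2) *: ((0, 2, 0) : C3).
    rewrite -[LHS]/(2 / Y * X', 2 / Y * Y', 2 / Y * 0).
    rewrite -[RHS]/(2 / Y * X' * 1 + (2 / Y * Y' - 2 / Y * X' * derive1 q 0) / 2 * 0,
      2 / Y * X' * derive1 q 0 + (2 / Y * Y' - 2 / Y * X' * derive1 q 0) / 2 * 2,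
      2 / Y * X' * 0 + (2 / Y * Y' - 2 / Y * X' * derive1 q 0) / 2 * 0).
    by apply: triple_eq; field.
  have cP2 : on_cone (0, 2, 0) by rewrite -E1; exact: on_coneZ.
  rewrite E1 E2 form_radial //; last by rewrite /=; ring.
  by rewrite -f0 f00 mulr0.
have [Y0|Y0] := eqVneq Y 0; last first.
  by rewrite form_regular ?mulf_neq0 // r0 ?mulr0 ?mulf_neq0 ?invr_eq0 //;
     rewrite exprMn /cub; move: E => E;
     have -> : Y ^+ 2 * Z^-1 ^+ 2 = Y ^+ 2 * Z / Z ^+ 3 by [field]; rewrite ?E; field.
pose e : C := X / Z.
have E0 : (Z^-1 *: ((X, Y, Z) : C3)) = (e, 0, 1).
  by rewrite -[LHS]/(Z^-1 * X, Z^-1 * Y, Z^-1 * Z) Y0 mulr0 mulVf // [_ * X]mulrC.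
have V0 : Z^-1 != 0 by rewrite invr_eq0.
have tw0 := tangentZ Z^-1 tw; have cP0 := on_coneZ V0 cP.
rewrite -(scal _ _ Z^-1 cP tw V0) {1}E0; rewrite E0 in tw0 cP0.
have ce : cub e = 0.
  have [_ K] := cP0; rewrite /cub; apply: (eq_lincomb (c := -1) K); ring.
have [W [q [f [[oW W0] [hq q0] hf f0 H]]]] := branch_arc om ce (simple_root ce).
have f00 : f 0 = 0.
  apply: (holomorphic_eq0 oW W0 hf) => s Ws s0; have [q2 _ qs0 /(_ s0)] := H s Ws.
  rewrite r0 ?mulf_neq0 //.
    move/eqP; rewrite eq_sym !mulf_eq0 (negbTE qs0) invr_eq0 pnatr_eq0.
    by move/eqP.
  by rewrite exprMn q2 (branch_cub s ce).
move: tw0; set w0 := _ *: _.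
have -> : w0 = (Z^-1 * X', Z^-1 * Y', Z^-1 * Z') by [].
move: (Z^-1 * X') (Z^-1 * Y') (Z^-1 * Z') => x' y' z' tw0.
have de := simple_root ce.
(* At a branch point tangency forces the affine x-velocity x' - e z' to vanish, because e is a
   simple root. *)
have xE : x' = e * z'.
  have K : 12 * e ^+ 2 * x' - a * (x' + 2 * e * z') - 3 * b * z' = 0.
    by apply: (eq_lincomb (c := -1) (tw0 : _ = _ :> C)); ring.
  have : dcub e * (x' - e * z') = 0.
    have -> : dcub e * (x' - e * z') = (12 * e ^+ 2 * x' - a * (x' + 2 * e * z') - 3 * b * z') -
       3 * z' * cub e by rewrite /cub /dcub; ring.
    by rewrite K ce mulr0 subrr.
  by move/eqP; rewrite mulf_eq0 (negbTE de) subr_eq0 => /eqP.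
have -> : ((x', y', z') : C3) = (y' / q 0) *: ((0, q 0, 0) : C3) + z' *: ((e, 0, 1) : C3).
  rewrite -[RHS]/(y' / q 0 * 0 + z' * e, y' / q 0 * q 0 + z' * 0, y' / q 0 * 0 + z' * 1) xE.
  by apply: triple_eq; field.
rewrite form_radial //; last by rewrite /=; ring.
by rewrite -f0 f00 mulr0.
Qed.

Lemma H10_dim1 om : exists! k : C, om = k *: dz a b.
Proof.
have [c0 Hc] := ratio_const om.
have dzr x y : y != 0 -> y ^+ 2 = cub x -> dz_ratio (dz a b) x y = 1.
  move=> y0 yx; rewrite /dz_ratio dz_spec ?mulr1 //; first by field.
  - exact: on_cone_affine.
  - exact: tangent_affine.
exists c0; split.
  apply/eqP; rewrite -subr_eq0; apply/eqP/form_eq0 => x y y0 yx.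
  have -> : dz_ratio (om - c0 *: dz a b) x y = dz_ratio om x y - c0 * dz_ratio (dz a b) x y.
    rewrite /dz_ratio mulrCA -mulrBr; congr (_ * _).
  by rewrite dzr // mulr1 Hc // subrr.
move=> k kE.
(* The values at -1, 0, 1, 2 cannot all vanish: their third difference is 4 * 3! = 24. *)
have [x fx] : exists x, cub x != 0.
  have [c1|c1] := eqVneq (cub 0) 0; last by exists 0.
  have [c2|c2] := eqVneq (cub 1) 0; last by exists 1.
  have [c3|c3] := eqVneq (cub (-1)) 0; last by exists (-1).
  have [c4|c4] := eqVneq (cub 2) 0; last by exists 2.
  exfalso; have : (24 : C) = 0.
    transitivity (cub 2 - 3 * cub 1 + 3 * cub 0 - cub (-1)); first by rewrite /cub; ring.
    by rewrite c1 c2 c3 c4; ring.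
  by move/eqP; rewrite pnatr_eq0.
have y2 := sqr_csqrt (cub x); set y := csqrt _ in y2.
have y0 : y != 0 by rewrite -sqrf_eq0 y2.
have := Hc x y y0 y2; rewrite kE.
have -> : dz_ratio (k *: dz a b) x y = k * dz_ratio (dz a b) x y.
  by rewrite /dz_ratio mulrCA.
by rewrite dzr // mulr1.
Qed.

End holomorphic_forms.

(** * Measurability in the plane and integrals on the line *)

Section plane_measure.
Variable R : realType.
Local Notation mu := (@lebesgue_measure R).

(** U is the union of the boxes with rational corners that it contains, a countable family. *)
Lemma open_box_measurable (U : set (R * R)) : open U -> measurable U.
Proof.
move=> oU.
pose B (q : (rat * rat) * (rat * rat)) : set (R * R) :=
  `]ratr q.1.1, ratr q.1.2[%classic `*` `]ratr q.2.1, ratr q.2.2[%classic.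
have -> : U = \bigcup_(q in [set q | B q `<=` U]) B q.
  apply/seteqP; split=> [[x y] Uxy|z [q Bq]]; last exact: Bq.
  have : nbhs (x, y) U by exact: open_nbhs_nbhs.
  case=> -[A1 A2] /= [/nbhs_ballP[d1 /= d10 H1] /nbhs_ballP[d2 /= d20 H2]] HU.
  have rat_in (a b : R) : a < b -> exists q : rat, a < ratr q < b.
    by move=> /rat_in_itvoo[q]; rewrite in_itv /=; exists q.
  have lo (t d : R) : 0 < d -> t - d < t by move=> d0; rewrite ltrBlDr ltrDl.
  have hi (t d : R) : 0 < d -> t < t + d by move=> d0; rewrite ltrDl.
  have [p1 /andP[p11 p12]] := rat_in _ _ (lo x _ d10).
  have [p2 /andP[p21 p22]] := rat_in _ _ (hi x _ d10).
  have [q1 /andP[q11 q12]] := rat_in _ _ (lo y _ d20).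
  have [q2 /andP[q21 q22]] := rat_in _ _ (hi y _ d20).
  exists ((p1, p2), (q1, q2)); last first.
    by split; rewrite /= in_itv /= ?p12 ?p21 ?q12 ?q21.
  move=> [u v] [/=]; rewrite !in_itv /= => /andP[u1 u2] /andP[v1 v2].
  apply: HU; split=> /=.
    apply: H1; rewrite /ball /= distrC ltr_norml; apply/andP; split; lra.
  apply: H2; rewrite /ball /= distrC ltr_norml; apply/andP; split; lra.
rewrite bigcup_mkcond; apply: countable_bigcupT_measurable; first exact: countableP.
by move=> q; case: ifP => _ //; apply: measurableX; exact: measurable_itv.
Qed.

Lemma continuous_measurable2 (f : R * R -> R) : continuous f -> measurable_fun setT f.
Proof.
move=> cf; apply: (measurability _ (RGenOpens.measurableE R)).
move=> /= _ [_ [a [b ->] <-]]; rewrite setTI; apply: open_box_measurable.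
by apply: open_comp; [move=> z _; exact: cf|exact: interval_open].
Qed.

Lemma measurable_inv : measurable_fun setT (fun x : R => x^-1).
Proof.
have -> : (fun x : R => x^-1) = (fun x => x * ((x ^+ 2) `^ (-1))).
  apply/funext => x; have [->|x0] := eqVneq x 0; first by rewrite invr0 mul0r.
  by rewrite powR_inv1 ?sqr_ge0 //; field.
apply: measurable_funM => //.
have h := @measurable_powR R (-1).
by apply: (measurableT_comp h); exact: measurable_funX.
Qed.

Lemma measurable_div d (T : measurableType d) (f g : T -> R) :
  measurable_fun setT f -> measurable_fun setT g -> measurable_fun setT (fun x => f x / g x).
Proof.
by move=> mf mg; apply: measurable_funM => //; exact: (measurableT_comp measurable_inv).
Qed.

Lemma FTC_itv (g g' : R -> R) (a b : R) : a < b -> (forall x : R, is_derive x 1 g (g' x)) ->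
  continuous g' -> (\int[mu]_(x in `[a, b]) (g' x)%:E = (g b - g a)%:E)%E.
Proof.
move=> ab dg cg'; have cg : continuous g.
  by move=> x; apply/differentiable_continuous/derivable1_diffP; case: (dg x).
rewrite (@continuous_FTC2 _ g' g) //.
- exact: continuous_subspaceT.
- split.
  + by move=> x _; case: (dg x).
  + exact: cvg_at_right_filter (cg a).
  + exact: cvg_at_left_filter (cg b).
- by move=> x _; rewrite derive1E; case: (dg x).
Qed.

Lemma integral_support (f : R -> R) (M : R) : (forall x, M < `|x| -> f x = 0) ->
  (\int[mu]_x (f x)%:E = \int[mu]_(x in `[(- M)%R, M]) (f x)%:E)%E.
Proof.
move=> f0; rewrite [RHS]integral_mkcond; apply: eq_integral => x _.
rewrite patchE; case: ifPn => //; rewrite notin_setE /= in_itv /= -ler_norml => /negP.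
by rewrite -ltNge => /f0 ->.
Qed.

Lemma integral_derive0 (g g' : R -> R) (M : R) : (forall x : R, is_derive x 1 g (g' x)) ->
  continuous g' -> (forall x, M <= `|x| -> g x = 0 /\ g' x = 0) ->
  (\int[mu]_x (g' x)%:E = 0)%E.
Proof.
move=> dg cg' supp; pose N := `|M| + 1.
have N0 : 0 < N by rewrite ltr_wpDl.
have MN : M <= N by rewrite (le_trans (ler_norm _)) // lerDl.
rewrite (@integral_support _ N); last first.
  by move=> x Nx; case: (supp x) => //; rewrite (le_trans MN) // ltW.
rewrite (FTC_itv (g := g)) //; last by rewrite ltrNl (lt_trans _ N0) // oppr_lt0.
have [-> _] : g N = 0 /\ g' N = 0 by apply: supp; rewrite ger0_norm // ltW.
have [-> _] : g (- N) = 0 /\ g' (- N) = 0 by apply: supp; rewrite normrN ger0_norm // ltW.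
by rewrite subrr.
Qed.

(** Each side of x0 contributes - g x0: the right side g N - g x0 with sign +, the left side g x0 -
    g (- N) with sign -. This jump is the source of the Dirac current. *)
Lemma integral_sg_derive (g g' : R -> R) (M x0 : R) : (forall x : R, is_derive x 1 g (g' x)) ->
  continuous g' -> (forall x, M <= `|x| -> g x = 0 /\ g' x = 0) ->
  (\int[mu]_x (Num.sg (x - x0) * g' x)%:E = (- 2 * g x0)%:E)%E.
Proof.
move=> dg cg' supp; pose N := `|M| + `|x0| + 1.
have N0 : 0 < N by rewrite ltr_wpDl.
have MN : M <= N by rewrite (le_trans (ler_norm _)) // /N -addrA lerDl addr_ge0.
have [x0N Nx0] : x0 < N /\ - N < x0.
  have := ler_norm x0; have := ler_norm (- x0); rewrite normrN /N.
  have := normr_ge0 M; move: `|M| `|x0| => u v; split; lra.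
have mg' (D : set R) : measurable D -> measurable_fun D (fun x : R => (g' x)%:E).
  move=> mD; apply/measurable_EFinP; apply: measurable_funS (continuous_measurable_fun cg') => //.
have msg (D : set R) : measurable D -> measurable_fun D (fun x : R => (Num.sg (x - x0) * g' x)%:E).
  move=> mD; apply/measurable_EFinP; apply: measurable_funM; last first.
    by apply: measurable_funS (continuous_measurable_fun cg').
  apply: (measurable_funS measurableT) => //.
  have -> : (fun x : R => Num.sg (x - x0)) = (fun x => (x - x0) / `|x - x0|).
    apply/funext => x; have [->|h] := eqVneq (x - x0) 0; first by rewrite sgr0 mul0r.
    by rewrite {2}[x - x0]numEsg mulfK // normr_eq0.
  apply: measurable_div; first by apply: measurable_funB => //.
  have h := @normr_measurable R setT.
  by apply: (measurableT_comp h); exact: measurable_funB.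
rewrite (@integral_support _ N); last first.
  by move=> x Nx; case: (supp x) => [|_ ->]; rewrite ?mulr0 // (le_trans MN) // ltW.
have -> : `[(- N)%R, N]%classic = `[(- N)%R, x0[%classic `|` `[x0, N]%classic :> set R.
  by rewrite -itv_bndbnd_setU // bnd_simp ltW.
rewrite integral_setU //=; first last.
- by apply/disj_setPS => x [/=]; rewrite !in_itv /= => /andP[_ xx] /andP[]; rewrite leNgt xx.
- by apply: msg; apply: measurableU; exact: measurable_itv.
have -> : (\int[mu]_(x in `[x0, N]) (Num.sg (x - x0) * g' x)%:E = (g N - g x0)%:E)%E.
  rewrite -integral_itv_obnd_cbnd; last exact: msg.
  rewrite -(FTC_itv (g := g) x0N dg cg') -[RHS]integral_itv_obnd_cbnd; last exact: mg'.
  apply: eq_integral => x; rewrite inE /= in_itv /= => /andP[xx _].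
  by rewrite gtr0_sg ?subr_gt0 // mul1r.
have -> : (\int[mu]_(x in `[(- N)%R, x0[) (Num.sg (x - x0) * g' x)%:E = (- (g x0 - g (- N)))%:E)%E.
  have dNg : forall x : R, is_derive x 1 (fun x => - g x) (- g' x).
    by move=> x; exact: (is_deriveN (dg x)).
  have cNg : continuous (fun x => - g' x) by move=> x; apply: cvgN; exact: cg'.
  transitivity (\int[mu]_(x in `[(- N)%R, x0[) (- g' x)%R%:E)%E.
    apply: eq_integral => x; rewrite inE /= in_itv /= => /andP[_ xx].
    by rewrite ltr0_sg ?subr_lt0 // mulN1r.
  rewrite integral_itv_bndo_bndc; last first.
    by apply/measurable_EFinP; apply: measurable_funS (continuous_measurable_fun cNg).
  by rewrite (FTC_itv Nx0 dNg cNg); congr EFin; ring.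
have [-> _] : g N = 0 /\ g' N = 0 by apply: supp; rewrite ger0_norm // ltW.
have [-> _] : g (- N) = 0 /\ g' (- N) = 0 by apply: supp; rewrite normrN ger0_norm // ltW.
by rewrite -EFinD; congr EFin; ring.
Qed.

End plane_measure.

(** * Slices of the kernel: primitives and bounds *)

Section kernel.
Variable R : realType.
Local Notation mu := (@lebesgue_measure R).

Lemma is_derive_lin (t0 c t : R) : is_derive t 1 (fun t => (t - t0) / c) c^-1.
Proof.
have h := is_deriveB (@is_derive_id _ _ t 1) (@is_derive_cst _ _ _ t0 t 1).
have k := is_derive_mul h (@is_derive_cst _ _ _ c^-1 t 1).
by apply: is_derive_eq; rewrite subr0 mul1r mulr0 addr0.
Qed.

Lemma sum_sq_neq0 (c s : R) : c != 0 -> c ^+ 2 + s ^+ 2 != 0.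
Proof.
by move=> c0; rewrite gt_eqF // ltr_pwDl ?sqr_ge0 // exprn_even_gt0.
Qed.

Lemma is_derive_atan_div (t0 c t : R) : c != 0 ->
  is_derive t 1 (fun t => atan ((t - t0) / c)) (c / (c ^+ 2 + (t - t0) ^+ 2)).
Proof.
move=> c0; have := @is_derive1_comp R atan (fun t => (t - t0) / c) t _ _ (is_derive1_atan _) (is_derive_lin t0 c t).
move=> h; apply: is_derive_eq; rewrite /GRing.scale /=.
have := sum_sq_neq0 (t - t0) c0; move: (t - t0) => s s0.
have h1 : 1 + (s / c) ^+ 2 != 0 by rewrite -[1](expr1n _ 2) sum_sq_neq0 // oner_neq0.
by field; rewrite c0 s0.
Qed.

Lemma is_derive_sum_sq (t0 c t : R) :
  is_derive t 1 (fun t => c ^+ 2 + (t - t0) ^+ 2) (2 * (t - t0)).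
Proof.
have h := is_deriveB (@is_derive_id _ _ t 1) (@is_derive_cst _ _ _ t0 t 1).
have k := is_deriveD (@is_derive_cst _ _ _ (c ^+ 2) t 1) (is_derive_mul h h).
have E : (fun t => c ^+ 2 + (t - t0) ^+ 2) = cst (c ^+ 2) + (fun w => (id - cst t0) w * (id - cst t0) w).
  by apply/funext => s; rewrite expr2.
rewrite E; apply: is_derive_eq; rewrite /= subr0 add0r mul1r mulr1 -mulr2n mulr_natl //.
Qed.

Lemma is_derive_ln_sum_sq (t0 c t : R) : c != 0 ->
  is_derive t 1 (fun t => ln (c ^+ 2 + (t - t0) ^+ 2) / 2) ((t - t0) / (c ^+ 2 + (t - t0) ^+ 2)).
Proof.
move=> c0; have q0 : 0 < c ^+ 2 + (t - t0) ^+ 2 by rewrite ltr_pwDl ?sqr_ge0 // exprn_even_gt0.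
have h := @is_derive1_comp R _ (fun t => c ^+ 2 + (t - t0) ^+ 2) t _ _ (is_derive1_ln q0) (is_derive_sum_sq t0 c t).
have k := is_derive_mul h (@is_derive_cst _ _ _ (2^-1 : R) t 1).
apply: is_derive_eq; rewrite /GRing.scale /= mulr0 addr0.
by field; rewrite gt_eqF.
Qed.

Lemma derivable_continuous (f f' : R -> R) :
  (forall t : R, is_derive t 1 f (f' t)) -> continuous f.
Proof. by move=> h t; apply/differentiable_continuous/derivable1_diffP; case: (h t). Qed.

Lemma continuous_kernel (t0 c : R) : c != 0 ->
  continuous (fun t : R => (c ^+ 2 + (t - t0) ^+ 2)^-1).
Proof.
move=> c0; apply: derivable_continuous => t; apply: is_derive_inv; exact: sum_sq_neq0.
Qed.

(** The primitive atan ((t - t0) / |c|) increases by at most pi, uniformly in c. *)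
Lemma integral_kernel_le (c t0 M : R) : 0 < M ->
  (\int[mu]_t (`|c| / (c ^+ 2 + (t - t0) ^+ 2) * \1_`[(- M)%R, M]%classic t)%:E <= pi%:E)%E.
Proof.
move=> M0; have [->|c0] := eqVneq c 0.
  rewrite integral0_eq; first by rewrite lee_fin pi_ge0.
  by move=> t _; rewrite normr0 !mul0r.
have n0 : `|c| != 0 by rewrite normr_eq0.
rewrite (@integral_support _ _ M); last first.
  move=> t Mt; rewrite indicE memNset ?mulr0 //= in_itv /= -ler_norml.
  by apply/negP; rewrite -ltNge.
have -> : (\int[mu]_(t in `[(- M)%R, M]) (`|c| / (c ^+ 2 + (t - t0) ^+ 2) * \1_`[(- M)%R, M]%classic t)%:E =
    \int[mu]_(t in `[(- M)%R, M]) (`|c| / (`|c| ^+ 2 + (t - t0) ^+ 2))%:E)%E.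
  apply: eq_integral => t tM;
   rewrite indicE tM mulr1 real_normK ?num_real //.
have MM : - M < M by rewrite ltrNl (lt_trans _ M0) // oppr_lt0.
have cK : continuous (fun t : R => `|c| / (`|c| ^+ 2 + (t - t0) ^+ 2)).
  by move=> t; apply: cvgM; [exact: cvg_cst|exact: continuous_kernel].
rewrite (FTC_itv MM (fun t => is_derive_atan_div t0 t n0) cK).
rewrite lee_fin; have := atan_ltpi2 ((M - t0) / `|c|).
have := atan_gtNpi2 ((- M - t0) / `|c|).
by move: (atan _) (atan _) => u v; have := pi_ge0 R; lra.
Qed.

End kernel.

(** * Absolute integrability of the kernel in the plane *)

Section kernel2.
Variable R : realType.
Local Notation mu := (@lebesgue_measure R).
Local Notation mu2 := (mu \x mu)%E.
Variables x0 y0 M : R.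
Hypothesis M0 : 0 < M.

Definition sq_dist (p : R * R) : R := (p.1 - x0) ^+ 2 + (p.2 - y0) ^+ 2.

Definition box : set (R * R) := `[(- M)%R, M]%classic `*` `[(- M)%R, M]%classic.

Lemma measurable_box : measurable box.
Proof. by apply: measurableX; exact: measurable_itv. Qed.

Lemma measurable_x : measurable_fun setT (fun p : R * R => p.1 - x0).
Proof. by apply: measurable_funB => //; exact: measurable_fst. Qed.

Lemma measurable_y : measurable_fun setT (fun p : R * R => p.2 - y0).
Proof. by apply: measurable_funB => //; exact: measurable_snd. Qed.

Lemma measurable_sq_dist : measurable_fun setT sq_dist.
Proof.
apply: measurable_funD; apply: measurable_funX; [exact: measurable_x|exact: measurable_y].
Qed.

(** The absolute values of the two coordinates of the kernel serve as majorants in place of 1/r,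
    since their slices have elementary integrals. *)
Definition kernel_x (p : R * R) := `|p.1 - x0| / sq_dist p * \1_box p.
Definition kernel_y (p : R * R) := `|p.2 - y0| / sq_dist p * \1_box p.

Lemma box_indic (x y : R) :
  \1_box (x, y) = \1_`[(- M)%R, M]%classic x * \1_`[(- M)%R, M]%classic y :> R.
Proof. by rewrite !indicE in_setX /= -natrM mulnb. Qed.

Lemma integral_indic_lt :
  (\int[mu]_x (pi * \1_`[(- M)%R, M]%classic x)%:E < +oo)%E.
Proof.
rewrite (@integral_support _ _ M); last first.
  move=> t Mt; rewrite indicE memNset ?mulr0 //= in_itv /= -ler_norml.
  by apply/negP; rewrite -ltNge.
have -> : (\int[mu]_(x in `[(- M)%R, M]) (pi * \1_`[(- M)%R, M]%classic x)%:E =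
    \int[mu]_(x in `[(- M)%R, M]) (cst pi%:E x))%E.
  by apply: eq_integral => x xM; rewrite indicE xM mulr1.
rewrite integral_cst //= lebesgue_measure_itv /=.
by case: ifP => _; rewrite ?mule0 // -EFinB -EFinM ltry.
Qed.

Lemma measurable_indic_pi : measurable_fun setT (fun x => (pi * \1_`[(- M)%R, M]%classic x)%:E : \bar R).
Proof.
by apply/measurable_EFinP; apply: measurable_funM => //; apply: measurable_indic; exact: measurable_itv.
Qed.

Lemma kernel_slice_le (c t0 s : R) :
  (\int[mu]_t (\1_`[(- M)%R, M]%classic s *
     (`|c| / (c ^+ 2 + (t - t0) ^+ 2) * \1_`[(- M)%R, M]%classic t))%:E <=
   (pi * \1_`[(- M)%R, M]%classic s)%:E)%E.
Proof.
rewrite !indicE; case: (s \in _).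
  by rewrite mulr1; under eq_integral do rewrite mul1r; exact: integral_kernel_le.
by rewrite mulr0; under eq_integral do rewrite mul0r; rewrite integral0.
Qed.

(** Tonelli's theorem, integrating over y at fixed x: every slice has integral at most pi, and the
    box bounds the range of x. [kernel_y] is integrated in the other order. *)
Lemma integrable_kernel_x : mu2.-integrable setT (fun p => (kernel_x p)%:E).
Proof.
have mk : measurable_fun setT kernel_x.
  apply: measurable_funM; last exact: measurable_indic measurable_box.
  apply: measurable_div; last exact: measurable_sq_dist.
  have h := @normr_measurable R setT; by apply: (measurableT_comp h); exact: measurable_x.
have mkE := (measurable_EFinP _ _).2 mk.
apply/integrable12ltyP => //; apply: le_lt_trans integral_indic_lt.
apply: ge0_le_integral => //.
- by move=> x _; exact: integral_ge0.
- apply: (@measurable_fun_fubini_tonelli_F _ _ _ _ _ mu (fun p => `|(kernel_x p)%:E|%E)) => //.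
  have h := @abse_measurable R setT; exact: (measurableT_comp h).
- exact: measurable_indic_pi.
- move=> x _; apply: le_trans (kernel_slice_le (x - x0) y0 x); rewrite le_eqVlt; apply/orP; left.
  apply/eqP/eq_integral => y _; rewrite /kernel_x box_indic /= ger0_norm; last first.
    by rewrite mulr_ge0 ?divr_ge0 ?mulr_ge0 // addr_ge0 ?sqr_ge0.
  by congr EFin; rewrite /sq_dist /=; ring.
Qed.

Lemma integrable_kernel_y : mu2.-integrable setT (fun p => (kernel_y p)%:E).
Proof.
have mk : measurable_fun setT kernel_y.
  apply: measurable_funM; last exact: measurable_indic measurable_box.
  apply: measurable_div; last exact: measurable_sq_dist.
  have h := @normr_measurable R setT; by apply: (measurableT_comp h); exact: measurable_y.
have mkE := (measurable_EFinP _ _).2 mk.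
apply/integrable21ltyP => //; apply: le_lt_trans integral_indic_lt.
apply: ge0_le_integral => //.
- by move=> x _; exact: integral_ge0.
- apply: (@measurable_fun_fubini_tonelli_G _ _ _ _ _ mu (fun p => `|(kernel_y p)%:E|%E)) => //.
  have h := @abse_measurable R setT; exact: (measurableT_comp h).
- exact: measurable_indic_pi.
- move=> y _; apply: le_trans (kernel_slice_le (y - y0) x0 y); rewrite le_eqVlt; apply/orP; left.
  apply/eqP/eq_integral => x _; rewrite /kernel_y box_indic /= ger0_norm; last first.
    by rewrite mulr_ge0 ?divr_ge0 ?mulr_ge0 // addr_ge0 ?sqr_ge0.
  by congr EFin; rewrite /sq_dist /= [(y - y0) ^+ 2 + _]addrC; ring.
Qed.

Lemma integrable_box : mu2.-integrable setT (fun p => (\1_box p)%:E).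
Proof.
have mb := measurable_box.
apply/integrableP; split; first by apply/measurable_EFinP; exact: measurable_indic.
have -> : (\int[mu2]_p `|(\1_box p)%:E| = \int[mu2]_p (\1_box p)%:E)%E.
  by apply: eq_integral => p _; rewrite gee0_abs // lee_fin indicE.
rewrite integral_indic // setIT.
apply: (@le_lt_trans _ _ (mu `[(- M)%R, M]%classic * mu `[(- M)%R, M]%classic)%E).
  by rewrite le_eqVlt; apply/orP; left; apply/eqP; apply: product_measure1E; exact: measurable_itv.
rewrite lebesgue_measure_itv /=; case: ifP => _; last by rewrite mule0.
by rewrite -EFinB -EFinM ltry.
Qed.

(* A measurable function supported in the box with a 1/r singularity at (x0, y0). *)
Definition tame (f : R * R -> R) :=
  measurable_fun setT f /\ exists K : R, forall p, `|f p| <= K * (\1_box p + kernel_x p + kernel_y p).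

Lemma tame_integrable f : tame f -> mu2.-integrable setT (fun p => (f p)%:E).
Proof.
move=> [mf [K fK]].
have h : mu2.-integrable setT (fun p => (K%:E * ((\1_box p)%:E + (kernel_x p)%:E + (kernel_y p)%:E))%E).
  apply: integrableZl => //; apply: integrableD => //; last exact: integrable_kernel_y.
  by apply: integrableD => //; [exact: integrable_box|exact: integrable_kernel_x].
have {}h : mu2.-integrable setT (fun p => (K * (\1_box p + kernel_x p + kernel_y p))%:E) := h.
apply: (le_integrable _ _ _ h) => //; first exact/measurable_EFinP.
by move=> p _; rewrite /= lee_fin (le_trans (fK p)) // ler_norm.
Qed.

Lemma box_ge0 p : 0 <= \1_box p :> R. Proof. by rewrite indicE. Qed.

Lemma kernel_x_ge0 p : 0 <= kernel_x p.
Proof. by rewrite mulr_ge0 ?box_ge0 // divr_ge0 // addr_ge0 // sqr_ge0. Qed.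

Lemma kernel_y_ge0 p : 0 <= kernel_y p.
Proof. by rewrite mulr_ge0 ?box_ge0 // divr_ge0 // addr_ge0 // sqr_ge0. Qed.

Lemma tameD f g : tame f -> tame g -> tame (fun p => f p + g p).
Proof.
move=> [mf [K1 f1]] [mg [K2 g2]]; split; first exact: measurable_funD.
by exists (K1 + K2) => p; rewrite (le_trans (ler_normD _ _)) // mulrDl lerD.
Qed.

Lemma tameZ (k : R) f : tame f -> tame (fun p => k * f p).
Proof.
move=> [mf [K1 f1]]; split; first exact: measurable_funM.
by exists (`|k| * K1) => p; rewrite normrM -mulrA ler_wpM2l.
Qed.

Lemma tameB f g : tame f -> tame g -> tame (fun p => f p - g p).
Proof.
move=> tf tg; have := tameD tf (tameZ (-1) tg).
by under eq_fun do rewrite mulN1r.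
Qed.

Definition plane_int (f : R * R -> R) : R := (\int[mu2]_p f p)%R.

Lemma plane_intD f g : tame f -> tame g ->
  plane_int (fun p => f p + g p) = plane_int f + plane_int g.
Proof. by move=> tf tg; apply: RintegralD => //; exact: tame_integrable. Qed.

Lemma plane_intB f g : tame f -> tame g ->
  plane_int (fun p => f p - g p) = plane_int f - plane_int g.
Proof. by move=> tf tg; apply: RintegralB => //; exact: tame_integrable. Qed.

Lemma ae_eq0 (F : R -> \bar R) (t0 : R) : measurable_fun setT F ->
  (forall t, t != t0 -> F t = 0%E) -> (\int[mu]_t F t = 0)%E.
Proof.
move=> mF F0; rewrite (@ae_eq_integral _ _ _ mu setT (cst 0%E)) //; first exact: integral0.
exists [set t0]; split => //; first exact: lebesgue_measure_set1.
move=> t /=; apply: contra_notP => /eqP tt _; exact: F0.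
Qed.

(** The excluded line y = y0, on which primitives will be singular, is a null set for the outer
    integral. *)
Lemma plane_int_y f : tame f -> (forall y, y != y0 -> (\int[mu]_x (f (x, y))%:E = 0)%E) ->
  plane_int f = 0.
Proof.
move=> tf h; have fi := tame_integrable tf.
rewrite /plane_int /Rintegral -(integral21_prod_meas1 fi) (ae_eq0 (t0 := y0)) //.
exact: (measurable_fubini_G fi).
Qed.

Lemma plane_int_x f : tame f -> (forall x, x != x0 -> (\int[mu]_y (f (x, y))%:E = 0)%E) ->
  plane_int f = 0.
Proof.
move=> tf h; have fi := tame_integrable tf.
rewrite /plane_int /Rintegral -(integral12_prod_meas1 fi) (ae_eq0 (t0 := x0)) //.
exact: (measurable_fubini_F fi).
Qed.

Lemma plane_int_iterated f (F : R -> R) : tame f ->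
  (forall y, (\int[mu]_x (f (x, y))%:E = (F y)%:E)%E) ->
  plane_int f = fine (\int[mu]_y (F y)%:E)%E.
Proof.
move=> tf h; have fi := tame_integrable tf.
rewrite /plane_int /Rintegral -(integral21_prod_meas1 fi); congr fine.
by apply: eq_integral => y _; rewrite -h.
Qed.

End kernel2.

(** * Complementary angles *)

Section atan_inverse.
Variable R : realType.

Lemma atanV_gt0 (c : R) : 0 < c -> atan c + atan c^-1 = pi / 2.
Proof.
move=> c0; have t0 : 0 < atan c by rewrite -(@atan0 R) lt_atan.
have t1 := atan_ltpi2 c.
suff -> : atan c^-1 = pi / 2 - atan c by rewrite addrC subrK.
rewrite -[RHS]tanK; last by rewrite in_itv /=; apply/andP; split; lra.
congr atan; rewrite -[c in LHS]atanK /tan sinB cosB sin_pihalf cos_pihalf.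
by rewrite !mul1r !mul0r subr0 add0r invf_div.
Qed.

(** The two angles are complementary up to sign. If u or v is 0, both sides are 0 because the
    inverse of 0 is 0. *)
Lemma atan_div_sg (u v : R) : atan (v / u) + atan (u / v) = pi / 2 * (Num.sg u * Num.sg v).
Proof.
have [->|u0] := eqVneq u 0; first by rewrite invr0 mulr0 mul0r atan0 addr0 sgr0 mul0r mulr0.
have [->|v0] := eqVneq v 0; first by rewrite invr0 mulr0 mul0r atan0 addr0 sgr0 !mulr0.
have -> : u / v = (v / u)^-1 by rewrite invf_div.
have [w0|w0|w0] := ltrgtP (v / u) 0.
- have n0 : 0 < - (v / u) by rewrite oppr_gt0.
  have := atanV_gt0 n0; rewrite invrN !atanN -opprD => /(congr1 -%R); rewrite opprK => ->.
  have : Num.sg (v / u) = -1 by rewrite ltr0_sg.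
  by rewrite sgrM sgrV mulrC => ->; rewrite mulrN1.
- rewrite atanV_gt0 //.
  have : Num.sg (v / u) = 1 by rewrite gtr0_sg.
  by rewrite sgrM sgrV mulrC => ->; rewrite mulr1.
- by move/eqP: w0; rewrite mulf_eq0 invr_eq0 (negbTE u0) (negbTE v0).
Qed.

Lemma atan_bound (t : R) : `|atan t| <= pi / 2.
Proof. by rewrite ler_norml (ltW (atan_gtNpi2 t)) (ltW (atan_ltpi2 t)). Qed.

End atan_inverse.

(** * Integration by parts against the kernel *)

Section green.
Variable R : realType.
Local Notation mu := (@lebesgue_measure R).
Variables x0 y0 M : R.
Hypothesis M0 : 0 < M.
Variables P Px Py Pxy : R * R -> R.
Hypothesis dPx : forall x y : R, is_derive x 1 (fun t : R => P (t, y)) (Px (x, y)).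
Hypothesis dPy : forall x y : R, is_derive y 1 (fun t : R => P (x, t)) (Py (x, y)).
Hypothesis dPxy : forall x y : R, is_derive y 1 (fun t : R => Px (x, t)) (Pxy (x, y)).
Hypothesis dPyx : forall x y : R, is_derive x 1 (fun t : R => Py (t, y)) (Pxy (x, y)).
Hypothesis cPx : continuous Px.
Hypothesis cPy : continuous Py.
Hypothesis cPxy : continuous Pxy.
Hypothesis supp : forall p : R * R, M <= `|p.1| \/ M <= `|p.2| ->
  [/\ P p = 0, Px p = 0, Py p = 0 & Pxy p = 0].

Local Notation sq_dist := (sq_dist x0 y0).
Local Notation tame := (tame x0 y0 M).
Local Notation box := (box M).

Lemma outside_box f : (forall p : R * R, M <= `|p.1| \/ M <= `|p.2| -> f p = 0) ->
  forall p : R * R, f p = f p * \1_box p :> R.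
Proof.
move=> f0 p; rewrite indicE; have [_|pB] := boolP (p \in box); first by rewrite mulr1.
rewrite mulr0; apply: f0; move: pB; rewrite notin_setE => pB.
have [h1|h1] := leP M `|p.1|; first by left.
have [h2|h2] := leP M `|p.2|; first by right.
by exfalso; apply: pB; split; rewrite /= in_itv /= -ler_norml ltW.
Qed.

Lemma compact_support_bounded (f : R * R -> R) : continuous f ->
  (forall p : R * R, M <= `|p.1| \/ M <= `|p.2| -> f p = 0) ->
  exists2 K : R, 0 <= K & forall p, `|f p| <= K.
Proof.
move=> cf f0; have cB : compact box by apply: compact_setX; exact: segment_compact.
have B0 : box !=set0 by exists (0, 0); split; rewrite /= in_itv /= oppr_le0 ltW.
have cn : continuous (fun p => `|f p|) by move=> p; apply: cvg_norm; exact: cf.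
have [c _ cmax] := compact_EVT_max B0 cB (continuous_subspaceT cn).
exists `|f c| => // p; have [pB|pB] := boolP (p \in box); first exact: cmax.
by rewrite outside_box // indicE (negbTE pB) mulr0 normr0.
Qed.

Lemma tame_kernel_x f : continuous f ->
  (forall p : R * R, M <= `|p.1| \/ M <= `|p.2| -> f p = 0) ->
  tame (fun p => (p.1 - x0) / sq_dist p * f p).
Proof.
move=> cf f0; have [K K0 fK] := compact_support_bounded cf f0; split.
  apply: measurable_funM; last exact: continuous_measurable2.
  by apply: measurable_div; [exact: measurable_x|exact: measurable_sq_dist].
exists K => p; rewrite (outside_box f0) normrM [X in _ * X]normrM !mulrA.
rewrite (le_trans (_ : _ <= K * kernel_x x0 y0 M p)) //; last first.
  by rewrite ler_wpM2l // [_ + kernel_x _ _ _ _]addrC -addrA lerDl addr_ge0 ?box_ge0 ?kernel_y_ge0.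
rewrite [`|\1_box p|]ger0_norm ?box_ge0 // /kernel_x mulrA ler_wpM2r ?box_ge0 //.
rewrite normrM normfV [`|sq_dist p|]ger0_norm ?addr_ge0 ?sqr_ge0 // mulrC ler_wpM2r //.
by rewrite divr_ge0 // addr_ge0 ?sqr_ge0.
Qed.

Lemma tame_kernel_y f : continuous f ->
  (forall p : R * R, M <= `|p.1| \/ M <= `|p.2| -> f p = 0) ->
  tame (fun p => (p.2 - y0) / sq_dist p * f p).
Proof.
move=> cf f0; have [K K0 fK] := compact_support_bounded cf f0; split.
  apply: measurable_funM; last exact: continuous_measurable2.
  by apply: measurable_div; [exact: measurable_y|exact: measurable_sq_dist].
exists K => p; rewrite (outside_box f0) normrM [X in _ * X]normrM !mulrA.
rewrite (le_trans (_ : _ <= K * kernel_y x0 y0 M p)) //; last first.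
  by rewrite ler_wpM2l // lerDr addr_ge0 ?box_ge0 ?kernel_x_ge0.
rewrite [`|\1_box p|]ger0_norm ?box_ge0 // /kernel_y mulrA ler_wpM2r ?box_ge0 //.
rewrite normrM normfV [`|sq_dist p|]ger0_norm ?addr_ge0 ?sqr_ge0 // mulrC ler_wpM2r //.
by rewrite divr_ge0 // addr_ge0 ?sqr_ge0.
Qed.

Lemma tame_bounded (b f : R * R -> R) (B : R) : measurable_fun setT b ->
  (forall p, box p -> `|b p| * \1_box p <= B * (\1_box p + kernel_x x0 y0 M p + kernel_y x0 y0 M p)) ->
  continuous f -> (forall p : R * R, M <= `|p.1| \/ M <= `|p.2| -> f p = 0) ->
  tame (fun p => b p * f p).
Proof.
move=> mb bB cf f0; have [K K0 fK] := compact_support_bounded cf f0; split.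
  by apply: measurable_funM => //; exact: continuous_measurable2.
exists (K * B) => p; rewrite normrM (outside_box f0).
have [pB|pB] := boolP (p \in box); last first.
  by rewrite indicE (negbTE pB) mulr0 normr0 mulr0 /kernel_x /kernel_y indicE (negbTE pB) !mulr0 !addr0 mulr0.
rewrite normrM [`|\1_box p|]ger0_norm ?box_ge0 // mulrCA mulrC -mulrA.
rewrite [leLHS]mulrC ler_pM ?mulr_ge0 ?box_ge0 //; apply: bB; exact: set_mem.
Qed.

(* The kernel (p - p0) / |p - p0|^2 is the gradient of log_dist; its rotation is the
   gradient of the angle, for which angle_yx and - angle_xy are two local branches,
   smooth off the vertical resp. horizontal line through p0 = (x0, y0). *)
Definition angle_yx (p : R * R) : R := atan ((p.2 - y0) / (p.1 - x0)).
Definition angle_xy (p : R * R) : R := atan ((p.1 - x0) / (p.2 - y0)).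
Definition log_dist (p : R * R) : R := ln (sq_dist p) / 2.

Lemma measurable_atan d (T : measurableType d) (f : T -> R) :
  measurable_fun setT f -> measurable_fun setT (fun x => atan (f x)).
Proof.
move=> mf; have h : measurable_fun setT (@atan R).
  by apply: continuous_measurable_fun; exact: continuous_atan.
exact: (measurableT_comp h).
Qed.

Lemma tame_angle (b f : R * R -> R) : measurable_fun setT b -> (forall p, `|b p| <= pi / 2) ->
  continuous f -> (forall p : R * R, M <= `|p.1| \/ M <= `|p.2| -> f p = 0) ->
  tame (fun p => b p * f p).
Proof.
move=> mb bB cf f0; apply: (tame_bounded (B := pi / 2)) => // p _.
have pi0 : 0 <= pi / 2 :> R by rewrite divr_ge0 // pi_ge0.
rewrite (le_trans (ler_wpM2r (box_ge0 M p) (bB p))) // ler_wpM2l // -addrA lerDl.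
by rewrite addr_ge0 ?kernel_x_ge0 ?kernel_y_ge0.
Qed.

(** From above, ln q <= q is bounded by the size of the box. From below, m = |x - x0| + |y - y0|
    satisfies q <= m^2, hence - (ln q) / 2 <= ln (m / q) <= m / q. So the two kernels dominate the
    logarithmic singularity. *)
Lemma log_dist_bound p : box p -> `|log_dist p| <=
  (M + `|x0|) ^+ 2 + (M + `|y0|) ^+ 2 + `|p.1 - x0| / sq_dist p + `|p.2 - y0| / sq_dist p.
Proof.
move=> [/=]; rewrite !in_itv /= -!ler_norml => p1 p2.
set A := (M + `|x0|) ^+ 2 + (M + `|y0|) ^+ 2; pose q := sq_dist p; rewrite -/q /log_dist -/q.
have A0 : 0 <= A by rewrite addr_ge0 ?sqr_ge0.
have q0 : 0 <= q by rewrite addr_ge0 ?sqr_ge0.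
have qA : q <= A.
  have h (u v m : R) : `|u| <= m -> (u - v) ^+ 2 <= (m + `|v|) ^+ 2.
    move=> um; rewrite -[(u - v) ^+ 2]real_normK ?num_real // ler_sqr ?nnegrE ?addr_ge0 //.
      by rewrite (le_trans (ler_normB _ _)) // lerD2r.
    exact: le_trans um.
  by rewrite lerD // h.
have [q00|qn0] := eqVneq q 0.
  by rewrite q00 ln0 // mul0r normr0 invr0 !mulr0 !addr0.
have qp : 0 < q by rewrite lt_def qn0.
pose m := `|p.1 - x0| + `|p.2 - y0|.
have m2 : q <= m ^+ 2.
  have -> : q = `|p.1 - x0| ^+ 2 + `|p.2 - y0| ^+ 2 by rewrite !real_normK ?num_real.
  by rewrite /m sqrrD lerD2r lerDl mulrn_wge0 // mulr_ge0.
have m0 : 0 < m.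
  rewrite lt_def addr_ge0 // andbT; apply: contraNneq qn0 => m0.
  by rewrite eq_le q0 andbT (le_trans m2) // m0 expr0n.
rewrite -addrA -mulrDl -/m ler_norml; apply/andP; split; last first.
  rewrite ler_wpDr //; first by rewrite divr_ge0 // ltW.
  rewrite ler_pdivrMr // (le_trans (ltW (ln_sublinear qp))) // (le_trans qA) //.
  by rewrite ler_peMr // ler1n.
rewrite lerNl ler_wpDl //.
have := ln_sublinear (divr_gt0 m0 qp); rewrite ln_div ?posrE //.
have : ln q <= ln (m ^+ 2) by rewrite ler_ln ?posrE // exprn_gt0.
rewrite lnXn // mulr2n; move: (ln q) (ln m) (m / q) => u v w; lra.
Qed.

Lemma tame_log f : continuous f -> (forall p : R * R, M <= `|p.1| \/ M <= `|p.2| -> f p = 0) ->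
  tame (fun p => log_dist p * f p).
Proof.
move=> cf f0; pose A := (M + `|x0|) ^+ 2 + (M + `|y0|) ^+ 2.
have A0 : 0 <= A by rewrite addr_ge0 ?sqr_ge0.
apply: (tame_bounded (B := A + 1)) => //.
  apply: measurable_funM => //; have h := @measurable_ln R.
  by apply: (measurableT_comp h); exact: measurable_sq_dist.
move=> p pB; apply: le_trans (ler_wpM2r (box_ge0 M p) (log_dist_bound pB)) _.
rewrite -/A (_ : _ * \1_box p = A * \1_box p + kernel_x x0 y0 M p + kernel_y x0 y0 M p); last first.
  by rewrite /kernel_x /kernel_y; ring.
rewrite [(A + 1) * _]mulrDl mul1r.
have := box_ge0 M p; have := kernel_x_ge0 x0 y0 M p; have := kernel_y_ge0 x0 y0 M p.
move: (\1_box p) (kernel_x _ _ _ _) (kernel_y _ _ _ _) => u v w w0 v0 u0.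
rewrite !mulrDr; have : 0 <= A * v by rewrite mulr_ge0.
have : 0 <= A * w by rewrite mulr_ge0.
lra.
Qed.

Lemma slice_continuous_x (f : R * R -> R) (y : R) : continuous f -> continuous (fun x : R => f (x, y)).
Proof.
move=> cf x; apply: (@continuous_comp _ _ _ (fun x : R => (x, y)) f); last exact: cf.
move=> A [[A1 A2] /= [h1 h2] hA].
by apply: filterS h1 => t t1; apply: hA; split=> //=; exact: nbhs_singleton h2.
Qed.

Lemma slice_continuous_y (f : R * R -> R) (x : R) : continuous f -> continuous (fun y : R => f (x, y)).
Proof.
move=> cf y; apply: (@continuous_comp _ _ _ (fun y : R => (x, y)) f); last exact: cf.
move=> A [[A1 A2] /= [h1 h2] hA].
by apply: filterS h2 => t t2; apply: hA; split=> //=; exact: nbhs_singleton h1.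
Qed.

Lemma suppPx p : M <= `|p.1| \/ M <= `|p.2| -> Px p = 0. Proof. by case/supp. Qed.
Lemma suppPy p : M <= `|p.1| \/ M <= `|p.2| -> Py p = 0. Proof. by case/supp. Qed.
Lemma suppPxy p : M <= `|p.1| \/ M <= `|p.2| -> Pxy p = 0. Proof. by case/supp. Qed.

(* The x-derivative of b Py integrates to 0 along every line y <> y0; b may be
   singular on the remaining, negligible line. *)
Lemma plane_int_derive_x (b b' : R * R -> R) :
  (forall x y : R, y != y0 -> is_derive x 1 (fun t : R => b (t, y)) (b' (x, y))) ->
  (forall y : R, y != y0 -> continuous (fun x : R => b' (x, y))) ->
  tame (fun p => b' p * Py p) -> tame (fun p => b p * Pxy p) ->
  plane_int (fun p => b' p * Py p) = - plane_int (fun p => b p * Pxy p).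
Proof.
move=> db cb' t1 t2; apply/eqP; rewrite -subr_eq0 opprK -(plane_intD M0 t1 t2); apply/eqP.
apply: (plane_int_y M0 (tameD t1 t2)) => y yy.
apply: (@integral_derive0 _ (fun x => b (x, y) * Py (x, y)) _ M) => [x|x|x xM].
- exact: is_derive_mul (db x y yy) (dPyx x y).
- apply: cvgD; apply: cvgM.
  + exact: cb'.
  + exact: slice_continuous_x.
  + by apply: (derivable_continuous (fun x => db x y yy)).
  + exact: slice_continuous_x.
- by rewrite suppPy ?suppPxy ?mulr0 ?addr0 //=; left.
Qed.

Lemma plane_int_derive_y (b b' : R * R -> R) :
  (forall x y : R, x != x0 -> is_derive y 1 (fun t : R => b (x, t)) (b' (x, y))) ->
  (forall x : R, x != x0 -> continuous (fun y : R => b' (x, y))) ->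
  tame (fun p => b' p * Px p) -> tame (fun p => b p * Pxy p) ->
  plane_int (fun p => b' p * Px p) = - plane_int (fun p => b p * Pxy p).
Proof.
move=> db cb' t1 t2; apply/eqP; rewrite -subr_eq0 opprK -(plane_intD M0 t1 t2); apply/eqP.
apply: (plane_int_x M0 (tameD t1 t2)) => x xx.
apply: (@integral_derive0 _ (fun y => b (x, y) * Px (x, y)) _ M) => [y|y|y yM].
- exact: is_derive_mul (db x y xx) (dPxy x y).
- apply: cvgD; apply: cvgM.
  + exact: cb'.
  + exact: slice_continuous_y.
  + by apply: (derivable_continuous (fun y => db x y xx)).
  + exact: slice_continuous_y.
- by rewrite suppPx ?suppPxy ?mulr0 ?addr0 //=; right.
Qed.

Lemma continuous_shift (t0 : R) : continuous (fun t : R => t - t0).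
Proof. by move=> t; apply: cvgB; [exact: cvg_id|exact: cvg_cst]. Qed.

Lemma inv_sq_dist_x y : y != y0 -> continuous (fun x : R => (sq_dist (x, y))^-1).
Proof.
move=> yy; have c0 : y - y0 != 0 by rewrite subr_eq0.
rewrite (_ : (fun x : R => _) = (fun x : R => ((y - y0) ^+ 2 + (x - x0) ^+ 2)^-1)).
  exact: continuous_kernel.
by apply/funext => x; rewrite /sq_dist /= addrC.
Qed.

Lemma inv_sq_dist_y x : x != x0 -> continuous (fun y : R => (sq_dist (x, y))^-1).
Proof.
by move=> xx; have c0 : x - x0 != 0 by [rewrite subr_eq0]; exact: (@continuous_kernel _ y0 _ c0).
Qed.

(** Both sides equal minus the integral of [log_dist] times [Pxy], by parts in x on the left and in
    y on the right. The logarithm is single-valued, so no jump appears. *)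
Lemma plane_int_curl :
  plane_int (fun p => (p.1 - x0) / sq_dist p * Py p) =
  plane_int (fun p => (p.2 - y0) / sq_dist p * Px p).
Proof.
have tl := tame_log cPxy suppPxy.
have -> : plane_int (fun p => (p.1 - x0) / sq_dist p * Py p) = - plane_int (fun p => log_dist p * Pxy p).
  apply: (@plane_int_derive_x log_dist) => //.
  - move=> x y yy; have c0 : y - y0 != 0 by rewrite subr_eq0.
    have := @is_derive_ln_sum_sq _ x0 _ x c0; rewrite /log_dist /sq_dist /= [(x - x0) ^+ 2 + _]addrC.
    by congr is_derive; apply/funext => t; rewrite addrC.
  - by move=> y yy x; apply: cvgM; [exact: continuous_shift|exact: inv_sq_dist_x].
  - exact: tame_kernel_x cPy suppPy.
have -> // : plane_int (fun p => (p.2 - y0) / sq_dist p * Px p) = - plane_int (fun p => log_dist p * Pxy p).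
apply: (@plane_int_derive_y log_dist) => //.
- move=> x y xx; have c0 : x - x0 != 0 by rewrite subr_eq0.
  exact: (@is_derive_ln_sum_sq _ y0 _ y c0).
- by move=> x xx y; apply: cvgM; [exact: continuous_shift|exact: inv_sq_dist_y].
- exact: tame_kernel_y cPx suppPx.
Qed.

Lemma is_derive_cmul (f : R -> R) (k t d : R) : is_derive t 1 f d ->
  is_derive t 1 (fun s => k * f s) (k * d).
Proof.
move=> h; have := is_derive_mul (@is_derive_cst _ _ _ k t 1) h.
by rewrite mul0r add0r.
Qed.

Lemma continuous_cmul (f : R -> R) (k : R) : continuous f -> continuous (fun s => k * f s).
Proof. by move=> cf t; apply: cvgM; [exact: cvg_cst|exact: cf]. Qed.

(** By parts, with one branch of the angle for each term, the sum becomes minus the integral of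
    [angle_yx + angle_xy] times [Pxy]. This sum of branches is pi/2 times two signs, and each sign
    contributes a factor - 2 by [integral_sg_derive]. *)
Lemma plane_int_div :
  plane_int (fun p => (p.1 - x0) / sq_dist p * Px p) +
  plane_int (fun p => (p.2 - y0) / sq_dist p * Py p) = - (2 * pi * P (x0, y0)).
Proof.
have t1 : tame (fun p => angle_yx p * Pxy p).
  apply: (tame_angle _ _ cPxy suppPxy) => [|p]; last exact: atan_bound.
  by apply: measurable_atan; apply: measurable_div; [exact: measurable_y|exact: measurable_x].
have t2 : tame (fun p => angle_xy p * Pxy p).
  apply: (tame_angle _ _ cPxy suppPxy) => [|p]; last exact: atan_bound.
  by apply: measurable_atan; apply: measurable_div; [exact: measurable_x|exact: measurable_y].
have -> : plane_int (fun p => (p.1 - x0) / sq_dist p * Px p) = - plane_int (fun p => angle_yx p * Pxy p).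
  apply: (@plane_int_derive_y angle_yx) => //.
  - move=> x y xx; have c0 : x - x0 != 0 by rewrite subr_eq0.
    exact: (@is_derive_atan_div _ y0 _ y c0).
  - by move=> x xx; exact: (continuous_cmul (k := x - x0) (inv_sq_dist_y xx)).
  - exact: tame_kernel_x cPx suppPx.
have -> : plane_int (fun p => (p.2 - y0) / sq_dist p * Py p) = - plane_int (fun p => angle_xy p * Pxy p).
  apply: (@plane_int_derive_x angle_xy) => //.
  - move=> x y yy; have c0 : y - y0 != 0 by rewrite subr_eq0.
    by have := @is_derive_atan_div _ x0 _ x c0; rewrite /angle_xy /sq_dist /= [(x - x0) ^+ 2 + _]addrC.
  - by move=> y yy; exact: (continuous_cmul (k := y - y0) (inv_sq_dist_x yy)).
  - exact: tame_kernel_y cPy suppPy.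
rewrite -opprD -(plane_intD M0 t1 t2); congr (- _).
have E : (fun p => angle_yx p * Pxy p + angle_xy p * Pxy p) =
    (fun p => Num.sg (p.1 - x0) * (pi / 2 * Num.sg (p.2 - y0) * Pxy p)).
  by apply/funext => p; rewrite -mulrDl atan_div_sg; ring.
have t3 := tameD t1 t2; rewrite E in t3; rewrite E.
(* The integral over x turns pi/2 into - 2 (pi/2) = - pi. *)
rewrite (plane_int_iterated M0 t3 (F := fun y => Num.sg (y - y0) * (- pi * Py (x0, y)))).
  have d1 (y : R) : is_derive y 1 (fun y => - pi * P (x0, y)) (- pi * Py (x0, y)).
    exact: is_derive_cmul.
  have c1 : continuous (fun y => - pi * Py (x0, y)).
    exact: (@continuous_cmul (fun y => Py (x0, y)) (- pi) (@slice_continuous_y Py x0 cPy)).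
  have s1 (y : R) : M <= `|y| -> - pi * P (x0, y) = 0 /\ - pi * Py (x0, y) = 0.
    by move=> yM; have [-> _ -> _] := supp (p := (x0, y)) (or_intror yM); rewrite mulr0.
  by rewrite (integral_sg_derive y0 d1 c1 s1) /=; ring.
move=> y; pose k := pi / 2 * Num.sg (y - y0).
have d1 (x : R) : is_derive x 1 (fun x => k * Py (x, y)) (k * Pxy (x, y)).
  exact: is_derive_cmul.
have c1 : continuous (fun x => k * Pxy (x, y)).
  exact: (@continuous_cmul (fun x => Pxy (x, y)) k (@slice_continuous_x Pxy y cPxy)).
have s1 (x : R) : M <= `|x| -> k * Py (x, y) = 0 /\ k * Pxy (x, y) = 0.
  by move=> xM; rewrite suppPy ?suppPxy ?mulr0 //=; left.
by rewrite (integral_sg_derive x0 d1 c1 s1) /k; congr EFin; field.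
Qed.

Lemma tame_terms :
  [/\ tame (fun p => (p.1 - x0) / sq_dist p * Px p), tame (fun p => (p.2 - y0) / sq_dist p * Px p),
      tame (fun p => (p.1 - x0) / sq_dist p * Py p) & tame (fun p => (p.2 - y0) / sq_dist p * Py p)].
Proof.
by split; [exact: tame_kernel_x cPx suppPx|exact: tame_kernel_y cPx suppPx|
  exact: tame_kernel_x cPy suppPy|exact: tame_kernel_y cPy suppPy].
Qed.

End green.

(** * Symmetry of mixed second derivatives *)

Section schwarz.
Variable R : realType.
Variables P Px Py Pxy Pyx : R * R -> R.
Hypothesis dPx : forall x y : R, is_derive x 1 (fun t : R => P (t, y)) (Px (x, y)).
Hypothesis dPy : forall x y : R, is_derive y 1 (fun t : R => P (x, t)) (Py (x, y)).
Hypothesis dPxy : forall x y : R, is_derive y 1 (fun t : R => Px (x, t)) (Pxy (x, y)).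
Hypothesis dPyx : forall x y : R, is_derive x 1 (fun t : R => Py (t, y)) (Pyx (x, y)).
Hypothesis cPxy : continuous Pxy.
Hypothesis cPyx : continuous Pyx.

Lemma mean_value (f f' : R -> R) (a h : R) : 0 < h -> (forall t : R, is_derive t 1 f (f' t)) ->
  exists2 c, a < c < a + h & f (a + h) - f a = f' c * h.
Proof.
move=> h0 df; have ah : a < a + h by rewrite ltrDl.
have [|c] := MVT ah (fun t _ => df t); first exact: continuous_subspaceT (derivable_continuous df).
by rewrite in_itv /= => cah ->; exists c => //; congr (_ * _); ring.
Qed.

Lemma continuous_near (f : R * R -> R) (x y e : R) : continuous f -> 0 < e ->
  exists2 d, 0 < d & forall u v : R, `|u - x| < d -> `|v - y| < d -> `|f (u, v) - f (x, y)| < e.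
Proof.
move=> cf e0; have /cvgrPdist_lt /(_ e e0) := cf (x, y).
case=> -[A1 A2] /= [/nbhs_ballP[d1 /= d10 H1] /nbhs_ballP[d2 /= d20 H2]] HA.
exists (Num.min d1 d2) => [|u v]; first by rewrite lt_min d10.
rewrite !lt_min => /andP[u1 _] /andP[_ v2]; rewrite distrC; apply: (HA (u, v)); split=> /=.
  by apply: H1; rewrite /ball /= distrC.
by apply: H2; rewrite /ball /= distrC.
Qed.

(** [smooth] provides the mixed derivatives in both orders, while the formulas above use one
    function for both. The second difference of P over a square of side h is h^2 times [Pxy] at one
    point and h^2 times [Pyx] at another, both close to p. *)
Lemma schwarz p : Pxy p = Pyx p.
Proof.
case: p => x y; apply/eqP; rewrite -subr_eq0 -normr_le0; apply/ler_addgt0Pl => e e0; rewrite addr0.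
have e20 : 0 < e / 2 by rewrite divr_gt0.
have [d1 d10 H1] := continuous_near x y cPxy e20.
have [d2 d20 H2] := continuous_near x y cPyx e20.
pose m := Num.min d1 d2; have m0 : 0 < m by rewrite lt_min d10.
pose h := m / 2; have h0 : 0 < h by rewrite divr_gt0.
have hm : h < m by rewrite ltr_pdivrMr // ltr_pMr // ltr1n.
have near t a : a < t < a + h -> `|t - a| < d1 /\ `|t - a| < d2.
  move=> /andP[t1 t2]; have : `|t - a| < m.
    by rewrite ger0_norm ?subr_ge0 ?(ltW t1) // (lt_trans _ hm) // ltrBlDl.
  by rewrite lt_min => /andP[].
have [c1 c1x E1] := @mean_value (fun t => P (t, y + h) - P (t, y)) (fun t => Px (t, y + h) - Px (t, y)) x h h0
  (fun t => is_deriveB (dPx t (y + h)) (dPx t y)).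
have [c2 c2y E2] := @mean_value (fun t => Px (c1, t)) (fun t => Pxy (c1, t)) y h h0 (dPxy c1).
have [k2 k2y F1] := @mean_value (fun t => P (x + h, t) - P (x, t)) (fun t => Py (x + h, t) - Py (x, t)) y h h0
  (fun t => is_deriveB (dPy (x + h) t) (dPy x t)).
have [k1 k1x F2] := @mean_value (fun t => Py (t, k2)) (fun t => Pyx (t, k2)) x h h0 (fun t => dPyx t k2).
have E : Pxy (c1, c2) = Pyx (k1, k2).
  have hn0 : h != 0 by rewrite gt_eqF.
  apply: (mulIf hn0); apply: (mulIf hn0).
  rewrite -E2 -F2 -E1 -F1; ring.
have [c11 _] := near _ _ c1x; have [c21 _] := near _ _ c2y.
have [_ k12] := near _ _ k1x; have [_ k22] := near _ _ k2y.
have K1 := H1 c1 c2 c11 c21; have K2 := H2 k1 k2 k12 k22.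
rewrite -(subrK (Pxy (c1, c2)) (Pxy (x, y))) -addrA (le_trans (ler_normD _ _)) //.
by rewrite -E in K2; rewrite [X in X + _]distrC [leRHS](splitr e) lerD // ltW.
Qed.

End schwarz.

(** * The Cauchy-Pompeiu formula *)

Section cauchy_pompeiu.
Variable R : realType.
Local Notation C := (Cplx R).
Local Notation mu := (@lebesgue_measure R).
Local Notation mu2 := (mu \x mu)%E.
Implicit Types (F G : C -> C) (z : C).

Definition vanishes_beyond (r : R) F := forall z, r < nm z -> F z = 0.

Lemma derive1_locally0 (f : R -> R) (d : R) : 0 < d -> (forall t : R, `|t| < d -> f t = 0) ->
  derive1 f 0 = 0.
Proof.
move=> d0 f0; rewrite derive1E; apply: (@derive_val _ _ _ _ _ _ _).
apply/is_deriveP_eps => e e0; exists d => // h hd.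
have d00 : `|0 : R| < d by rewrite normr0.
by rewrite add0r (f0 h hd) (f0 0 d00) mul0r !subr0 normr0 mulr_ge0 // ltW.
Qed.

Lemma beyond_line (r : R) F z (w : R -> C) : vanishes_beyond r F -> r < nm z ->
  (forall t : R, nm (w t) = `|t|) ->
  exists2 d : R, 0 < d & forall t : R, `|t| < d -> F (z + w t) = 0.
Proof.
move=> F0 rz wt; exists (nm z - r); first by rewrite subr_gt0.
move=> t td; apply: F0.
have := nm_triangle z (z + w t); rewrite addrAC subrr add0r wt ler_norml => /andP[+ _].
move: td; move: (nm z) (nm _) `|t| => a b c; lra.
Qed.

Lemma nm_real_line (t : R) : nm (Complex t 0 : C) = `|t|. Proof. exact: nmR. Qed.
Lemma nm_imag_line (t : R) : nm (Complex 0 t : C) = `|t|.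
Proof. by rewrite /nm /= expr0n /= add0r sqrtr_sqr. Qed.

Lemma beyond_dx r F : vanishes_beyond r F -> vanishes_beyond r (@dx R F).
Proof.
move=> F0 z rz; have [d d0 H] := beyond_line F0 rz nm_real_line.
by rewrite /dx !(derive1_locally0 d0) // => t td; rewrite H.
Qed.

Lemma beyond_dy r F : vanishes_beyond r F -> vanishes_beyond r (@dy R F).
Proof.
move=> F0 z rz; have [d d0 H] := beyond_line F0 rz nm_imag_line.
by rewrite /dy !(derive1_locally0 d0) // => t td; rewrite H.
Qed.

(** The integral formulas above are real; this predicate lets one argument treat the real and the
    imaginary part. *)
Definition is_part (pr : C -> R) := pr = @re R \/ pr = @im R.

Lemma part_continuous pr G : is_part pr -> continuous G ->
  continuous (fun p : R * R => pr (G (Complex p.1 p.2))).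
Proof.
move=> hpr cG p; apply: (@continuous_comp _ _ _ (fun p : R * R => G (Complex p.1 p.2)) pr).
  by apply: (@continuous_comp _ _ _ (fun p : R * R => Complex p.1 p.2 : C) G);
    [exact: continuous_Complex|exact: cG].
by case: hpr => ->; [exact: continuous_re|exact: continuous_im].
Qed.

Lemma is_derive_origin (f g : R -> R) (x : R) : (forall t, g t = f (x + t)) ->
  derivable g 0 1 -> is_derive x 1 f (derive1 g 0).
Proof.
move=> gf; rewrite derive1E => /derivableP h; apply/is_deriveP_eps => e e0.
have [d d0 H] := (is_deriveP_eps _ _ _).1 h e e0; exists d => // k kd.
by have := H k kd; rewrite add0r !gf addr0.
Qed.

Definition first_order G := forall z,
  [/\ derivable (fun t : R => re (G (z + Complex t 0))) 0 1,
      derivable (fun t : R => im (G (z + Complex t 0))) 0 1,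
      derivable (fun t : R => re (G (z + Complex 0 t))) 0 1 &
      derivable (fun t : R => im (G (z + Complex 0 t))) 0 1].

Lemma part_dx pr G : is_part pr -> first_order G -> forall x y : R,
  is_derive x 1 (fun t : R => pr (G (Complex t y))) (pr (@dx R G (Complex x y))).
Proof.
move=> hpr dG x y; have [h1 h2 _ _] := dG (Complex x y).
have E (t : R) : (Complex x y : C) + Complex t 0 = Complex (x + t) y.
  by rewrite -[LHS]/(Complex (x + t) (y + 0)) addr0.
by case: hpr => ->; [apply: (is_derive_origin _ h1)|apply: (is_derive_origin _ h2)] => t; rewrite E.
Qed.

Lemma part_dy pr G : is_part pr -> first_order G -> forall x y : R,
  is_derive y 1 (fun t : R => pr (G (Complex x t))) (pr (@dy R G (Complex x y))).
Proof.
move=> hpr dG x y; have [_ _ h1 h2] := dG (Complex x y).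
have E (t : R) : (Complex x y : C) + Complex 0 t = Complex x (y + t).
  by rewrite -[LHS]/(Complex (x + 0) (y + t)) addr0.
by case: hpr => ->; [apply: (is_derive_origin _ h1)|apply: (is_derive_origin _ h2)] => t; rewrite E.
Qed.

Section smooth_part.
Variables (F : C -> C) (r : R).
Hypothesis sF : smooth F.
Hypothesis F0 : vanishes_beyond r F.
Variables (pr : C -> R) (x0 y0 : R).
Hypothesis hpr : is_part pr.

(** Positive and strictly larger than r, so that F and its derivatives vanish already where a
    coordinate equals M in absolute value. *)
Let M : R := `|r| + 1.

Let M0 : 0 < M. Proof. by rewrite ltr_wpDl. Qed.

Let P (p : R * R) := pr (F (Complex p.1 p.2)).
Let Px (p : R * R) := pr (@dx R F (Complex p.1 p.2)).
Let Py (p : R * R) := pr (@dy R F (Complex p.1 p.2)).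
Let Pxy (p : R * R) := pr (@dy R (@dx R F) (Complex p.1 p.2)).
Let Pyx (p : R * R) := pr (@dx R (@dy R F) (Complex p.1 p.2)).

Let pr0 : pr 0 = 0. Proof. by case: hpr => ->. Qed.

Let dPx (x y : R) : is_derive x 1 (fun t : R => P (t, y)) (Px (x, y)).
Proof. by have [_ [dF _ _]] := sF 2; exact: part_dx. Qed.

Let dPy (x y : R) : is_derive y 1 (fun t : R => P (x, t)) (Py (x, y)).
Proof. by have [_ [dF _ _]] := sF 2; exact: part_dy. Qed.

Let dPxy (x y : R) : is_derive y 1 (fun t : R => Px (x, t)) (Pxy (x, y)).
Proof. by have [_ [_ [_ [dF _ _]] _]] := sF 2; exact: part_dy. Qed.

Let dPyx' (x y : R) : is_derive x 1 (fun t : R => Py (t, y)) (Pyx (x, y)).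
Proof. by have [_ [_ _ [_ [dF _ _]]]] := sF 2; exact: part_dx. Qed.

Let cPx : continuous Px.
Proof. by have [_ [_ [cF _] _]] := sF 2; exact: part_continuous. Qed.

Let cPy : continuous Py.
Proof. by have [_ [_ _ [cF _]]] := sF 2; exact: part_continuous. Qed.

Let cPxy : continuous Pxy.
Proof. by have [_ [_ [_ [_ _ [cF _]]] _]] := sF 2; exact: part_continuous. Qed.

Let cPyx : continuous Pyx.
Proof. by have [_ [_ _ [_ [_ [cF _] _]]]] := sF 2; exact: part_continuous. Qed.

Let dPyx (x y : R) : is_derive x 1 (fun t : R => Py (t, y)) (Pxy (x, y)).
Proof. by rewrite (schwarz dPx dPy dPxy dPyx' cPxy cPyx); exact: dPyx'. Qed.

Let supp (p : R * R) : M <= `|p.1| \/ M <= `|p.2| -> [/\ P p = 0, Px p = 0, Py p = 0 & Pxy p = 0].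
Proof.
move=> hp; have rp : r < nm (Complex p.1 p.2 : C).
  have rM : r < M by rewrite (le_lt_trans (ler_norm _)) // ltrDl.
  case: hp => /(lt_le_trans rM) /lt_le_trans; apply; first exact: (re_le_nm (Complex p.1 p.2)).
  exact: (im_le_nm (Complex p.1 p.2)).
by rewrite /P /Px /Py /Pxy F0 // (beyond_dx F0) // (beyond_dy F0) // (beyond_dy (beyond_dx F0)).
Qed.

Lemma part_curl : plane_int (fun p => (p.1 - x0) / sq_dist x0 y0 p * Py p) =
  plane_int (fun p => (p.2 - y0) / sq_dist x0 y0 p * Px p).
Proof. exact: (plane_int_curl x0 y0 M0 dPxy dPyx cPx cPy cPxy supp). Qed.

Lemma part_div : plane_int (fun p => (p.1 - x0) / sq_dist x0 y0 p * Px p) +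
  plane_int (fun p => (p.2 - y0) / sq_dist x0 y0 p * Py p) = - (2 * pi * pr (F (Complex x0 y0))).
Proof. exact: (plane_int_div x0 y0 M0 dPy dPxy dPyx cPx cPy cPxy supp). Qed.

Lemma part_tame :
  [/\ tame x0 y0 M (fun p => (p.1 - x0) / sq_dist x0 y0 p * Px p),
      tame x0 y0 M (fun p => (p.2 - y0) / sq_dist x0 y0 p * Px p),
      tame x0 y0 M (fun p => (p.1 - x0) / sq_dist x0 y0 p * Py p) &
      tame x0 y0 M (fun p => (p.2 - y0) / sq_dist x0 y0 p * Py p)].
Proof. exact: (tame_terms x0 y0 M0 cPx cPy supp). Qed.

End smooth_part.

Lemma part_integrable F r pr (x0 y0 : R) : smooth F -> vanishes_beyond r F -> is_part pr ->
  let M := `|r| + 1 in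
  [/\ 0 < M, tame x0 y0 M (fun p => (p.1 - x0) / sq_dist x0 y0 p * pr (@dx R F (Complex p.1 p.2))),
      tame x0 y0 M (fun p => (p.2 - y0) / sq_dist x0 y0 p * pr (@dx R F (Complex p.1 p.2))),
      tame x0 y0 M (fun p => (p.1 - x0) / sq_dist x0 y0 p * pr (@dy R F (Complex p.1 p.2))) &
      tame x0 y0 M (fun p => (p.2 - y0) / sq_dist x0 y0 p * pr (@dy R F (Complex p.1 p.2)))].
Proof.
move=> sF F0 hpr M; have [t1 t2 t3 t4] := part_tame sF F0 x0 y0 hpr.
by split; [rewrite ltr_wpDl|exact: t1|exact: t2|exact: t3|exact: t4].
Qed.

Definition plane_integrable (H : C -> C) :=
  mu2.-integrable setT (fun p => (re (H (Complex p.1 p.2)))%:E) /\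
  mu2.-integrable setT (fun p => (im (H (Complex p.1 p.2)))%:E).

Lemma plane_integralD (H1 H2 : C -> C) : plane_integrable H1 -> plane_integrable H2 ->
  plane_integrable (fun z => H1 z + H2 z) /\
  plane_integral (fun z => H1 z + H2 z) = plane_integral H1 + plane_integral H2.
Proof.
move=> [r1 i1] [r2 i2]; split; first split.
- have := integrableD measurableT r1 r2; congr (integrable _ _ _).
  by apply/funext => p; rewrite /= reD.
- have := integrableD measurableT i1 i2; congr (integrable _ _ _).
  by apply/funext => p; rewrite /= imD.
- refine (@eq_reim R _ _ _ _); rewrite ?reD ?imD /=.
  + by rewrite -(RintegralD measurableT r1 r2); congr Rintegral; apply/funext => p; rewrite reD.
  + by rewrite -(RintegralD measurableT i1 i2); congr Rintegral; apply/funext => p; rewrite imD.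
Qed.

Lemma plane_integralZ (k : C) (H : C -> C) : plane_integrable H ->
  plane_integrable (fun z => k * H z) /\
  plane_integral (fun z => k * H z) = k * plane_integral H.
Proof.
move=> [r1 i1].
have rr := integrableZl measurableT (re k) r1; have ri := integrableZl measurableT (im k) i1.
have ir := integrableZl measurableT (im k) r1; have ii := integrableZl measurableT (re k) i1.
split; first split.
- have := integrableB measurableT rr ri; congr (integrable _ _ _).
  by apply/funext => p; rewrite /= reM.
- have := integrableD measurableT ii ir; congr (integrable _ _ _).
  by apply/funext => p; rewrite /= imM.
- refine (@eq_reim R _ _ _ _); rewrite ?reM ?imM /=.
  + rewrite -(RintegralZl (re k) measurableT r1) -(RintegralZl (im k) measurableT i1).
    rewrite -(RintegralB measurableT rr ri).
    by congr Rintegral; apply/funext => p; rewrite reM.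
  + rewrite -(RintegralZl (re k) measurableT i1) -(RintegralZl (im k) measurableT r1).
    rewrite -(RintegralD measurableT ii ir).
    by congr Rintegral; apply/funext => p; rewrite imM.
Qed.

Lemma plane_integral_sum (I : Type) (s : seq I) (c : I -> C) (H : I -> C -> C) :
  (forall i, plane_integrable (H i)) ->
  plane_integrable (fun z => \sum_(i <- s) c i * H i z) /\
  plane_integral (fun z => \sum_(i <- s) c i * H i z) = \sum_(i <- s) c i * plane_integral (H i).
Proof.
move=> iH; elim: s => [|i s [IHi IHs]].
  have E : (fun z => \sum_(i <- [::]) c i * H i z) = (fun=> 0).
    by apply/funext => z; rewrite big_nil.
  rewrite E big_nil /plane_integrable /plane_integral /=; split.
    by split; exact: integrable0.
  by rewrite /Rintegral integral0.
have E : (fun z => \sum_(j <- i :: s) c j * H j z) =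
    (fun z => c i * H i z + \sum_(j <- s) c j * H j z).
  by apply/funext => z; rewrite big_cons.
have [Zi Ze] := plane_integralZ (c i) (iH i); have [Di De] := plane_integralD Zi IHi.
by rewrite E; split=> //; rewrite big_cons De Ze IHs.
Qed.

Lemma re_inv_sub (z z0 : C) : re (z - z0)^-1 = (re z - re z0) / sq_dist (re z0) (im z0) (re z, im z).
Proof. by case: z z0 => x y [u v]. Qed.

Lemma im_inv_sub (z z0 : C) : im (z - z0)^-1 = - ((im z - im z0) / sq_dist (re z0) (im z0) (re z, im z)).
Proof. by case: z z0 => x y [u v]. Qed.

(** As 1/(z - z0) = ((x - x0) - i (y - y0)) / r^2, the real part of the integrand is the curl term
    of re F plus the divergence term of im F, and the imaginary part is the curl term of im F minus
    the divergence term of re F. The curl terms integrate to 0, and [part_div] leaves - 2 pi im F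
    and 2 pi re F at z0. *)
Lemma cauchy_pompeiu F r (z0 : C) : smooth F -> vanishes_beyond r F ->
  plane_integrable (fun z => (z - z0)^-1 * (@dy R F z - 'i * @dx R F z)) /\
  exterior_derivative (fun z => (z - z0)^-1) F = (2 * pi)%:C%C * 'i * F z0.
Proof.
move=> sF F0; set x0 := re z0; set y0 := im z0; pose z0F := F z0.
have pre : is_part (@re R) by left. have pim : is_part (@im R) by right.
have [M0 a1 a2 a3 a4] := part_integrable x0 y0 sF F0 pre.
have [_ b1 b2 b3 b4] := part_integrable x0 y0 sF F0 pim.
have E1 : (fun p : R * R => re ((Complex p.1 p.2 - z0)^-1 * (@dy R F (Complex p.1 p.2) - 'i * @dx R F (Complex p.1 p.2)))) =
  (fun p => ((p.1 - x0) / sq_dist x0 y0 p * re (@dy R F (Complex p.1 p.2)) -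
             (p.2 - y0) / sq_dist x0 y0 p * re (@dx R F (Complex p.1 p.2))) +
            ((p.1 - x0) / sq_dist x0 y0 p * im (@dx R F (Complex p.1 p.2)) +
             (p.2 - y0) / sq_dist x0 y0 p * im (@dy R F (Complex p.1 p.2)))).
  apply/funext => -[x y]; rewrite reM re_inv_sub im_inv_sub !(reD, imD, reN, imN, reM, imM) /=; ring.
have E2 : (fun p : R * R => im ((Complex p.1 p.2 - z0)^-1 * (@dy R F (Complex p.1 p.2) - 'i * @dx R F (Complex p.1 p.2)))) =
  (fun p => ((p.1 - x0) / sq_dist x0 y0 p * im (@dy R F (Complex p.1 p.2)) -
             (p.2 - y0) / sq_dist x0 y0 p * im (@dx R F (Complex p.1 p.2))) -
            ((p.1 - x0) / sq_dist x0 y0 p * re (@dx R F (Complex p.1 p.2)) +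
             (p.2 - y0) / sq_dist x0 y0 p * re (@dy R F (Complex p.1 p.2)))).
  apply/funext => -[x y]; rewrite imM re_inv_sub im_inv_sub !(reD, imD, reN, imN, reM, imM) /=; ring.
split.
  split.
    have := tame_integrable M0 (tameD (tameB a3 a2) (tameD b1 b4)).
    by congr (integrable _ _ _); apply/funext => p; have /(congr1 (fun f => f p)) := E1 => /= ->.
  have := tame_integrable M0 (tameB (tameB b3 b2) (tameD a1 a4)).
  by congr (integrable _ _ _); apply/funext => p; have /(congr1 (fun f => f p)) := E2 => /= ->.
rewrite /exterior_derivative /plane_integral E1 E2 -/(plane_int _) -/(plane_int _).
rewrite (plane_intD M0 (tameB a3 a2) (tameD b1 b4)) (plane_intB M0 a3 a2) (plane_intD M0 b1 b4).
rewrite (plane_intB M0 (tameB b3 b2) (tameD a1 a4)) (plane_intB M0 b3 b2) (plane_intD M0 a1 a4).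
have key (a b c d e f g h : R) : a = b -> e = f -> g + h = - (2 * pi * re z0F) ->
    c + d = - (2 * pi * im z0F) ->
    Complex (a - b + (c + d)) (e - f - (g + h)) = (2 * pi)%:C%C * 'i * z0F.
  move=> -> -> -> ->; apply: eq_reim; rewrite !(reM, imM) /=; ring.
have zE : (Complex x0 y0 : C) = z0 by rewrite /x0 /y0; case: (z0).
have d1 := part_div sF F0 x0 y0 pre; have d2 := part_div sF F0 x0 y0 pim.
rewrite zE in d1 d2.
exact: (key _ _ _ _ _ _ _ _ (part_curl sF F0 x0 y0 pre) (part_curl sF F0 x0 y0 pim) d1 d2).
Qed.

Lemma exterior_derivative_sum (I : Type) (s : seq I) (c p : I -> C) F r : smooth F ->
  vanishes_beyond r F ->
  exterior_derivative (fun z => \sum_(i <- s) c i / (z - p i)) F =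
  \sum_(i <- s) (2 * pi)%:C%C * 'i * (c i * F (p i)).
Proof.
move=> sF F0; rewrite /exterior_derivative.
have E : (fun z : C => (\sum_(i <- s) c i / (z - p i)) * (@dy R F z - 'i * @dx R F z)) =
    (fun z => \sum_(i <- s) c i * ((z - p i)^-1 * (@dy R F z - 'i * @dx R F z))).
  by apply/funext => z; rewrite big_distrl; apply: eq_bigr => i _; rewrite mulrA.
have [_ H] := plane_integral_sum s c (fun i => (cauchy_pompeiu (p i) sF F0).1).
rewrite E H; apply: eq_bigr => i _; have := (cauchy_pompeiu (p i) sF F0).2.
by rewrite /exterior_derivative => ->; rewrite mulrCA.
Qed.

End cauchy_pompeiu.

(** * Finite sums of simple poles *)

Section pole_sums.
Variable R : realType.
Local Notation C := (Cplx R).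

Lemma is_derive_derive1 (f : R -> R) (t d : R) : is_derive t 1 f d -> derive1 f t = d.
Proof. by rewrite derive1E => h; rewrite derive_val. Qed.

(** The Cauchy-Riemann equations: the derivatives along the axes are D and i D. *)
Lemma dbar_holomorphic (f : C -> C) (z D : C) : is_derive z 1 f D -> dbar f z = 0.
Proof.
move=> df.
have h (c : C) : is_derive (z + c * (0 : R)%:C%C) 1 f D by rewrite mulr0 addr0.
have Ex : (fun t : R => (Complex t 0 : C)) = (fun t => 1 * t%:C%C) by apply/funext => t; rewrite mul1r.
have Ey : (fun t : R => (Complex 0 t : C)) = (fun t => 'i * t%:C%C).
  by apply/funext => t; apply: eq_reim; rewrite !(reM, imM) /=; ring.
have line c (w : R -> C) : w = (fun t : R => c * t%:C%C) ->
    Complex (derive1 (fun t : R => re (f (z + w t))) 0) (derive1 (fun t : R => im (f (z + w t))) 0) = D * c.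
  move=> ->; apply: eq_reim.
    exact: is_derive_derive1 (is_derive_re_line (h c)).
  exact: is_derive_derive1 (is_derive_im_line (h c)).
have dxE : dx f z = D * 1 := line _ _ Ex.
have dyE : dy f z = D * 'i := line _ _ Ey.
have i2 : 'i * 'i = -1 :> C by rewrite -expr2 sqrCi.
by rewrite /dbar dxE dyE mulrCA i2 -mulrDr subrr mulr0 mul0r.
Qed.

Variables (I : finType) (res pole : I -> C).
Implicit Types (Q : pred I) (z : C).

(** Indices with zero residue do not count as poles; they will stand for singular points outside the
    chart. *)
Definition off_poles Q : set C := [set z | forall i, Q i -> res i != 0 -> z <> pole i].

Lemma open_off_poles Q : open (off_poles Q).
Proof.
pose q : {poly C} := \prod_(i | Q i && (res i != 0)) ('X - (pole i)%:P).
have := open_neq0 openT (@holomorphic_horner R setT q openT).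
congr open; apply/seteqP; split=> z /=; rewrite /q horner_prod.
  move=> [_ /prodf_neq0 h] i Qi ri; have := h i; rewrite Qi ri => /(_ isT).
  by rewrite hornerXsubC subr_eq0 => /eqP.
move=> h; split=> //; apply/prodf_neq0 => i /andP[Qi ri].
by rewrite hornerXsubC subr_eq0; apply/eqP; exact: h.
Qed.

Lemma holomorphic_pole_sum Q :
  holomorphic (off_poles Q) (fun z => \sum_(i | Q i) res i / (z - pole i)).
Proof.
have oU : open (off_poles Q) by exact: open_off_poles.
apply: (holomorphic_sum oU) => i Qi; have [->|ri] := eqVneq (res i) 0.
  have := @holomorphic_cst R (off_poles Q) 0.
  by apply: (holomorphic_on oU) => w _; rewrite mul0r.
apply: (holomorphic_div oU) => [w Uw||].
- by rewrite subr_eq0; apply/eqP; exact: Uw.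
- exact: holomorphic_cst.
- by apply: (holomorphicB oU); [exact: holomorphic_id|exact: holomorphic_cst].
Qed.

Hypothesis pole_inj : forall i j, res i != 0 -> res j != 0 -> pole i = pole j -> i = j.

Lemma pole_sum_simple i : res i != 0 ->
  simple_pole (fun z => \sum_j res j / (z - pole j)) (pole i).
Proof.
move=> ri; pose Q := [pred j | j != i]; have oU : open (off_poles Q) by exact: open_off_poles.
exists (off_poles Q), (fun z => res i + (z - pole i) * \sum_(j | Q j) res j / (z - pole j)); split.
- exact: oU.
- by move=> j Qj rj /(pole_inj ri rj) ji; rewrite /= ji eqxx in Qj.
- apply: (holomorphicD oU); first exact: holomorphic_cst.
  apply: (holomorphicM oU); last exact: holomorphic_pole_sum.
  by apply: (holomorphicB oU); [exact: holomorphic_id|exact: holomorphic_cst].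
- by rewrite subrr mul0r addr0.
- move=> z _ zi; rewrite (bigD1 i) //= mulrDl [_ * \sum_(_ | _) _]mulrC mulfK //.
  by rewrite subr_eq0.
Qed.

Lemma pole_sum_meromorphic z : meromorphic_at (fun z => \sum_j res j / (z - pole j)) z.
Proof.
have [[i ri zi]|h] := pselect (exists2 i, res i != 0 & z = pole i).
  have [V [g [oV Vz hg _ gE]]] := pole_sum_simple ri.
  by exists 1%N, V, g; split; rewrite ?zi.
exists 0%N, (off_poles predT), (fun z => \sum_j res j / (z - pole j)); split.
- exact: open_off_poles.
- by move=> i _ ri zi; apply: h; exists i.
- exact: holomorphic_pole_sum.
- by move=> w _ _; rewrite expr0 divr1.
Qed.

End pole_sums.

(** * The two charts of the projective line *)

Section charts.
Variable R : realType.
Local Notation C := (Cplx R).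
Implicit Types (c : chart) (z u v : C) (p : CP1 R).

(** The partial inverse of [pt c]. In the result [None] means that the point is outside the chart,
    whereas in the argument it is the point at infinity. *)
Definition chart_coord c p : option C :=
  match c, p with
  | chart_u, _ => p
  | chart_v, None => Some 0
  | chart_v, Some u => if u == 0 then None else Some (- u^-1)
  end.

Lemma chart_coordP c p z : chart_coord c p = Some z <-> p = pt c z.
Proof.
case: c => //=; case: p => [u|]; split.
- have [->//|u0] := eqVneq u 0; move=> [<-].
  by rewrite oppr_eq0 invr_eq0 (negbTE u0) invrN invrK opprK.
- case: ifP => // /negbT z0 [->].
  by rewrite oppr_eq0 invr_eq0 (negbTE z0) invrN invrK opprK.
- by move=> [<-]; rewrite eqxx.
- by case: ifP => // /eqP ->.
Qed.

Lemma chart_coord_pt c z : chart_coord c (pt c z) = Some z. Proof. exact/chart_coordP. Qed.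

Lemma pt_inj c : injective (@pt R c).
Proof. by move=> z w zw; have := chart_coord_pt c z; rewrite zw chart_coord_pt => -[]. Qed.

(** The estimate in [current] only sees the unit disc of each chart. Because u = - 1/v, the two
    discs cover the sphere. *)
Lemma unit_disc_cover p : exists c z, p = pt c z /\ `|z| <= 1.
Proof.
case: p => [u|]; last by exists chart_v, 0; rewrite /= eqxx normr0 ler01.
have [u1|u1] := leP (nm u) 1.
  by exists chart_u, u; split=> //; rewrite normE -[1]/((1 : R)%:C%C) lecR'.
have u0 : u != 0 by rewrite -nm_gt0 (lt_trans _ u1).
exists chart_v, (- u^-1); split; first by apply/chart_coordP => /=; rewrite (negbTE u0).
by rewrite normE -[1]/((1 : R)%:C%C) lecR' nmN nmV invf_le1 ?(lt_trans _ u1) // ltW.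
Qed.

Lemma derive1_NV u : u != 0 -> derive1 (fun t : C => - t^-1) u = u^-1 ^+ 2.
Proof.
move=> u0; have h := @is_derive_inv C id u 1 u0 (is_derive_id _ _).
rewrite (is_derive1E (is_deriveN h)); by rewrite mulN1r mulNr opprK expr2.
Qed.

Lemma supported_vanishes c (f : CP1 R -> C) : supported_in c f ->
  exists r, vanishes_beyond r (f \o pt c).
Proof.
move=> [r hr]; exists r => z rz /=; apply: hr => w wr /pt_inj zw.
by move: wr; rewrite -zw normE lecR' leNgt rz.
Qed.

Lemma outside_chart c (f : CP1 R -> C) p : supported_in c f -> chart_coord c p = None -> f p = 0.
Proof.
by move=> [r hr] pN; apply: hr => z _ /chart_coordP; rewrite pN.
Qed.

End charts.

(** * Frames, and the change of coordinates of a connection *)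

Section line_bundles.
Variable R : realType.
Local Notation C := (Cplx R).

(** The isomorphism sends frame to frame. With equal connection forms the covariant derivative has
    the same coefficient on both sides, so g = f works. *)
Lemma flat_isomorphic_same_form (X : set (CP1 R)) (U : set C) (E F : framed_bundle R) :
  open U -> X `<=` Some @` U -> flat_line_bundle U E -> flat_line_bundle U F ->
  (forall u, U u -> connection_form E u = connection_form F u) -> flat_isomorphic X E F.
Proof.
move=> oU XU fE fF EF; exists U; split => //.
pose coef u (s : fiber E u) : C := xget 0 [set k | s = k *: frame E u].
have coefE u s : U u -> s = @coef u s *: frame E u.
  by move=> Uu; have [k [sk _]] := fE.1 u Uu s; exact: (@xgetPex _ 0 [set k | s = k *: frame E u] (ex_intro _ k sk)).
have coefZ u (k : C) : U u -> @coef u (k *: frame E u) = k.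
  move=> Uu; have [k' [_ uk]] := fE.1 u Uu (k *: frame E u).
  by rewrite -(uk _ (coefE u _ Uu)) (uk k).
exists (fun u s => @coef u s *: frame F u); split=> [u Uu|W f oW WU hf].
  split.
    move=> k s t; rewrite {1}(coefE u s Uu) {1}(coefE u t Uu) scalerA -scalerDl coefZ //.
    by rewrite scalerDl scalerA.
  pose inv (t : fiber F u) : fiber E u := xget 0 [set k : C | t = k *: frame F u] *: frame E u.
  exists inv => s; rewrite /inv.
    have [k [sk uk]] := fF.1 u Uu (@coef u s *: frame F u).
    have xE : xget 0 [set l : C | coef u s *: frame F u = l *: frame F u] = coef u s.
      by apply: xget_unique => // l sl; rewrite -(uk _ sl) (uk (coef u s)).
    by rewrite xE -coefE.
  have [k [sk uk]] := fF.1 u Uu s; rewrite coefZ //; apply: esym.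
  exact: (@xgetPex _ 0 [set k : C | s = k *: frame F u] (ex_intro _ k sk)).
exists f; split=> // u Wu; rewrite coefZ //; try exact: WU.
by rewrite /covariant_derivative EF //; exact: WU.
Qed.

(** If [coef] is the coordinate with respect to e, every bilinear form is B (e, e) times the product
    form [B0] of two copies of [coef]. A functional s is thus determined by s [B0], and [square e]
    takes the value 1 there. *)
Lemma square_frame (V : lmodType C) (e : V) : (forall x : V, exists! k : C, x = k *: e) ->
  forall s : dual (inverse_square V), exists! k : C, s = k *: square e.
Proof.
move=> he; pose coef x : C := xget 0 [set k : C | x = k *: e].
have coefE x : x = coef x *: e.
  by have [k [xk _]] := he x; exact: (@xgetPex _ 0 [set k : C | x = k *: e] (ex_intro _ k xk)).
have coefU x k : x = k *: e -> coef x = k.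
  by move=> xk; have [k' [_ uk]] := he x; rewrite -(uk _ (coefE x)) (uk k).
have coefL (k : C) (x y : V) : coef (k *: x + y) = k * coef x + coef y.
  by apply: coefU; rewrite {1}(coefE x) {1}(coefE y) scalerA -scalerDl.
have bB : (fun p : V * V => coef p.1 * coef p.2 : C^o) \in @is_bilinear_form C V.
  apply/asboolP => x; split=> k y z; rewrite /= coefL /GRing.scale /=; ring.
pose B0 := InverseSquare bB.
have BE (B : inverse_square V) : B = B (e, e) *: B0.
  have /asboolP bil : bilinear_fun B \in @is_bilinear_form C V by case: B.
  apply: val_inj; apply/funext => -[x y] /=.
  have [lx _] := bil x; have [_ rx] := bil e.
  have s1 : B (x, y) = coef y * B (x, e).
    have := lx (coef y) e 0; rewrite addr0 -coefE => ->.
    have := lx (-1) 0 0; rewrite scaler0 addr0 => h.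
    by have -> : B (x, 0) = 0; [move: h; rewrite scaleN1r addNr|rewrite addr0].
  have s2 : B (x, e) = coef x * B (e, e).
    have := rx (coef x) e 0; rewrite addr0 -coefE => ->.
    have := rx (-1) 0 0; rewrite scaler0 addr0 => h.
    by have -> : B (0, e) = 0; [move: h; rewrite scaleN1r addNr|rewrite addr0].
  have key (b c d : C) : d * (c * b) = b * (c * d) by ring.
  by rewrite [LHS]s1 s2; exact: key.
have ce : coef e = 1 by apply: coefU; rewrite scale1r.
move=> s; exists (s B0); split.
  apply: val_inj; apply/funext => B /=.
  have /asboolP ls : dual_fun s \in @is_dual C (inverse_square V) by case: s.
  have := ls (B (e, e)) B0 0; rewrite addr0 -BE => ->.
  have := ls (-1) 0 0; rewrite scaler0 addr0 => h.
  have -> : s 0 = 0 by move: h; rewrite scaleN1r addNr.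
  by rewrite addr0; exact: (mulrC (B (e, e) : C) (s B0 : C)).
by move=> k ->; rewrite -[LHS]/(k * (coef e * coef e)) ce !mulr1.
Qed.

Lemma cotangent_components (p : CP1 R) (alpha : cotangent p) : components alpha \in is_cotangent p.
Proof. by case: alpha. Qed.

Lemma coordinate_vector_u_frame (u : C) (s : anticanonical (Some u)) :
  exists! k : C, s = k *: coordinate_vector chart_u (Some u).
Proof.
pose d : C := derive1 (fun t : C => - t^-1) u.
have d0 : u != 0 -> d != 0.
  by move=> u0; rewrite /d derive1_NV // expf_neq0 // invr_eq0.
(* The components of du: off u = 0 its dv-component is du/dv = 1/d, and at u = 0, outside the chart
   of v, it is 0 by convention. *)
pose comp (c : chart) : C^o := if c is chart_u then 1 else if u == 0 then 0 else d^-1.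
have hc : comp \in is_cotangent (Some u).
  apply/asboolP; case: ifP => [u0|/negbT u0]; rewrite /comp ?u0 // (negbTE u0) -/d mulVf //; exact: d0.
pose e := Cotangent hc.
have aE (alpha : cotangent (Some u)) : alpha = alpha chart_u *: e.
  have /asboolP := cotangent_components alpha.
  rewrite -/d => ha; apply: val_inj; apply/funext => -[] /=.
    exact: esym (mulr1 (alpha chart_u : C)).
  rewrite -[RHS]/((alpha chart_u : C) * (comp chart_v : C)) /comp; case: ifP ha => [_ ->|/negbT u0 ->].
    by rewrite mulr0.
  by rewrite mulfK // d0.
exists (s e); split.
  apply: val_inj; apply/funext => alpha /=.
  have /asboolP ls : dual_fun s \in @is_dual C (cotangent (Some u)) by case: s.
  have := ls (alpha chart_u) e 0; rewrite addr0 -aE => ->.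
  have := ls (-1) 0 0; rewrite scaler0 addr0 => h.
  have -> : s 0 = 0 by move: h; rewrite scaleN1r addNr.
  by rewrite addr0; exact: (mulrC (alpha chart_u : C) (s e : C)).
by move=> k ->; exact: (mulr1 (k : C)).
Qed.

Lemma coordinate_change (v a b : C) : v != 0 ->
  a *: coordinate_vector chart_u (pt chart_v v) = b *: coordinate_vector chart_v (pt chart_v v)
  <-> b = v ^+ 2 * a.
Proof.
move=> v0; rewrite /= (negbTE v0); set u := - v^-1.
have u0 : u != 0 by rewrite oppr_eq0 invr_eq0.
have dE : derive1 (fun t : C => - t^-1) u = v ^+ 2.
  by rewrite derive1_NV // /u invrN invrK sqrrN.
split.
  pose comp (c : chart) : C^o := if c is chart_u then v ^+ 2 else 1.
  have hc : comp \in is_cotangent (Some u).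
    by apply/asboolP; rewrite (negbTE u0) dE /comp mul1r.
  move=> /(congr1 (fun s : anticanonical (Some u) => s (Cotangent hc))).
  by rewrite -[X in X = _ -> _]/(a * v ^+ 2) -[X in _ = X -> _]/(b * 1) mulr1 mulrC => ->.
move=> ->; apply: val_inj; apply/funext => alpha /=.
have /asboolP := cotangent_components alpha.
rewrite (negbTE u0) dE => ha.
have key (x y : C) : a * (y * x) = x * a * y by ring.
rewrite -[LHS]/(a * alpha chart_u) ha; exact: key.
Qed.

(** Differentiating v^2 f (- 1/v) yields f' + 2 v f, and the term 2 v f is cancelled by - 2 / v
    times v^2 f. The coefficient 2 is the degree of the anti-canonical bundle. *)
Lemma connection_coordinate_change (au av f g : C -> C) (W : set C) (v : C) : open W ->
  (forall w, W w -> w != 0) -> holomorphic [set - w^-1 | w in W] f ->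
  (forall w, W w -> g w = w ^+ 2 * f (- w^-1)) -> W v ->
  av v = au (- v^-1) / v ^+ 2 - 2 / v ->
  covariant_derivative av g v = covariant_derivative au f (- v^-1).
Proof.
move=> oW W0 hf gf Wv avE; have v0 := W0 v Wv.
have fU : [set - w^-1 | w in W] (- v^-1) by exists v.
have df := holomorphic_is_derive hf fU.
have dn : is_derive v 1 (fun t : C => - t^-1) (v^-1 ^+ 2).
  have h := @is_derive_inv C id v 1 v0 (is_derive_id _ _).
  by have := is_deriveN h; rewrite mulN1r mulNr opprK expr2.
have dfn := is_derive_compC dn df.
have d2 : is_derive v 1 (fun t : C => t ^+ 2) (1 * v + v * 1).
  exact: is_derive_mul (is_derive_id v 1) (is_derive_id v 1).
have dg := is_derive_on oW Wv (fun w Ww => esym (gf w Ww)) (is_derive_mul d2 dfn).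
rewrite /covariant_derivative (is_derive1E dg) gf // avE.
move: (derive1 f _) (f _) (au _) => x y z; field; exact: v0.
Qed.

End line_bundles.

(** * Polynomials with prescribed root multiplicities *)

Section factored_discriminant.
Variable F : fieldType.
Implicit Types (D : {poly F}).

Lemma prod_XsubC_dvd (I : eqType) (s : seq I) (x : I -> F) (m : I -> nat) D : uniq s ->
  {in s &, injective x} -> D != 0 -> (forall i, i \in s -> mup (x i) D = m i) ->
  \prod_(i <- s) ('X - (x i)%:P) ^+ m i %| D.
Proof.
elim: s => [|i s IHs]; first by rewrite big_nil dvd1p.
rewrite /= => /andP[is_ us] xinj D0 mx; rewrite big_cons Gauss_dvdp.
  rewrite IHs ?andbT //; last first.
  - by move=> j js; apply: mx; rewrite inE js orbT.
  - by move=> j k js ks; apply: xinj; rewrite inE ?js ?ks orbT.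
  by rewrite -mup_geq // mx // inE eqxx.
apply: coprimep_expl; rewrite coprimep_sym coprimep_XsubC.
rewrite /root horner_prod prodf_seq_neq0; apply/allP => j js /=.
rewrite horner_exp hornerXsubC expf_neq0 // subr_eq0; apply: contraNneq is_.
by move=> /xinj ->; rewrite ?inE ?eqxx ?js ?orbT.
Qed.

Lemma horner_deriv_prod (I : Type) (s : seq I) (x : I -> F) (m : I -> nat) (u : F) :
  (forall i, u != x i) ->
  let q := \prod_(i <- s) ('X - (x i)%:P) ^+ m i in
  q^`().[u] = q.[u] * \sum_(i <- s) (m i)%:R / (u - x i).
Proof.
move=> ux /=; elim: s => [|i s IHs]; first by rewrite !big_nil derivC horner0 mulr0.
have u0 : u - x i != 0 by rewrite subr_eq0.
rewrite !big_cons derivM hornerD !hornerM IHs deriv_exp derivXsubC mul1r.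
rewrite hornerMn !horner_exp hornerXsubC.
have -> : (u - x i) ^+ (m i).-1 *+ m i = (u - x i) ^+ m i * ((m i)%:R / (u - x i)).
  case: (m i) => [|n]; first by rewrite mulr0n mul0r mulr0.
  by rewrite exprSr -mulr_natr /=; field.
rewrite mulrDr; congr (_ + _); first by rewrite -mulrA [_ * (_.[u])]mulrC mulrA.
by rewrite !mulrA.
Qed.

Lemma size_prod_XsubC_exp (I : Type) (s : seq I) (x : I -> F) (m : I -> nat) :
  size (\prod_(i <- s) ('X - (x i)%:P) ^+ m i) = (\sum_(i <- s) m i).+1.
Proof.
elim: s => [|i s IHs]; first by rewrite !big_nil size_poly1.
have mon (j : I) : ('X - (x j)%:P) ^+ m j \is monic by rewrite monic_exp // monicXsubC.
rewrite !big_cons size_monicM ?IHs ?size_exp_XsubC ?addSn ?addnS //.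
by apply: monic_neq0; apply: monic_prod.
Qed.

(** Powers of linear factors at distinct points are coprime, so their product divides D; equality of
    degrees leaves a constant. *)
Lemma factored (I : finType) (x : I -> F) (m : I -> nat) D : injective x -> D != 0 ->
  (forall i, mup (x i) D = m i) -> size D = (\sum_i m i).+1 ->
  exists2 c : F, c != 0 & D = c *: \prod_i ('X - (x i)%:P) ^+ m i.
Proof.
move=> xinj D0 mx sD.
have dv : \prod_i ('X - (x i)%:P) ^+ m i %| D.
  by apply: prod_XsubC_dvd => //; [exact: index_enum_uniq|move=> i j _ _; exact: xinj].
have := dvdp_size_eqp dv; rewrite size_prod_XsubC_exp sD eqxx => /esym/eqpP[[c1 c2] /= /andP[c10 c20] E].
exists (c2^-1 * c1); first by rewrite mulf_neq0 // invr_eq0.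
by rewrite -scalerA E scalerA mulVf // scale1r.
Qed.

End factored_discriminant.

Lemma sum_option (V : nmodType) (I : finType) (f : option I -> V) :
  \sum_i f i = f None + \sum_i f (Some i).
Proof.
rewrite (bigD1 None) //=; congr (_ + _).
rewrite (reindex_omap Some id) => [|[i|] //].
by apply: eq_bigl => i; rewrite /= eqxx.
Qed.

(** * The connection, its restriction and its curvature *)

Section connection_on_surface.
Variable R : realType.
Local Notation C := (Cplx R).
Variables (Nf K : nat) (us : 'I_K -> C) (k : 'I_K -> nat) (g2 g3 : {poly C}).
Hypothesis surface : rational_elliptic_surface Nf us k g2 g3.

Let Sing : set (CP1 R) := [set None] `|` range (fun n => Some (us n)).

(* Indices are the singular points: Some n is u_n, None is infinity. *)
Definition weight (i : option 'I_K) : C :=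
  if i is Some n then (k n)%:R / 6 else (10 - Nf)%:R / 6.
Definition point (i : option 'I_K) : CP1 R := omap us i.
(** A singular point outside the chart gets residue 0 and the dummy pole 0, so that the forms of
    both charts are sums over the same index set. The minus sign is that of the dual connection. *)
Definition residue c i : C := if chart_coord c (point i) is Some _ then - weight i else 0.
Definition pole c i : C := odflt 0 (chart_coord c (point i)).
Definition pole_form c z : C := \sum_i residue c i / (z - pole c i).

Lemma weight_neq0 i : weight i != 0.
Proof.
case: i => [n|] /=; rewrite mulf_neq0 ?invr_eq0 // pnatr_eq0 -lt0n.
  by have [] := fiber_us surface n.
by rewrite subn_gt0 (leq_ltn_trans (Nf_le4 surface)).
Qed.

Lemma sum_weight : \sum_i weight i = 2.
Proof.
rewrite sum_option /= -mulr_suml -natr_sum (sum_k surface) -mulrDl -natrD.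
(* The subtraction [10 - Nf] is exact because Nf <= 4; the numerators add up to 12. *)
rewrite addnA subnK ?(leq_trans (Nf_le4 surface)) //.
by have -> : (12%:R : C) = 2 * 6%:R; [rewrite -natrM|rewrite mulfK // pnatr_eq0].
Qed.

Lemma SingE p : Sing p <-> exists i, p = point i.
Proof.
split=> [[->|[n _ <-]]|[[n|] ->]]; [by exists None|by exists (Some n)| |by left].
by right; exists n.
Qed.

Lemma point_inj : injective point.
Proof. by move=> [n|] [m|] //= [] /(us_inj surface) ->. Qed.

Lemma residueP c i : residue c i != 0 <-> point i = pt c (pole c i).
Proof.
rewrite /residue /pole; split; last first.
  move=> /chart_coordP -> /=; rewrite oppr_eq0; exact: weight_neq0.
by case E: (chart_coord c (point i)) => [z|]; rewrite ?eqxx // => _; apply/chart_coordP.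
Qed.

Lemma pole_inj c i j : residue c i != 0 -> residue c j != 0 -> pole c i = pole c j -> i = j.
Proof. by move=> /residueP pi /residueP pj ij; apply: point_inj; rewrite pi pj ij. Qed.

Lemma sing_pole c z : Sing (pt c z) <-> exists2 i, residue c i != 0 & z = pole c i.
Proof.
split=> [/SingE[i ip]|[i /residueP ri ->]]; last by apply/SingE; exists i.
have zi : chart_coord c (point i) = Some z by apply/chart_coordP.
exists i; last by rewrite /pole zi.
by rewrite /residue zi oppr_eq0 weight_neq0.
Qed.

Lemma regularE c : [set z | ~ Sing (pt c z)] = off_poles (residue c) (pole c) predT.
Proof.
apply/seteqP; split=> z /= h.
  by move=> i _ ri zi; apply: h; apply/sing_pole; exists i.
by move=> /sing_pole[i ri zi]; exact: (h i isT ri zi).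
Qed.

Lemma form_regular_singular : regular_singular_points Sing pole_form.
Proof.
split=> [c|c z /sing_pole[i ri ->]].
  by rewrite regularE; exact: holomorphic_pole_sum.
exact: (pole_sum_simple (@pole_inj c)).
Qed.

Lemma form_integrable : integrable_connection Sing pole_form.
Proof.
move=> c z nz; have h := form_regular_singular.1 c.
exact: dbar_holomorphic (holomorphic_is_derive h nz).
Qed.

Lemma form_chart_u u : pole_form chart_u u = - \sum_n (k n)%:R / 6 / (u - us n).
Proof.
rewrite /pole_form sum_option /residue /= mul0r add0r -sumrN.
by apply: eq_bigr => n _; rewrite /pole /= mulNr.
Qed.

(** By [sum_weight], 2 / v is distributed over the singular points as weight / v. The claim then
    holds point by point: w v^-2 / (v^-1 + p) - w / v = - w / (v + 1 / p) for p = us n, and infinity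
    supplies the pole at v = 0. *)
Lemma form_change v : v != 0 -> ~ Sing (pt chart_v v) ->
  pole_form chart_v v = pole_form chart_u (- v^-1) / v ^+ 2 - 2 / v.
Proof.
move=> v0 nv; rewrite form_chart_u {1}/pole_form sum_option /residue /pole /= subr0.
rewrite -sum_weight sum_option mulrDl mulNr -[LHS]addrC opprD addrA.
rewrite [RHS]addrAC; congr (_ - _); rewrite mulNr !mulr_suml -!sumrN -big_split /=; apply: eq_bigr => n _.
have un : 1 + us n * v != 0.
  apply/negP => /eqP h; apply: nv; apply/SingE; exists (Some n); rewrite /= (negbTE v0).
  congr Some; apply: (mulIf v0); rewrite mulNr mulVf //; apply/eqP.
  by rewrite eq_sym -subr_eq0 opprK addrC h.
move: ((k n)%:R / 6) => w.
have vu : - v^-1 - us n = - ((1 + us n * v) / v) by field.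
(* The point u = 0 is outside the chart of v: its residue is 0, and the two terms on the right
   cancel. *)
rewrite vu; have [->|u0] := eqVneq (us n) 0.
  by rewrite !mul0r addr0; field.
have -> : v - (- (us n)^-1) = (1 + us n * v) / us n by field.
by field; rewrite v0 un u0.
Qed.

Lemma form_meromorphic : meromorphic_connection Sing pole_form.
Proof.
split=> [c z|W f g oW W0 hg hf fg v Wv]; first exact: (pole_sum_meromorphic (@pole_inj c)).
have [v0 nv] := W0 v Wv.
have gf w : W w -> g w = w ^+ 2 * f (- w^-1).
  by move=> Ww; apply/(coordinate_change _ _ (W0 w Ww).1); exact: fg.
rewrite (connection_coordinate_change oW (fun w Ww => (W0 w Ww).1) hf gf Wv (form_change v0 nv)).
rewrite scalerA; apply/esym/(coordinate_change _ _ v0).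
by rewrite derive1_NV // mulrA -exprMn divff // expr1n mul1r.
Qed.

(** The multiplicities k n exhaust the degree Nf + 2. *)
Lemma discriminant_factored : exists2 c : C, c != 0 &
  discriminant g2 g3 = c *: \prod_n ('X - (us n)%:P) ^+ k n.
Proof.
have D0 : discriminant g2 g3 != 0 by rewrite -size_poly_eq0 (size_discriminant surface).
apply: factored => //; first exact: us_inj surface.
  by move=> n; have [] := fiber_us surface n.
by rewrite (size_discriminant surface) (sum_k surface) addn2.
Qed.

Lemma discriminant_neq0 u : (forall n, u != us n) -> (discriminant g2 g3).[u] != 0.
Proof.
move=> un; have [c c0 ->] := discriminant_factored.
rewrite hornerZ mulf_neq0 // horner_prod; apply/prodf_neq0 => n _.
by rewrite horner_exp hornerXsubC expf_neq0 // subr_eq0.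
Qed.

Lemma bismut_freed_form u : (forall n, u != us n) -> - bismut_freed g2 g3 u = pole_form chart_u u.
Proof.
move=> un; have := discriminant_neq0 un; have [c c0 DE] := discriminant_factored.
rewrite /bismut_freed DE derivZ !hornerZ (horner_deriv_prod _ _ un).
rewrite mulf_eq0 negb_or => /andP[_]; move: (_.[u]) => q q0.
rewrite form_chart_u; congr (- _).
have -> : \sum_n (k n)%:R / 6 / (u - us n) = (\sum_n (k n)%:R / (u - us n)) / 6.
  by rewrite mulr_suml; apply: eq_bigr => n _; rewrite mulrAC.
by move: (\sum_n _) => s; field; rewrite q0 c0.
Qed.

(** The isomorphism is defined over the whole complement of the singular points, an open set
    containing [UP]. There the discriminant is nonzero, so E_u is smooth and [H10_dim1] makes (dz)^2
    a frame. *)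
Lemma restriction_isomorphic (r : 'I_K -> R) (r' : R) : (forall n, 0 < r n) -> 0 < r' ->
  flat_isomorphic (UP us r r') (restricted_anticanonical pole_form) (dual_DET g2 g3).
Proof.
move=> r0 r'0; pose U := [set u : C | ~ Sing (pt chart_u u)].
have Uus u : U u -> forall n, u != us n.
  by move=> Uu n; apply: contra_not_neq Uu => ->; right; exists n.
have hU : holomorphic U (pole_form chart_u) by exact: form_regular_singular.1.
have oU : open U by rewrite /U regularE; exact: open_off_poles.
have EF u : U u -> connection_form (restricted_anticanonical pole_form) u =
    connection_form (dual_DET g2 g3) u.
  by move=> Uu; rewrite /= bismut_freed_form //; exact: Uus.
apply: (flat_isomorphic_same_form oU _ _ _ EF).
- move=> [u|] Xu; last first.
    exfalso; apply: Xu; right; exists 0; last by rewrite /= eqxx.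
    by rewrite subrr normr0 -[0]/((0 : R)%:C%C) ltcR'.
  exists u => // -[//|[n _ [un]]]; apply: Xu; left; exists n => //; exists u => //.
  by rewrite un subrr normr0 -[0]/((0 : R)%:C%C) ltcR'.
- by split; [move=> u Uu s; exact: coordinate_vector_u_frame|exact: hU].
- split=> [u Uu s|]; last first.
    exact: (holomorphic_on oU EF hU).
  apply: square_frame => om; apply: H10_dim1.
  have := discriminant_neq0 (Uus u Uu).
  by rewrite /discriminant hornerD hornerN hornerZ !horner_exp.
Qed.

Definition curvature (f : CP1 R -> C) : C :=
  \sum_i (2 * pi)%:C%C * 'i * (- weight i * f (point i)).

Lemma curvature_currentP : curvature_current pole_form curvature.
Proof.
split; last first.
  move=> c f sf supp; have [r rf] := supported_vanishes supp.
  rewrite [RHS](exterior_derivative_sum _ _ _ (sf c) rf); apply: eq_bigr => i _.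
  congr (_ * _); rewrite /residue /pole /=.
  case E: (chart_coord c (point i)) => [z|] /=; first by rewrite -((chart_coordP _ _ _).1 E).
  (* At a point outside the chart f vanishes by the support condition, and the residue is 0. *)
  by rewrite (outside_chart supp E) mulr0 mul0r.
split.
  move=> l f g _ _; rewrite /curvature mulr_sumr -big_split /=; apply: eq_bigr => i _; ring.
(* The current has order 0: a combination of point values is bounded by the values of f alone. *)
exists (2 * pi * \sum_i nm (weight i)), 0%N => f B sf bound.
have fB i : nm (f (point i)) <= B.
  have [c [z [-> z1]]] := unit_disc_cover (point i).
  by have := bound c z 0%N 0%N z1 isT; rewrite /= normE lecR'.
rewrite normE lecR' /curvature -mulr_sumr nmM.
have nmi : nm ((2 * pi)%:C%C * 'i : C) = 2 * pi.
  by rewrite nmM nmR ger0_norm ?mulr_ge0 ?pi_ge0 // /nm /= expr0n expr1n /= add0r sqrtr1 mulr1.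
rewrite nmi -[leRHS]mulrA ler_wpM2l ?mulr_ge0 ?pi_ge0 //.
have nm_sum (s : seq (option 'I_K)) (h : option 'I_K -> C) : nm (\sum_(i <- s) h i) <= \sum_(i <- s) nm (h i).
  elim: s => [|i s IHs]; first by rewrite !big_nil nm0.
  by rewrite !big_cons (le_trans (nmD _ _)) // lerD2l.
rewrite (le_trans (nm_sum _ _)) // mulr_suml ler_sum // => i _.
by rewrite nmM nmN ler_wpM2l ?nm_ge0.
Qed.

Lemma curvature_value (f : CP1 R -> C) : 'i * curvature f / (2 * pi)%:C%C =
  \sum_n (k n)%:R / 6 * f (Some (us n)) + (10 - Nf)%:R / 6 * f None.
Proof.
have pi0 : (2 * pi)%:C%C != 0 :> C.
  by rewrite (inj_eq (@complexI R) _ 0) mulf_neq0 // gt_eqF // pi_gt0.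
rewrite /curvature -mulr_sumr.
have -> : \sum_i - weight i * f (point i) = - \sum_i weight i * f (point i).
  by rewrite -sumrN; apply: eq_bigr => i _; rewrite mulNr.
rewrite sum_option /= addrC; move: (_ + _) => s.
have i2 : 'i * 'i = -1 :> C by rewrite -expr2 sqrCi.
rewrite mulrN mulrN !mulrA [_ * _%:C%C]mulrC -[X in - (X * _)]mulrA i2 mulrN1 mulNr opprK.
by rewrite mulrAC mulfV ?mul1r.
Qed.

End connection_on_surface.

Theorem proposition7p6 (R : realType) (Nf K : nat) (us : 'I_K -> Cplx R)
    (k : 'I_K -> nat) (g2 g3 : {poly Cplx R}) :
  rational_elliptic_surface Nf us k g2 g3 ->
  let Sing : set (CP1 R) := [set None] `|` range (fun n => Some (us n)) in
  exists a : chart -> Cplx R -> Cplx R,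
    [/\ meromorphic_connection Sing a,
        integrable_connection Sing a,
        regular_singular_points Sing a,
        forall (r : 'I_K -> R) (r' : R), (forall n, 0 < r n) -> 0 < r' ->
          flat_isomorphic (UP us r r') (restricted_anticanonical a)
            (dual_DET g2 g3) &
        exists2 Om : (CP1 R -> Cplx R) -> Cplx R, curvature_current a Om &
          (forall f, smooth_CP1 f ->
             'i * Om f / (2 * pi)%:C%C =
             \sum_n (k n)%:R / 6 * f (Some (us n)) + (10 - Nf)%:R / 6 * f None) /\
          'i * Om (fun=> 1) / (2 * pi)%:C%C = 2].
Proof.
move=> surface Sing; exists (pole_form Nf us k); split.
- exact: form_meromorphic surface.
- exact: form_integrable surface.
- exact: form_regular_singular surface.
- by move=> r r' r0 r'0; exact: restriction_isomorphic surface _ _ r0 r'0.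
exists (curvature Nf us k); first exact: curvature_currentP.
split=> [f _|]; first exact: curvature_value.
(* On the constant function 1 the formula becomes the sum of all weights. *)
rewrite curvature_value -(sum_weight surface) sum_option addrC /= mulr1; congr (_ + _).
by apply: eq_bigr => n _; rewrite mulr1.
Qed.
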